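(* Let $d\ge 3$ be an integer and $M$ a finite set. For any $\mu\in\mathcal I_d(M)$ and any integer $r\ge 1$, $$\bar h(\mu,r)\le \Sigma_r(\mu)\qquad\text{and}\qquad \bar h(\mu)\le\Sigma(\mu).$$
   Context: **Processes.** $T_d$ is the infinite $d$-regular tree with root $o$, whose neighbors are labeled $1,\dots,d$. $\mathcal I_d(M)$ is the set of probability measures on $M^{T_d}$ invariant under all automorphisms of $T_d$. **Random labeling and topology.** Let $\mathbb N=\{1,2,\dots\}$ and $\mathbb N^f=\bigcup_{k\ge0}\mathbb N^k$ with $\mathbb N^0=\{o\}$. A rooted $M$-colored graph $(G,f,v)$ is a connected graph $G$ with a map $f$ from its vertices to $M$ and a distinguished vertex $v$. If $G$ is locally finite, its randomly labeled version is the isomorphic random rooted colored graph on a subset of $\mathbb N^f$ given by the breadth-first search from the root with ties broken uniformly at random: the root gets label $o$, and the $j$-th offspring of the vertex labeled $(i_1,\dots,i_{k-1})$ gets label $(i_1,\dots,i_{k-1},j)$. $\mathcal G^\bullet_M$ is the set of rooted colored graphs arising as such labelings, with metric $\sum_{r\ge0}2^{-r}\mathbf 1_{g_r\ne g'_r}$, where $g_r$ is the restriction of $g$ to vertices at distance at most $r$ from the root. Fix a distance $\mathrm d$ on $\mathcal P(\mathcal G^\bullet_M)$ (probability measures) generating the weak topology (e.g. Lévy–Prohorov; the entropies below do not depend on this choice). $T_d$ is built on a subset of $\mathbb N^f$ in this way, and $\mu\in\mathcal I_d(M)$ is identified with the law of $(T_d,X,o)$, $X\sim\mu$. For $\nu\in\mathcal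 P(\mathcal G^\bullet_M)$, $\nu_r$ is the law of the restriction to vertices at distance at most $r$ from the root. For a finite graph $G$ with vertex set $V$ and $f:V\to M$, $\mathrm{distr}_G(f)=\frac1{|V|}\sum_{v\in V}\mathrm{distr}_{G,v}(f)$, where $\mathrm{distr}_{G,v}(f)$ is the law of the randomly labeled version of the connected component of $v$ in $(G,f)$, rooted at $v$. **Sofic entropies.** For $n\ge d+1$ with $nd$ even, $\mathcal G_n(d)$ is the set of simple $d$-regular graphs on $[n]=\{1,\dots,n\}$ and $G_n$ is uniform on $\mathcal G_n(d)$; all limits in $n$ are along such $n$. For $\epsilon>0$, $r\ge0$, set $\mathcal F_G(\mu,r,\epsilon)=\{f\in M^n:\mathrm d(\mathrm{distr}_G(f)_r,\mu_r)\le\epsilon\}$ and $H_G(\mu,r,\epsilon)=\frac1n\log|\mathcal F_G(\mu,r,\epsilon)|\in\{-\infty\}\cup[0,\infty)$. For $0<\alpha<1$, let $h_n(\mu,r,\epsilon,\alpha)=\sup\{h\in\{-\infty\}\cup[0,\infty):\mathbb P(H_{G_n}(\mu,r,\epsilon)\ge h)\ge\alpha\}$, $\bar h(\mu,r,\alpha)=\lim_{\epsilon\to0}\limsup_{n}h_n(\mu,r,\epsilon,\alpha)$ and $\underline h(\mu,r,\alpha)=\lim_{\epsilon\to0}\liminf_n h_n(\mu,r,\epsilon,\alpha)$. These do not depend on $\alpha\in(0,1)$; the common values are $\bar h(\mu,r)$ and $\underline h(\mu,r)$. They are non-increasing in $r$, and $\bar h(\mu)=\lim_{r\to\infty}\bar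 h(\mu,r)$, $\underline h(\mu)=\lim_{r\to\infty}\underline h(\mu,r)$. **Annealed entropy.** $B_r(S)$ is the set of vertices of $T_d$ at distance at most $r$ from $S$; for $r\ge1$, $S_r=B_r(o)$ and $E_r=B_{r-1}(\{o,1\})$. $H$ is Shannon entropy (natural logarithm). For $X\sim\mu\in\mathcal I_d(M)$ and $r\ge1$, $\Sigma_r(\mu)=H(X_{S_r})-\frac d2H(X_{E_r})$, where $X_S$ is the restriction of $X$ to $S$. $\Sigma_r(\mu)$ is non-increasing in $r$ and $\Sigma(\mu)=\lim_{r\to\infty}\Sigma_r(\mu)$. *)

(* Defs.v *)
From HB Require Import structures.
From mathcomp Require Import all_boot all_order all_algebra finmap perm.
From mathcomp Require Import all_classical all_reals all_analysis.
From mathcomp Require Import lra zify.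

Set Implicit Arguments.
Unset Strict Implicit.
Unset Printing Implicit Defensive.
Import Order.TTheory GRing.Theory Num.Theory.
Import numFieldNormedType.Exports.
Local Open Scope classical_set_scope.
Local Open Scope ring_scope.

(* Measurable types are pointed in MathComp-Analysis, so the finite set of colors
   carries a distinguished element; that element plays no role besides
   providing default values. *)
#[short(type="finPointedType")]
HB.structure Definition FinPointed := {T of Finite T & Pointed T}.

Definition label := seq nat.

(* A rooted M-colored graph on a subset of N^f, with root [::]: the vertices are
   the labels l with color l <> None. *)
Record lgraph (M : Type) := LGraph {
  color : label -> option M ;
  edge : rel label }.

Lemma lgraph_ext M (g h : lgraph M) :
  color g =1 color h -> edge g =2 edge h -> g = h.
Proof.
case: g h => [c e] [c' e'] /= cc ee; congr LGraph; first exact/funext.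
by apply/funext => u; apply/funext => w.
Qed.

(* Breadth-first search in a locally finite graph given by adjacency lists, ties
   being broken by the order of the lists. Only the connected component of the
   starting vertex is explored. *)
Section bfs.
Variables (V : eqType) (adj : V -> seq V).

Definition offspring (seen : seq V) (u : V) : seq V :=
  [seq w <- adj u | w \notin seen].

(* Visits the labeled vertices L of one generation in order, labeling from 1 on
   the neighbors of each that have not been discovered before, and returns the
   next generation in order of discovery. *)
Fixpoint sweep (seen : seq V) (L : seq (label * V)) : seq (label * V) :=
  if L is (l, u) :: L' then
    let c := offspring seen u in
    zip [seq rcons l j | j <- iota 1 (size c)] c ++ sweep (seen ++ c) L'
  else [::].

Variable v : V.

(* The vertices discovered up to generation k, and the labeled generation k. *)
Fixpoint generations (k : nat) : seq V * seq (label * V) :=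
  if k is k'.+1 then
    let: (seen, L) := generations k' in
    let L' := sweep seen L in (seen ++ unzip2 L', L')
  else ([:: v], [:: ([::], v)]).

Definition vertex_at (l : label) : option V :=
  ohead [seq p.2 | p <- (generations (size l)).2 & p.1 == l].

Definition labeling M (f : V -> M) : lgraph M := {|
  color := fun l => omap f (vertex_at l) ;
  edge := fun l l' => if (vertex_at l, vertex_at l') is (Some u, Some u')
                      then u' \in adj u else false |}.

Definition seen k := (generations k).1.
Definition level k := (generations k).2.

Definition adjacency_lists :=
  [/\ forall u, uniq (adj u), forall u, u \notin adj u &
      forall u w, (w \in adj u) = (u \in adj w)].

Definition connected_from :=
  forall w, exists p, path (fun a b => b \in adj a) v p /\ last v p = w.

Lemma seenS k : seen k.+1 = seen k ++ unzip2 (level k.+1).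
Proof. by rewrite /seen /level /=; case: generations. Qed.

Lemma levelS k : level k.+1 = sweep (seen k) (level k).
Proof. by rewrite /seen /level /=; case: generations. Qed.

Lemma level0 : level 0 = [:: ([::], v)]. Proof. by []. Qed.
Lemma seen0 : seen 0 = [:: v]. Proof. by []. Qed.

Lemma unzip2_child l (c : seq V) :
  unzip2 (zip [seq rcons l j | j <- iota 1 (size c)] c) = c.
Proof. by apply: unzip2_zip; rewrite size_map size_iota. Qed.

Lemma child_mem l (c : seq V) p :
  p \in zip [seq rcons l j | j <- iota 1 (size c)] c ->
  exists2 j, p.1 = rcons l j & p.2 \in c.
Proof.
case: p => a b /= h.
have /mapP[j _ ->] : a \in [seq rcons l j | j <- iota 1 (size c)].
  rewrite -(unzip1_zip (s := [seq rcons l j | j <- iota 1 (size c)]) (t := c)).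
    by apply/mapP; exists (a, b).
  by rewrite size_map size_iota.
by exists j => //; rewrite -(unzip2_child l c); apply/mapP; exists (a, b).
Qed.

Lemma sweep_mem s L p : p \in sweep s L ->
  exists q j, [/\ q \in L, p.1 = rcons q.1 j, p.2 \in adj q.2 & p.2 \notin s].
Proof.
elim: L s => [//|[l u] L IH] s /=; rewrite mem_cat => /orP[/child_mem[j -> h]|].
  exists (l, u), j; rewrite inE eqxx; move: h; rewrite mem_filter => /andP[-> ->].
  by split.
move=> /IH[q [j [qL -> pq]]]; rewrite mem_cat negb_or => /andP[ps _].
by exists q, j; split => //; rewrite inE qL orbT.
Qed.

Lemma sweep_seen s L u : u \in unzip2 L ->
  {subset adj u <= s ++ unzip2 (sweep s L)}.
Proof.
elim: L s => [//|[l a] L IH] s /=; rewrite inE /unzip2 map_cat.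
rewrite -/(unzip2 _) -/(unzip2 _) unzip2_child.
case: (eqVneq u a) => [<- _ x xu|_ /= uL x xu].
  rewrite !mem_cat mem_filter xu andbT.
  by case: (x \in s).
by rewrite catA; apply: (IH _ uL).
Qed.

Lemma level_size k p : p \in level k -> size p.1 = k.
Proof.
elim: k p => [p|k IH p]; first by rewrite level0 inE => /eqP ->.
by rewrite levelS => /sweep_mem[q [j [/IH qk -> _ _]]]; rewrite size_rcons qk.
Qed.

Lemma levelSP k p : p \in level k.+1 ->
  exists q j, [/\ q \in level k, p.1 = rcons q.1 j & p.2 \in adj q.2].
Proof.
by rewrite levelS => /sweep_mem[q [j [? ? ? _]]]; exists q, j.
Qed.

Lemma seenP k u : reflect (exists2 j, (j <= k)%N & u \in unzip2 (level j))
  (u \in seen k).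
Proof.
elim: k u => [u|k IH u].
  rewrite seen0; apply: (iffP idP) => [uv|[j]]; first by exists 0%N.
  by rewrite leqn0 => /eqP ->.
rewrite seenS mem_cat; apply: (iffP orP) => [[/IH[j jk uj]|uk]|[j]].
- by exists j => //; rewrite leqW.
- by exists k.+1.
- rewrite leq_eqVlt => /orP[/eqP -> ->|jk uj]; first by right.
  by left; apply/IH; exists j.
Qed.

Lemma seen_le j k : (j <= k)%N -> {subset seen j <= seen k}.
Proof.
by move=> jk u /seenP[i ij ui]; apply/seenP; exists i => //; exact: leq_trans jk.
Qed.

Lemma adj_seen k u : u \in seen k -> {subset adj u <= seen k.+1}.
Proof.
move=> /seenP[j jk uj] x xu; apply: (@seen_le j.+1) => //.
by rewrite seenS levelS; apply: sweep_seen uj _ xu.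
Qed.

Hypothesis adj_uniq : forall u, uniq (adj u).

Lemma sweep_uniq s L : uniq s -> uniq (s ++ unzip2 (sweep s L)).
Proof.
elim: L s => [|[l u] L IH] s us /=; first by rewrite cats0.
rewrite /unzip2 map_cat -/(unzip2 _) -/(unzip2 _) unzip2_child catA.
apply: IH; rewrite cat_uniq us filter_uniq // andbT /=.
by apply/hasPn => x; rewrite mem_filter => /andP[].
Qed.

Lemma seen_uniq k : uniq (seen k).
Proof.
elim: k => [//|k IH]; rewrite seenS levelS; exact: sweep_uniq.
Qed.

Lemma zip_rcons_uniq l (c : seq V) n :
  uniq (unzip1 (zip [seq rcons l j | j <- iota n (size c)] c)).
Proof.
rewrite unzip1_zip ?size_map ?size_iota //.
by rewrite map_inj_uniq ?iota_uniq // => i j /rcons_inj[].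
Qed.

Lemma sweep_uniq1 s L : uniq (unzip1 L) -> uniq (unzip1 (sweep s L)).
Proof.
elim: L s => [//|[l u] L IH] s /= /andP[lL uL].
rewrite /unzip1 map_cat -/(unzip1 _) -/(unzip1 _) cat_uniq zip_rcons_uniq IH //.
rewrite andbT; apply/hasPn => x /mapP[p /sweep_mem[q [j [qL pq _ _]]] ->].
apply/negP => /mapP[p' /child_mem[j' p'l _]]; rewrite pq p'l => /rcons_inj[e _].
by move/negP: lL; apply; apply/mapP; exists q.
Qed.

Lemma level_uniq1 k : uniq (unzip1 (level k)).
Proof. by elim: k => [//|k IH]; rewrite levelS; exact: sweep_uniq1. Qed.

Lemma vertex_atP l u : reflect ((l, u) \in level (size l)) (vertex_at l == Some u).
Proof.
rewrite /vertex_at -/(level _).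
have := level_uniq1 (size l); elim: (level _) => [|[a b] L IH] /=.
  by move=> _; apply: (iffP idP).
move=> /andP[aL /IH{}IH]; rewrite inE xpair_eqE (eq_sym l a).
case: eqP => [al|_] /=; last exact: IH.
apply: (iffP eqP) => [[->]|]; first by rewrite eqxx.
move=> /orP[/eqP ->//|h]; move/negP: aL; case; rewrite al.
by apply/mapP; exists (l, u).
Qed.

Lemma level_index i j u : u \in unzip2 (level i) -> u \in unzip2 (level j) ->
  i = j.
Proof.
wlog ij : i j / (i <= j)%N.
  by move=> W hi hj; case: (leqP i j) => [|/ltnW] h; [exact: W|exact/esym/W].
move=> ui uj; move: ij; rewrite leq_eqVlt => /orP[/eqP//|].
case: j uj => // j uj ij.
have := seen_uniq j.+1; rewrite seenS cat_uniq => /and3P[_ /hasPn/(_ _ uj) + _].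
by move=> /negP; case; apply/seenP; exists i.
Qed.

Lemma edge_size M (f : V -> M) l l' : edge (labeling f) l l' ->
  (size l' <= (size l).+1)%N.
Proof.
rewrite /=; case E : (vertex_at l) => [u|//]; case E' : (vertex_at l') => [u'|//].
move/eqP/vertex_atP in E; move/eqP/vertex_atP in E'.
have us : u \in seen (size l).
  by apply/seenP; exists (size l) => //; apply/mapP; exists (l, u).
move=> /(adj_seen us)/seenP[j jl uj].
rewrite (@level_index (size l') j u') //.
by apply/mapP; exists (l', u').
Qed.

Lemma path_size M (f : V -> M) l p : path (edge (labeling f)) l p ->
  (size (last l p) <= size l + size p)%N.
Proof.
elim: p l => [|l' p IH] l /=; first by rewrite addn0.
move=> /andP[/edge_size h /IH /leq_trans]; apply.
by rewrite addnS -addSn leq_add2r (h _ f).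
Qed.

Lemma path_to M (f : V -> M) l u : vertex_at l = Some u ->
  exists2 p, path (edge (labeling f)) [::] p & last [::] p = l /\ size p = size l.
Proof.
move=> /eqP/vertex_atP; move: {2}(size l) (erefl (size l)) => k.
elim: k l u => [|k IH] l u lk.
  by move=> _; exists [::] => //; split => //; move/size0nil: lk.
move=> lu; move: (lu); rewrite {1}lk => /levelSP[[q w] [j [qk /= lq uw]]].
have qs := level_size qk.
have [|p pp [pl ps]] := IH q w qs; first by rewrite qs.
exists (rcons p l); last by rewrite last_rcons size_rcons ps lq size_rcons.
rewrite rcons_path pp pl /=.
move: qk; rewrite -{1}qs => /vertex_atP/eqP ->.
move/vertex_atP: lu => /eqP ->; exact: uw.
Qed.

Lemma reach k u : u \in seen k ->
  exists p, path (fun a b => b \in adj a) v p /\ last v p = u.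
Proof.
elim: k u => [u|k IH u]; first by rewrite inE => /eqP ->; exists [::].
rewrite seenS mem_cat => /orP[/IH//|/mapP[p /levelSP[q [j [qk _ pq]]] ->]].
have /IH[s [sp sl]] : q.2 \in seen k.
  by apply/seenP; exists k => //; apply/mapP; exists q.
by exists (rcons s p.2); rewrite rcons_path sp sl pq last_rcons.
Qed.

End bfs.

Section restriction.
Variable M : Type.

Definition dist_le (g : lgraph M) (r : nat) (l : label) : Prop :=
  exists p, [/\ path (edge g) [::] p, last [::] p = l & (size p <= r)%N].

Definition restrict_ball (r : nat) (g : lgraph M) : lgraph M := {|
  color := fun l => if `[< dist_le g r l >] then color g l else None ;
  edge := fun l l' => [&& edge g l l', `[< dist_le g r l >] &
                         `[< dist_le g r l' >]] |}.

(* The graphs on subsets of N^f that arise as breadth-first labelings of locally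
   finite connected rooted M-colored graphs. *)
Definition bfs_graphs : set (lgraph M) :=
  [set g | exists (V : eqType) (adj : V -> seq V) (v : V) (f : V -> M),
     [/\ adjacency_lists adj, connected_from adj v & g = labeling adj v f]].

End restriction.

Lemma dist_leP (V : eqType) (adj : V -> seq V) v M (f : V -> M) r l u :
  (forall u, uniq (adj u)) -> vertex_at adj v l = Some u ->
  `[< dist_le (labeling adj v f) r l >] = (size l <= r)%N.
Proof.
move=> au lu; apply/asboolP/idP => [[p [pp <- pr]]|lr].
  exact: leq_trans (path_size au pp) pr.
have [p pp [pl ps]] := path_to f lu.
by exists p; split => //; rewrite ps.
Qed.

Section embedding.
Variables (V W : eqType) (adjV : V -> seq V) (adjW : W -> seq W) (i : W -> V).
Hypothesis i_inj : injective i.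
Hypothesis adj_i : forall w, map i (adjW w) = adjV (i w).
Let i2 (p : label * W) := (p.1, i p.2).

Lemma sweep_map s L : sweep adjV (map i s) (map i2 L) = map i2 (sweep adjW s L).
Proof.
elim: L s => [//|[l u] L IH] s /=.
have -> : offspring adjV (map i s) (i u) = map i (offspring adjW s u).
  rewrite /offspring -adj_i filter_map; congr map; apply: eq_filter => x /=.
  by rewrite mem_map.
rewrite -map_cat IH map_cat size_map; congr (_ ++ _).
rewrite /i2; move: (offspring _ _ _) => c; move: (iota _ _) => t.
by elim: c t => [|x c IHc] [|j t] //=; rewrite IHc.
Qed.

Lemma generations_map w k : generations adjV (i w) k =
  (map i (generations adjW w k).1, map i2 (generations adjW w k).2).
Proof.
elim: k => [//|k IH] /=; rewrite IH; case: generations => s L /=.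
rewrite sweep_map map_cat; congr (_ ++ _, _).
by rewrite /unzip2 -!map_comp.
Qed.

Lemma vertex_at_map w l : vertex_at adjV (i w) l = omap i (vertex_at adjW w l).
Proof.
rewrite /vertex_at generations_map /=.
by elim: (_.2) => //= -[a b] L IH; case: ifP.
Qed.

Lemma labeling_map M w (f : V -> M) :
  labeling adjV (i w) f = labeling adjW w (f \o i).
Proof.
apply: lgraph_ext => l; rewrite /= ?vertex_at_map; first by case: vertex_at.
move=> l' /=; rewrite !vertex_at_map.
case: (vertex_at _ _ l) => // u; case: (vertex_at _ _ l') => //= u'.
by rewrite -adj_i mem_map.
Qed.

End embedding.

Section component.
Variables (V : eqType) (adj : V -> seq V) (v : V) (M : Type) (f : V -> M).
Hypothesis adjP : adjacency_lists adj.

Let D (x : V) : bool := `[< exists k, x \in seen adj v k >].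
Let W := {x : V | D x}.
Let adjW (w : W) : seq W := pmap insub (adj (val w)).

Let adj_val w : map val (adjW w) = adj (val w).
Proof.
rewrite /adjW pmap_filter; last exact: insubK.
apply/all_filterP/allP => x xw.
rewrite isSome_insub; apply/asboolP.
by have /asboolP[k kw] := valP w; exists k.+1; exact: adj_seen kw _ xw.
Qed.

Let Dv : D v. Proof. by apply/asboolP; exists 0%N; rewrite inE. Qed.
Let w0 : W := Sub v Dv.

Lemma labeling_bfs_graphs : bfs_graphs (labeling adj v f).
Proof.
case: adjP => au ai asym.
exists W, adjW, w0, (f \o val); split.
- have mem_adjW (w x : W) : (x \in adjW w) = (val x \in adj (val w)).
    by rewrite -adj_val mem_map //; exact: val_inj.
  split.
  + by move=> w; rewrite -(map_inj_uniq val_inj) adj_val.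
  + by move=> w; rewrite mem_adjW.
  + by move=> w x; rewrite !mem_adjW.
- move=> w; have /asboolP[k kw] := valP w; apply: (@reach _ _ _ k).
  rewrite -(mem_map val_inj).
  have := generations_map val_inj adj_val w0 k.
  by move/(congr1 fst) => /= <-.
- exact: (labeling_map val_inj adj_val w0).
Qed.

End component.

Section truncation.
Variables (V : eqType) (adj : V -> seq V) (v : V) (r : nat).
Hypothesis adjP : adjacency_lists adj.
Let S := seen adj v r.
Let adjS (u : V) := if u \in S then [seq w <- adj u | w \in S] else [::].

Let adjS_mem u w : (w \in adjS u) = [&& u \in S, w \in S & w \in adj u].
Proof. by rewrite /adjS; case: ifP; rewrite ?in_nil // mem_filter. Qed.

Lemma adjSP : adjacency_lists adjS.
Proof.
case: adjP => au ai asym; split.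
- by move=> u; rewrite /adjS; case: ifP => // _; exact: filter_uniq.
- by move=> u; rewrite adjS_mem (negbTE (ai u)) !andbF.
- by move=> u w; rewrite !adjS_mem asym andbCA.
Qed.

Let sweepS s L : (forall u, u \in unzip2 L -> u \in S /\ {subset adj u <= S}) ->
  sweep adjS s L = sweep adj s L.
Proof.
elim: L s => [//|[l u] L IH] s h /=.
have [uS auS] := h u (mem_head _ _).
have -> : offspring adjS s u = offspring adj s u.
  have/allP/all_filterP aS := auS.
  by rewrite /offspring /adjS uS aS.
by rewrite IH // => x xL; apply: h; rewrite inE xL orbT.
Qed.

Let generationsS k : (k <= r)%N -> generations adjS v k = generations adj v k.
Proof.
elim: k => [//|k IH] kr /=; rewrite IH 1?ltnW //.
have : sweep adjS (seen adj v k) (level adj v k) =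
       sweep adj (seen adj v k) (level adj v k).
  apply: sweepS => u uk.
  have us : u \in seen adj v k by apply/seenP; exists k.
  split; first by apply: seen_le us; exact: ltnW.
  by move=> x /(adj_seen us); exact: seen_le.
by rewrite /seen /level; case: generations => s L /= ->.
Qed.

Let sweep_nil s L : (forall u, {subset adjS u <= s}) -> sweep adjS s L = [::].
Proof.
move=> h; elim: L => [//|[l u] L IH] /=.
have -> : offspring adjS s u = [::].
  apply/eqP; rewrite -(negbK (_ == _)) -has_filter.
  by apply/negP => /hasP[x /h ->].
by rewrite cats0.
Qed.

Let levelS_nil k : level adjS v (k + r).+1 = [::].
Proof.
suff [h _] : level adjS v (k + r).+1 = [::] /\ seen adjS v (k + r).+1 = S by [].
elim: k => [|k [lk sk]].
  have e : level adjS v r.+1 = [::].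
    rewrite levelS sweep_nil // => u x.
    by rewrite adjS_mem /seen generationsS // => /and3P[].
  by split; rewrite ?seenS ?e ?cats0 /seen ?generationsS.
have e : level adjS v (k.+1 + r).+1 = [::].
  by rewrite levelS addSn lk.
by split; rewrite // seenS e cats0 addSn.
Qed.

Let vertex_atS l : vertex_at adjS v l =
  if (size l <= r)%N then vertex_at adj v l else None.
Proof.
rewrite /vertex_at; case: leqP => lr; first by rewrite generationsS.
have -> : size l = (size l - r.+1 + r).+1 by rewrite -addnS subnK.
by rewrite -/(level _ _ _) levelS_nil.
Qed.

Lemma restrict_labeling M (f : V -> M) :
  restrict_ball r (labeling adj v f) = labeling adjS v f.
Proof.
case: adjP => au _ _; apply: lgraph_ext => l.
  rewrite /= vertex_atS; case E : (vertex_at adj v l) => [u|] /=.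
    by rewrite (dist_leP f r au E); case: ifP.
  by case: ifP => //; case: ifP.
move=> l' /=; rewrite !vertex_atS.
case E : (vertex_at adj v l) => [u|] /=; last by do ?case: ifP.
case E' : (vertex_at adj v l') => [u'|] /=; last by do ?case: ifP.
rewrite (dist_leP f r au E) (dist_leP f r au E').
case: ifP => lr; last by rewrite andbF.
case: ifP => lr'; last by rewrite !andbF.
have mS l1 u1 : vertex_at adj v l1 = Some u1 -> (size l1 <= r)%N -> u1 \in S.
  move=> /eqP/vertex_atP h h1; apply/seenP; exists (size l1) => //.
  by apply/mapP; exists (l1, u1) => //; exact: h.
by rewrite adjS_mem (mS _ _ E lr) (mS _ _ E' lr') !andbT.
Qed.

End truncation.

Lemma restrict_bfs_graphs M r (g : lgraph M) :
  bfs_graphs g -> bfs_graphs (restrict_ball r g).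
Proof.
move=> [V [adj [v [f [adjP _ ->]]]]]; rewrite restrict_labeling //.
exact/labeling_bfs_graphs/adjSP.
Qed.

Lemma restrict_color M r (g : lgraph M) l : bfs_graphs g -> (size l <= r)%N ->
  color (restrict_ball r g) l = color g l.
Proof.
move=> [V [adj [v [f [[au _ _] _ ->]]]]] lr.
rewrite /restrict_ball /=; case E : (vertex_at adj v l) => [u|]; last by case: ifP.
by rewrite (dist_leP f r au E) lr.
Qed.

Lemma restrict_edge M r (g : lgraph M) l l' : bfs_graphs g ->
  (size l <= r)%N -> (size l' <= r)%N -> edge (restrict_ball r g) l l' = edge g l l'.
Proof.
move=> [V [adj [v [f [[au _ _] _ ->]]]]] lr lr'.
rewrite /restrict_ball /=; case E : (vertex_at adj v l) => [u|//].
case E' : (vertex_at adj v l') => [u'|//].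
by rewrite (dist_leP f r au E) (dist_leP f r au E') lr lr' !andbT.
Qed.

Lemma restrict_inj M (g h : lgraph M) : bfs_graphs g -> bfs_graphs h ->
  (forall r, restrict_ball r g = restrict_ball r h) -> g = h.
Proof.
move=> bg bh gh; apply: lgraph_ext => l.
  by rewrite -(restrict_color bg (leqnn _)) gh restrict_color.
move=> l'; pose r := maxn (size l) (size l').
by rewrite -(@restrict_edge _ r _ _ _ bg) ?leq_maxl ?leq_maxr // gh
  restrict_edge ?leq_maxl ?leq_maxr.
Qed.

(* R is a phantom parameter: it fixes the field in which distances are valued,
   so that the metric and Borel structures can be inferred from the type. *)
Definition graph_space (R : realType) (M : finPointedType) : Type :=
  {g : lgraph M | bfs_graphs g}.

Section graph_metric.
Variables (R : realType) (M : finPointedType).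
Local Notation graphs := (graph_space R M).

HB.instance Definition _ := gen_eqMixin graphs.
HB.instance Definition _ := gen_choiceMixin graphs.

Lemma single_vertex_bfs_graphs :
  bfs_graphs (labeling (fun _ : unit => [::]) tt (fun=> point : M)).
Proof. by apply: labeling_bfs_graphs; split. Qed.

HB.instance Definition _ :=
  isPointed.Build graphs (exist _ _ single_vertex_bfs_graphs).

Definition ball_restrict (r : nat) (g : graphs) : graphs :=
  exist _ (restrict_ball r (sval g)) (restrict_bfs_graphs r (svalP g)).

Lemma ball_restrict_inj (g h : graphs) :
  (forall r, ball_restrict r g = ball_restrict r h) -> g = h.
Proof.
move=> gh; apply: eq_sig_hprop => [*|/=]; first exact: Prop_irrelevance.
apply: restrict_inj; [exact: svalP|exact: svalP|].
by move=> r; have /(congr1 sval) := gh r.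
Qed.

Definition graph_dist_term (g h : graphs) (r : nat) : R :=
  2 ^- r * (ball_restrict r g != ball_restrict r h)%:R.

Definition graph_dist (g h : graphs) : R :=
  limn (series (graph_dist_term g h)).

Let term := graph_dist_term.

Lemma graph_dist_term_ge0 g h r : 0 <= term g h r.
Proof. by rewrite mulr_ge0 // invr_ge0 exprn_ge0. Qed.

Lemma graph_dist_term_le g h r : term g h r <= 2 ^- r.
Proof.
by rewrite /term /graph_dist_term ler_piMr ?invr_ge0 ?exprn_ge0 // lern1 leq_b1.
Qed.

Lemma graph_dist_cvg g h : cvgn (series (term g h)).
Proof.
apply: (@series_le_cvg _ _ (geometric 1 (2^-1))).
- exact: graph_dist_term_ge0.
- by move=> n; rewrite /geometric /= mul1r exprn_ge0 // invr_ge0.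
- by move=> n; rewrite /geometric /= mul1r exprVn graph_dist_term_le.
- apply: is_cvg_geometric_series.
  by rewrite ger0_norm ?invr_ge0 // invf_lt1 // ltr1n.
Qed.

Lemma graph_dist_ge_term g h r : term g h r <= graph_dist g h.
Proof.
have nd : nondecreasing_seq (series (term g h)).
  by apply: nondecreasing_series => n _ _; exact: graph_dist_term_ge0.
apply: le_trans (nondecreasing_cvgn_le nd (@graph_dist_cvg g h) r.+1).
rewrite /series /= big_nat_recr //= lerDr sumr_ge0 // => k _.
exact: graph_dist_term_ge0.
Qed.

Let dist_xx g : graph_dist g g = 0.
Proof.
rewrite /graph_dist (_ : series _ = cst 0) ?lim_cst //.
by apply/funext => n; rewrite /series /= big1 // => k _; rewrite /graph_dist_term eqxx mulr0.
Qed.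

Lemma graph_dist_lt g h r : graph_dist g h < 2 ^- r ->
  ball_restrict r g = ball_restrict r h.
Proof.
move=> gh; apply/eqP/negPn/negP => ne.
have := le_lt_trans (graph_dist_ge_term g h r) gh.
by rewrite /term /graph_dist_term ne mulr1 ltxx.
Qed.

Let dist_pos g h : graph_dist g h = 0 -> g = h.
Proof.
move=> gh; apply: ball_restrict_inj => r; apply: graph_dist_lt.
by rewrite gh invr_gt0 exprn_gt0.
Qed.

Let dist_sym g h : graph_dist g h = graph_dist h g.
Proof.
rewrite /graph_dist; congr (limn (series _)).
by apply/funext => k; rewrite /graph_dist_term eq_sym.
Qed.

Let dist_triangle h g k : graph_dist g k <= graph_dist g h + graph_dist h k.
Proof.
have cv a b := @graph_dist_cvg a b.
rewrite -[X in _ <= X](lim_seriesD (cv g h) (cv h k)).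
apply: lim_series_le; [exact: cv| exact: is_cvg_seriesD|move=> n].
change (term g k n <= term g h n + term h k n).
rewrite /term /graph_dist_term -mulrDr ler_wpM2l ?invr_ge0 ?exprn_ge0 //.
rewrite -natrD ler_nat.
case: (eqVneq (ball_restrict n g) (ball_restrict n h)) => [->|] //=.
by move=> _; case: eqP => // _; rewrite addn_gt0.
Qed.

HB.instance Definition _ := isMetric.Build R graphs
  dist_xx dist_pos dist_sym dist_triangle.

Lemma graph_dist_le g h r :
  (forall k, (k <= r)%N -> ball_restrict k g = ball_restrict k h) ->
  graph_dist g h <= 2 ^- r.
Proof.
move=> gh; apply: limr_le; first exact: graph_dist_cvg.
have t0 k : (k <= r)%N -> term g h k = 0.
  by move=> kr; rewrite /term /graph_dist_term gh // eqxx mulr0.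
have H n : (r <= n)%N -> \sum_(0 <= k < n.+1) term g h k <= 2 ^- r - 2 ^- n.
  elim: n => [|n IH].
    by rewrite leqn0 => /eqP r0; rewrite big_nat1 t0 // r0 subrr.
  rewrite leq_eqVlt => /orP[/eqP rn|/IH{}IH].
    rewrite rn subrr big_nat big1 // => k /andP[_ kn].
    by rewrite t0 // rn -ltnS.
  rewrite big_nat_recr //=.
  apply: le_trans (lerD IH (graph_dist_term_le _ _ _)) _.
  by rewrite -addrA lerD2l exprSr invfM; lra.
near=> n; have : (r < n)%N by near: n; exists r.+1.
case: (n) => // m; rewrite ltnS => /H /le_trans; apply.
by rewrite gerBl invr_ge0 exprn_ge0.
Unshelve. all: by end_near. Qed.

End graph_metric.

HB.instance Definition _ (R : realType) (M : finPointedType) :=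
  Measurable.copy (graph_space R M)
    (g_sigma_algebraType (@open (graph_space R M))).

Section ball_law.
Variables (R : realType) (M : finPointedType).
Local Notation graphs := (graph_space R M).

Lemma open_measurable_graphs (U : set graphs) : open U -> measurable U.
Proof. by move=> oU; apply: sub_sigma_algebra. Qed.

Lemma open_ball_restrict r (U : set graphs) :
  open (@ball_restrict R M r @^-1` U).
Proof.
rewrite openE => g Ug; apply/nbhs_ballP; exists (2 ^- r) => /=.
  by rewrite invr_gt0 exprn_gt0.
by move=> h; rewrite ballEmdist => /graph_dist_lt gh; move: Ug; rewrite /preimage /= gh.
Qed.

Lemma measurable_ball_restrict r :
  measurable_fun [set: graphs] (@ball_restrict R M r : graphs -> graphs).
Proof.
move=> _ U _; rewrite setTI; apply: open_measurable_graphs; exact: open_ball_restrict.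
Qed.

HB.instance Definition _ r := isMeasurableFun.Build _ _ graphs graphs
  (@ball_restrict R M r) (@measurable_ball_restrict r).

Definition ball_law (r : nat) (nu : probability graphs R) :
  probability graphs R := distribution nu (@ball_restrict R M r).

Definition bounded_continuous : Type :=
  {F : graphs -> R | continuous F /\ bounded_fun F}.

Definition integrals (nu : probability graphs R) : {ptws bounded_continuous -> R} :=
  fun F => \int[nu]_g sval F g.

Definition weak_topology : Type := initial_topology integrals.
HB.instance Definition _ := Topological.on weak_topology.

(* A measure is a function on all sets that is only constrained on measurable
   ones, whence the form of the separation axiom. *)
Definition weak_distance (dist : probability graphs R -> probability graphs R -> R) :=
  [/\ forall p q, dist p q = 0 <-> (forall A, measurable A -> p A = q A),
      forall p q, dist p q = dist q p,
      forall p q s, dist p s <= dist p q + dist q s &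
      forall U : set (probability graphs R),
        open (U : set weak_topology) <->
        (forall p, U p -> exists2 e, 0 < e & forall q, dist p q < e -> U q)].

End ball_law.

Section average.
Local Open Scope ereal_scope.
Context d (T : measurableType d) (R : realType) (I : finType).
Variable P : I -> probability T R.

(* The uniform mixture of the P i. The value for empty I is a dummy. *)
Definition average (A : set T) : \bar R :=
  if #|I| == 0%N then (point : probability T R) A
  else (#|I|%:R^-1)%:E * \sum_(i : I) P i A.

Let average0 : average set0 = 0.
Proof.
rewrite /average; case: ifP => _; first exact: measure0.
by rewrite big1 ?mule0.
Qed.

Let average_ge0 A : 0 <= average A.
Proof.
rewrite /average; case: ifP => _ //.
by rewrite mule_ge0 ?lee_fin ?invr_ge0 // sume_ge0.
Qed.

Let average_sigma_additive : semi_sigma_additive average.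
Proof.
move=> F mF tF mUF; rewrite /average; case: ifP => _.
  exact: measure_semi_sigma_additive.
rewrite [X in X @ \oo --> _](_ : _ = (fun n => (#|I|%:R^-1)%:E *
    \sum_(i : I) \sum_(0 <= k < n) P i (F k))); last first.
  apply/funext => n; rewrite exchange_big /= ge0_sume_distrr // => k _.
  exact: sume_ge0.
apply: cvgeZl => //; apply: cvg_nnesum => i _.
  by apply: nearW => n; exact: sume_ge0.
exact: measure_semi_sigma_additive.
Qed.

HB.instance Definition _ := isMeasure.Build _ _ _ average
  average0 average_ge0 average_sigma_additive.

Let average_setT : average [set: T] = 1.
Proof.
rewrite /average; case: ifPn => [_|I0]; first exact: probability_setT.
under eq_bigr do rewrite probability_setT.
rewrite sumEFin -EFinM big_const iter_addr_0 mulVf //.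
by rewrite pnatr_eq0.
Qed.

HB.instance Definition _ :=
  Measure_isProbability.Build _ _ _ average average_setT.

End average.

Section regular_tree.
Variable d : nat.

(* T_d on a subset of N^f: the root has offspring labels 1, ..., d, every other
   vertex 1, ..., d - 1. *)
Definition nb_offspring (l : label) : nat := if l is [::] then d else d.-1.

Definition tree_label (l : label) : bool :=
  if l is j :: s then (0 < j <= d)%N && all (fun i => 0 < i <= d.-1)%N s else true.

Record tree := Tree { tree_val :> label ; _ : tree_label tree_val }.
HB.instance Definition _ := [isSub for tree_val].
HB.instance Definition _ := [Countable of tree by <:].

Definition parent_of (l l' : label) : bool :=
  (l' != [::]) && (l == take (size l').-1 l').

Definition tree_edge (l l' : label) : bool := parent_of l l' || parent_of l' l.

Lemma tree_label_rcons l j : tree_label (rcons l j) =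
  [&& (0 < j)%N, (j <= nb_offspring l)%N & tree_label l].
Proof.
case: l => [|a l]; first by rewrite /= !andbT.
by rewrite rcons_cons /= all_rcons [X in _ && X]andbC andbA andbC -!andbA.
Qed.

Let take_rcons (l : label) j : take (size l) (rcons l j) = l.
Proof. by rewrite -cats1 take_size_cat. Qed.

Lemma parent_of_rcons l j : parent_of l (rcons l j).
Proof.
rewrite /parent_of size_rcons /= take_rcons eqxx andbT.
by case: l.
Qed.

Lemma parent_ofP l l' : reflect (exists j, l' = rcons l j) (parent_of l l').
Proof.
apply: (iffP idP) => [|[j ->]]; last exact: parent_of_rcons.
case/lastP: l' => [//|l' j]; rewrite /parent_of size_rcons /=.
rewrite take_rcons => /andP[_ /eqP ->].
by exists j.
Qed.

Definition tree_graph M (x : tree -> M) : lgraph M := {|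
  color := fun l => omap x (insub l) ;
  edge := fun l l' => [&& tree_label l, tree_label l' & tree_edge l l'] |}.

Let nbl (l : label) : seq label := [seq rcons l j | j <- iota 1 (nb_offspring l)] ++
  (if l is [::] then [::] else [:: take (size l).-1 l]).

Let nbl_mem l l' : tree_label l -> tree_label l' ->
  (l' \in nbl l) = tree_edge l l'.
Proof.
move=> tl tl'; rewrite /nbl mem_cat; congr (_ || _).
  apply/mapP/parent_ofP => [[j _ ->]|[j e]]; first by exists j.
  exists j => //; rewrite mem_iota add1n ltnS.
  by move: tl'; rewrite e tree_label_rcons => /and3P[-> -> _].
by rewrite /parent_of; case: l {tl} => // a l; rewrite inE.
Qed.

Lemma nbl_label l l' : tree_label l -> l' \in nbl l -> tree_label l'.
Proof.
move=> tl; rewrite mem_cat => /orP[/mapP[j]|].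
  by rewrite mem_iota add1n ltnS => /andP[j0 jd] ->; rewrite tree_label_rcons j0 jd.
case/lastP: l tl => [//|l j] tl.
have -> : (if rcons l j is [::] then [::] else
  [:: take (size (rcons l j)).-1 (rcons l j)]) = [:: l].
  have : rcons l j <> [::] by case: (l).
  case E : (rcons l j) => [//|a b] _; rewrite -E.
  by rewrite size_rcons /= take_rcons.
by rewrite inE => /eqP ->; move: tl; rewrite tree_label_rcons => /and3P[].
Qed.

Let root : tree := Tree (isT : tree_label [::]).
Let tadj (u : tree) : seq tree := pmap insub (nbl (val u)).

Let tadj_val u : map val (tadj u) = nbl (val u).
Proof.
rewrite /tadj pmap_filter; last exact: insubK.
apply/all_filterP/allP => l lu; rewrite isSome_insub.
exact: nbl_label (valP u) lu.
Qed.

Let mem_tadj u w : (w \in tadj u) = tree_edge (val u) (val w).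
Proof.
rewrite -(mem_map val_inj) tadj_val nbl_mem //; exact: valP.
Qed.

Lemma tree_edge_sym l l' : tree_edge l l' = tree_edge l' l.
Proof. by rewrite /tree_edge orbC. Qed.

Lemma parent_of_size l l' : parent_of l l' -> size l' = (size l).+1.
Proof. by move=> /parent_ofP[j ->]; rewrite size_rcons. Qed.

Lemma tree_edge_size l l' : tree_edge l l' ->
  size l' = (size l).+1 \/ size l = (size l').+1.
Proof. by move=> /orP[]/parent_of_size; [left|right]. Qed.

Lemma tadjP : adjacency_lists tadj.
Proof.
split.
- move=> u; rewrite -(map_inj_uniq val_inj) tadj_val /nbl.
  rewrite cat_uniq map_inj_uniq ?iota_uniq; last by move=> i j /rcons_inj[].
  apply/and3P; split=> //; last by case: (val u).
  apply/hasPn => l lu; apply/negP => /mapP[j _ lj]; move: lu; rewrite lj.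
  case: (val u) => // a s; rewrite inE => /eqP/(congr1 size).
  rewrite size_rcons size_take /=; case: ifP => _ h; first by lia.
  by lia.
- move=> u; rewrite mem_tadj; apply/negP => /tree_edge_size.
  by case=> /n_Sn.
- by move=> u w; rewrite !mem_tadj tree_edge_sym.
Qed.

Let sweep_tree k s L : uniq (unzip2 L) ->
  (forall p, p \in L -> p.1 = val p.2 /\ size (val p.2) = k) ->
  (forall x : tree, (size (val x) <= k)%N -> x \in s) ->
  (forall p (x : tree), p \in L -> parent_of (val p.2) (val x) -> x \notin s) ->
  forall p, p \in sweep tadj s L -> p.1 = val p.2.
Proof.
elim: L s => [//|[l u] L IH] s /= /andP[uL LU] Lk sk ns p.
have [/= lu uk] := Lk (l, u) (mem_head _ _).
set c := offspring tadj s u.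
have cE : map val c = [seq rcons (val u) j | j <- iota 1 (nb_offspring (val u))].
  have -> : map val c = [seq l <- nbl (val u) | (size (val u) < size l)%N].
    rewrite /c /offspring -tadj_val filter_map; congr map.
    apply: eq_in_filter => x; rewrite mem_tadj /= => ux.
    case: (ltnP (size (val u)) (size (val x))) => xu.
      have : parent_of (val u) (val x).
        case/orP: ux => // /parent_of_size ux; move: xu.
        by rewrite ux ltnNge leqnSn.
      exact: (ns (l, u) x (mem_head _ _)).
    by apply/negP => /negP; rewrite sk // -uk.
  rewrite /nbl filter_cat [X in _ ++ X](_ : _ = [::]) ?cats0; last first.
    case: (val u) => // a t.
    have ts : size (take (size t) (a :: t)) = size t by rewrite size_takel.
    by rewrite /= in ts *; rewrite ts ltnNge leqnSn.
  by apply/all_filterP/allP => _ /mapP[j _ ->]; rewrite size_rcons.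
have szc : size c = nb_offspring (val u).
  by rewrite -(size_map val) cE size_map size_iota.
rewrite mem_cat => /orP[|].
  rewrite szc lu -cE; elim: (c) => //= y c' IHc.
  by rewrite inE => /orP[/eqP ->|].
apply: IH => //.
- by move=> q qL; apply: Lk; rewrite inE qL orbT.
- by move=> x xk; rewrite mem_cat sk.
- move=> q x qL qx; rewrite mem_cat negb_or (ns q) ?inE ?qL ?orbT //=.
  apply/negP => xc; have : val x \in map val c by apply: map_f.
  rewrite cE => /mapP[j _ xj]; case/parent_ofP: qx => i; rewrite xj.
  move=> /rcons_inj[/val_inj uq _]; move/negP: uL; apply; rewrite uq.
  by apply/mapP; exists q.
Qed.

Let tree_levels k : (forall p, p \in level tadj root k -> p.1 = val p.2) /\
  (forall x : tree, (x \in seen tadj root k) = (size (val x) <= k)%N).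
Proof.
have au : forall u, uniq (tadj u) by case: tadjP.
elim: k => [|k [Lk Sk]].
  split => [p|x]; first by rewrite inE => /eqP ->.
  by rewrite inE -val_eqE /= leqn0 size_eq0.
have LS p : p \in level tadj root k.+1 -> p.1 = val p.2.
  rewrite levelS; apply: (@sweep_tree k).
  - case: (k) => [//|k']; have := @seen_uniq _ tadj root au k'.+1.
    by rewrite seenS cat_uniq => /and3P[].
  - by move=> q qk; split; [exact: Lk|rewrite -(Lk _ qk) (level_size qk)].
  - by move=> x; rewrite Sk.
  - move=> q x qk /parent_of_size; rewrite Sk -(Lk _ qk) (level_size qk) => ->.
    by rewrite ltnn.
split=> // x; rewrite seenS mem_cat Sk.
apply/orP/idP => [[/leqW //|/mapP[p pk ->]]|].
  by rewrite -(LS _ pk) (level_size pk).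
rewrite leq_eqVlt => /orP[/eqP xk|]; last by rewrite ltnS => ->; left.
right; case/lastP E : (val x) xk => [//|l j]; rewrite size_rcons => -[lk].
have tl : tree_label l.
  by have := valP x; rewrite E tree_label_rcons => /and3P[].
have : x \in seen tadj root k.+1.
  apply: (@adj_seen _ tadj root k (Tree tl)); first by rewrite Sk /= lk.
  by rewrite mem_tadj /= E /tree_edge parent_of_rcons.
by rewrite seenS mem_cat Sk E size_rcons lk ltnn.
Qed.

Let tree_vertex_at l : vertex_at tadj root l = insub l.
Proof.
have au : forall u, uniq (tadj u) by case: tadjP.
case: insubP => [u tl ul|tl].
  apply/eqP/vertex_atP => //.
  have : u \in seen tadj root (size l) by rewrite (tree_levels _).2 ul.
  move=> /seenP[j _ /mapP[p pj up]].
  have pl : p.1 = l by rewrite ((tree_levels _).1 _ pj) -up.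
  by move: (level_size pj); rewrite pl => ->; move: pj; rewrite -pl up; case: (p).
case E : (vertex_at tadj root l) => [u|//].
move/eqP/vertex_atP : E => /(tree_levels _).1 /= E.
by move: tl; rewrite E (valP u).
Qed.

Lemma tree_graphE M (x : tree -> M) : tree_graph x = labeling tadj root x.
Proof.
apply: lgraph_ext => l; first by rewrite /= tree_vertex_at.
move=> l' /=; rewrite !tree_vertex_at.
case: insubP => [u -> ul|/negbTE -> //].
case: insubP => [w -> wl|/negbTE -> //].
by rewrite mem_tadj ul wl.
Qed.

Lemma tree_graph_bfs M (x : tree -> M) : bfs_graphs (tree_graph x).
Proof. rewrite tree_graphE; exact/labeling_bfs_graphs/tadjP. Qed.

Lemma tree_dist_le M (x : tree -> M) r (u : tree) :
  `[< dist_le (tree_graph x) r (val u) >] = (size (val u) <= r)%N.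
Proof.
have au : forall u, uniq (tadj u) by case: tadjP.
by rewrite tree_graphE (@dist_leP _ _ _ _ _ _ _ u) // tree_vertex_at valK.
Qed.

Lemma tree_ball_seq r : exists s : seq tree,
  forall v : tree, (size (val v) <= r)%N -> v \in s.
Proof. by exists (seen tadj root r) => v; rewrite (tree_levels r).2. Qed.

End regular_tree.

Section processes.
Variables (R : realType) (d : nat) (M : finPointedType).
Local Notation graphs := (graph_space R M).

(* M^(T_d) with its product sigma-algebra *)
Definition cylinders : set (set (tree d -> M)) :=
  [set A | exists v a, A = [set x | x v = a]].
Definition config : Type := g_sigma_algebraType cylinders.
HB.instance Definition _ := Measurable.on config.

Definition tree_aut (phi : tree d -> tree d) : Prop :=
  bijective phi /\ forall u v, tree_edge (phi u) (phi v) = tree_edge u v.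

Definition aut_invariant (mu : probability config R) : Prop :=
  forall phi, tree_aut phi -> forall A : set config, measurable A ->
    mu [set x : config | A (x \o phi)] = mu A.

Definition rooted_tree (x : config) : graphs :=
  exist _ (tree_graph x) (tree_graph_bfs x).

Let rooted_tree_local r (x y : config) :
  (forall v : tree d, (size (val v) <= r)%N -> x v = y v) ->
  ball_restrict r (rooted_tree x) = ball_restrict r (rooted_tree y).
Proof.
move=> xy; apply: eq_sig_hprop => [*|/=]; first exact: Prop_irrelevance.
apply: lgraph_ext => l //=.
case: insubP => [u _ ul|_] /=; last by do !case: ifP.
rewrite -ul !tree_dist_le; case: ifP => // /xy ->.
by [].
Qed.

Let measurable_pattern (s : seq (tree d)) (p : seq M) :
  measurable [set x : config | map x s = p].
Proof.
elim: s p => [|v s IH] [|a p].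
- by rewrite [X in measurable X](_ : _ = setT) //; apply/seteqP; split.
- by rewrite [X in measurable X](_ : _ = set0) //; apply/seteqP; split.
- by rewrite [X in measurable X](_ : _ = set0) //; apply/seteqP; split.
rewrite [X in measurable X](_ : _ =
  [set x : config | x v = a] `&` [set x : config | map x s = p]).
  by apply: measurableI => //; apply: sub_sigma_algebra; exists v, a.
by apply/seteqP; split => x /= [-> ->].
Qed.

Lemma measurable_rooted_tree : measurable_fun [set: config] rooted_tree.
Proof.
apply: (@measurability _ _ _ _ _ _ (@open graphs)) => //.
move=> _ [U oU <-]; rewrite setTI.
pose s r := sval (cid (tree_ball_seq d r)).
pose F (i : nat * seq M) := [set x : config | map x (s i.1) = i.2 /\
  forall y : config, map y (s i.1) = i.2 -> U (rooted_tree y)].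
rewrite [X in measurable X](_ : _ = \bigcup_i F i).
  apply: countable_bigcupT_measurable; first exact: countableP.
  move=> [r p]; rewrite /F /=.
  case: (pselect (forall y : config, map y (s r) = p -> U (rooted_tree y))) => h.
    rewrite [X in measurable X](_ : _ = [set x : config | map x (s r) = p]).
      exact: measurable_pattern.
    by apply/seteqP; split => x /= => [[]|].
  rewrite [X in measurable X](_ : _ = set0) //.
  by apply/seteqP; split => x //= -[].
apply/seteqP; split => [x /= Ux|x [[r p] _] [/= xp]]; last exact.
move: oU; rewrite openE => /(_ _ Ux) /nbhs_ballP[e /= e0 eU].
have [r re] : exists r, 2 ^- r < e.
  exists (Num.truncn e^-1).+1; rewrite invf_plt ?posrE ?exprn_gt0 //.
  apply: lt_le_trans (truncnS_gt _) _; rewrite -natrX ler_nat.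
  exact/ltnW/ltn_expl.
exists (r, map x (s r)) => //; split => //= y /eq_in_map yx.
apply: eU; rewrite ballEmdist /=.
apply: le_lt_trans re; apply: graph_dist_le => k kr.
apply: rooted_tree_local => v vk; apply/esym/yx.
by apply: (svalP (cid (tree_ball_seq d r))); exact: leq_trans kr.
Qed.

HB.instance Definition _ := isMeasurableFun.Build _ _ config graphs
  rooted_tree measurable_rooted_tree.

Definition tree_law (mu : probability config R) : probability graphs R :=
  distribution mu rooted_tree.

End processes.

Section random_labeling.
Variable n : nat.

Definition simple_graph_axiom (G : {ffun 'I_n -> {set 'I_n}}) : bool :=
  [forall u, u \notin G u] && [forall u, forall w, (w \in G u) == (u \in G w)].

Record simple_graph := SimpleGraph {
  nbhd :> {ffun 'I_n -> {set 'I_n}} ; _ : simple_graph_axiom nbhd }.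
HB.instance Definition _ := [isSub for nbhd].
HB.instance Definition _ := [Finite of simple_graph by <:].

Definition is_regular (d : nat) (G : simple_graph) : bool :=
  [forall u, #|G u| == d].

Definition sorted_adj (G : simple_graph) (s : {perm 'I_n}) (u : 'I_n) : seq 'I_n :=
  sort (fun a b => (s a <= s b)%N) (enum (G u)).

Lemma sorted_adjP G s : adjacency_lists (sorted_adj G s).
Proof.
have /andP[/forallP irr /forallP sym] := valP G.
have mem u w : (w \in sorted_adj G s u) = (w \in G u).
  by rewrite mem_sort mem_enum.
split.
- by move=> u; rewrite sort_uniq enum_uniq.
- by move=> u; rewrite mem irr.
- by move=> u w; rewrite !mem; have /forallP/(_ w)/eqP := sym u.
Qed.

Variables (R : realType) (M : finPointedType).
Local Notation graphs := (graph_space R M).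

Definition labeled_graph (G : simple_graph) (f : 'I_n -> M) (v : 'I_n)
    (s : {perm 'I_n}) : graphs :=
  exist _ (labeling (sorted_adj G s) v f)
    (labeling_bfs_graphs v f (sorted_adjP G s)).

(* The randomly labeled component of v: the offspring of the visited vertices are
   ordered by a uniform permutation s of all vertices. Its restrictions to the
   disjoint sets of siblings are independent uniform orders. *)
Definition distr_at (G : simple_graph) (f : 'I_n -> M) (v : 'I_n) :
    probability graphs R :=
  average (fun s : {perm 'I_n} => \d_(labeled_graph G f v s)).

Definition distr (G : simple_graph) (f : 'I_n -> M) : probability graphs R :=
  average (distr_at G f).

End random_labeling.

Section sofic_entropy.
Local Open Scope ereal_scope.
Variables (R : realType) (d : nat) (M : finPointedType).
Local Notation graphs := (graph_space R M).
Variable dist : probability graphs R -> probability graphs R -> R.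
Variable mu : probability (config d M) R.

Definition good_coloring n (G : simple_graph n) r (eps : R)
    (f : {ffun 'I_n -> M}) : bool :=
  (dist (ball_law r (distr R G f)) (ball_law r (tree_law mu)) <= eps)%R.

(* lne 0 = -oo *)
Definition H_graph n (G : simple_graph n) r eps : \bar R :=
  lne #|good_coloring G r eps|%:R%:E * (n%:R^-1)%:E.

Definition prob_H_ge n r eps (h : \bar R) : R :=
  (#|[pred G : simple_graph n | is_regular d G && (h <= H_graph G r eps)%E]|%:R /
   #|[pred G : simple_graph n | is_regular d G]|%:R)%R.

Definition h_n n r eps (alpha : R) : \bar R :=
  ereal_sup [set h | (h = -oo \/ 0 <= h < +oo) /\
                     (alpha <= prob_H_ge n r eps h)%R].

Definition admissible : set nat := [set n | (d < n)%N && ~~ odd (n * d)].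

(* The upper sofic entropies at level alpha; their value does not depend on
   alpha in (0, 1). *)
Definition hbar_r r alpha : \bar R :=
  lim (limf_esup (fun n => h_n n r eps alpha) (within admissible \oo)
       @[eps --> 0^'+]).

Definition hbar alpha : \bar R := limn (hbar_r ^~ alpha).

End sofic_entropy.

Section annealed_entropy.
Variables (R : realType) (d : nat) (M : finPointedType).
Variable mu : probability (config d M) R.

Definition tree_ball (r : nat) (S : set (tree d)) : set (tree d) :=
  [set v | exists2 u, S u & exists p : seq (tree d),
     [/\ path (fun a b : tree d => tree_edge a b) u p, last u p = v & (size p <= r)%N]].

(* The entropy of the restriction of X ~ mu to the finite set S, in nats
   (fset_set is a dummy on infinite sets, and 0 * ln 0 = 0). *)
Definition shannon (S : set (tree d)) : R :=
  - \sum_(a : {ffun fset_set S -> M})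
      let p := fine (mu [set x : config d M |
                          forall v : fset_set S, x (val v) = a v]) in
      p * ln p.

Definition S_ball r := tree_ball r [set v | val v = [::]].
Definition E_ball r := tree_ball r.-1 [set v | val v = [::] \/ val v = [:: 1%N]].

Definition Sigma_r r : R := shannon (S_ball r) - d%:R / 2 * shannon (E_ball r).

Definition Sigma : \bar R := limn (fun r => (Sigma_r r)%:E).

End annealed_entropy.

(* Main.v *)
Require Import Defs.
From mathcomp Require Import all_boot all_order all_algebra finmap all_fingroup.
From mathcomp Require Import all_classical all_reals all_analysis measurable_realfun.
From mathcomp Require Import lra zify.

(* First moment method. If the number of good colorings of [G_n] is at least
   [e^(nh)] with probability at least [alpha], then [alpha * e^(nh)] is at most the
   mean number of good colorings, so it suffices to show that there are at most
   [e^(n (Sigma_r + o(1)))] times as many good pairs (graph, coloring) as graphs.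

   Order the neighbors of every vertex. An ordered graph is a fixed-point-free
   involution (a matching) of the half-edges [n] x [d], and following the orders maps
   the tree to the graph, starting from any vertex; the coloring pulled back to the
   ball [S_r] is the type of the vertex. A half-edge inherits a coloring of [E_r] from
   the type of its vertex, and matched half-edges carry mutually reversed ones. There
   are [e^(n (H(S_r) + o(1)))] assignments of types with empirical law close to that
   of the process, and each is compatible with a proportion
   [e^(- n (d/2 H(E_r) + o(1)))] of all matchings.

   Three facts complete the count. By switchings, a proportion at least [n^(-C)] of the
   matchings come from simple graphs. By a second moment bound, at least half of
   the orders of a given colored graph have an empirical law of types close to its
   mean. And this mean is close to the law of the process on [S_r] when the coloring
   is good: around a vertex whose ball is a tree, the uniform permutation behind the
   breadth-first labeling and uniform independent orders both induce the uniform
   distribution on the embeddings of [S_r].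

   [Sigma_r] is nonincreasing by submodularity of the entropy and invariance of the
   process, and the upper entropy is nonincreasing in [r] since restriction to
   balls is weakly continuous. *)

Set Implicit Arguments.
Unset Strict Implicit.
Unset Printing Implicit Defensive.
Import Order.TTheory GRing.Theory Num.Theory.
Import numFieldNormedType.Exports.
Local Open Scope ring_scope.

(** * Entropy and counting by types *)

(** The distance is known only through the topology that it generates. A good coloring is therefore
    used only through the probabilities of finitely many events that depend on a ball: these are
    clopen, so weak closeness controls them.

    Breadth-first labels cannot serve as types: near a short cycle, the two ends of an edge may not
    see neighborhoods that match. Non-backtracking walks along the orders give a type to every
    vertex of every ordered graph. Compatibility with the matching is then exact, and cycles matter
    only when the law of types is compared with that of the random labeling.

    No asymptotic formula for the number of matchings or of regular graphs is used. Both sides are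
    compared with the number of matchings, the factor [d! ^ n] for the orders appears on both and
    cancels, and the polynomial losses are absorbed in [expR (n * delta)]. *)

Section entropy.
Variables (R : realType) (T : finType).
Implicit Types p q mu : T -> R.

Definition is_dist p := (forall a, 0 <= p a) /\ \sum_a p a = 1.

Definition entropy p : R := - \sum_a p a * ln (p a).

Definition cross_entropy p q : R := \sum_a p a * - ln (q a).

(** Termwise [ln x <= x - 1] at [x = q / p]. The total mass of [q] may be smaller than that of [p],
    as happens in the proof of submodularity. *)
Lemma gibbs p q : (forall a, 0 <= p a) -> (forall a, 0 <= q a) ->
  (forall a, 0 < p a -> 0 < q a) -> \sum_a q a <= \sum_a p a ->
  entropy p <= cross_entropy p q.
Proof.
move=> p0 q0 pq qp; rewrite -subr_ge0 /entropy /cross_entropy opprK -big_split /=.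
apply: le_trans (_ : 0 <= \sum_a (p a - q a)) _; first by rewrite sumrB subr_ge0.
apply: ler_sum => a _.
have [->|pa] := eqVneq (p a) 0.
  by rewrite !mul0r addr0 sub0r oppr_le0.
have pa0 : 0 < p a by rewrite lt_neqAle eq_sym pa p0.
have qa0 := pq a pa0.
have : ln (q a / p a) <= q a / p a - 1.
  rewrite -[X in ln X](subrK 1) addrC; apply: le_ln1Dx.
  by rewrite ltrBrDr addNr divr_gt0.
rewrite ln_div ?posrE // => h.
have : p a * (ln (q a) - ln (p a)) <= p a * (q a / p a - 1) by rewrite ler_pM2l.
have -> : p a * (q a / p a - 1) = q a - p a.
  by rewrite mulrBr mulr1 mulrCA divff // mulr1.
lra.
Qed.

(* Perturbing [mu] to a law charging every point replaces the continuity of the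
   entropy by that of a linear functional: below, logarithms of [smooth] are
   integrated against the law that varies. *)
Definition smooth (eta : R) mu a : R := (mu a + eta) / (1 + #|T|%:R * eta).

Lemma smooth_sum eta mu : 0 < eta -> is_dist mu -> \sum_a smooth eta mu a = 1.
Proof.
move=> e0 [m0 m1]; rewrite /smooth -mulr_suml big_split /= m1 sumr_const -[eta *+ _]mulr_natl.
by rewrite divff // gt_eqF // ltr_pwDl // mulr_ge0 // ltW.
Qed.

Lemma smooth_gt0 eta mu a : 0 < eta -> is_dist mu -> 0 < smooth eta mu a.
Proof.
move=> e0 [m0 m1]; apply: divr_gt0; first exact: ltr_wpDl.
by rewrite ltr_pwDl // mulr_ge0 // ltW.
Qed.

Lemma smooth_ln_le0 eta mu a : 0 < eta -> is_dist mu -> ln (smooth eta mu a) <= 0.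
Proof.
move=> e0 md; apply: ln_le0; rewrite -(smooth_sum e0 md) (bigD1 a) //= lerDl.
by rewrite sumr_ge0 // => b _; rewrite ltW ?smooth_gt0.
Qed.

(** Lipschitz constant, for the sup norm, of the linear functional
    [cross_entropy _ (smooth eta mu)]. *)
Definition slack (eta : R) mu : R := \sum_a - ln (smooth eta mu a).

Lemma slack_ge0 eta mu : 0 < eta -> is_dist mu -> 0 <= slack eta mu.
Proof. by move=> *; rewrite sumr_ge0 // => a _; rewrite oppr_ge0 smooth_ln_le0. Qed.

Lemma cross_smooth_le eta mu : 0 < eta -> is_dist mu ->
  cross_entropy mu (smooth eta mu) <= entropy mu + #|T|%:R * eta.
Proof.
move=> e0 md; have [m0 m1] := md.
have D0 : 0 < 1 + #|T|%:R * eta by rewrite ltr_pwDl // mulr_ge0 // ltW.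
have -> : #|T|%:R * eta = \sum_a mu a * (#|T|%:R * eta) by rewrite -mulr_suml m1 mul1r.
rewrite /cross_entropy /entropy -sumrN -big_split /=.
apply: ler_sum => a _; rewrite -mulrN -mulrDr.
have [->|ma] := eqVneq (mu a) 0; first by rewrite !mul0r.
have ma0 : 0 < mu a by rewrite lt_neqAle eq_sym ma m0.
have mae : 0 < mu a + eta by exact: addr_gt0.
rewrite ler_pM2l // /smooth ln_div ?posrE // opprB addrC.
apply: lerD; first by rewrite lerN2 ler_ln ?posrE // lerDl ltW.
apply: le_ln1Dx; apply: lt_le_trans (_ : 0 <= _); first by rewrite ltrN10.
by rewrite mulr_ge0 // ltW.
Qed.

(** Only a lower bound is asked for: it is applied to the entropy of half-edge types, which enters
    the count with a minus sign. Half of [delta] pays for smoothing, half for moving from [mu] to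
    [p]. *)
Lemma entropy_cont_lb mu (delta : R) : is_dist mu -> 0 < delta ->
  exists2 eps, 0 < eps & forall p, is_dist p ->
    (forall a, `|p a - mu a| <= eps) -> entropy mu - delta <= entropy p.
Proof.
move=> md d0; have [m0 m1] := md.
pose eta := delta / 2 / (1 + #|T|%:R).
have T0 : 0 < 1 + #|T|%:R :> R by rewrite ltr_pwDl.
have e0 : 0 < eta by rewrite !divr_gt0.
have Te : #|T|%:R * eta <= delta / 2.
  rewrite mulrC /eta mulrAC ler_pdivrMr // ler_pM2l ?divr_gt0 //.
  by rewrite lerDr.
have s0 := slack_ge0 e0 md.
pose e1 := delta / 2 / (1 + slack eta mu).
have s1 : 0 < 1 + slack eta mu by rewrite ltr_pwDl.
have e10 : 0 < e1 by rewrite !divr_gt0.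
have e1s : e1 * slack eta mu <= delta / 2.
  by rewrite /e1 mulrAC ler_pdivrMr // ler_pM2l ?divr_gt0 // lerDr.
exists (Num.min eta e1); first by rewrite lt_min e0.
move=> p [p0 p1] pm.
have q0 a := smooth_gt0 a e0 md.
have D0 : 0 < 1 + #|T|%:R * eta by rewrite ltr_pwDl // mulr_ge0 // ltW.
(* A converse of the Gibbs inequality, with an error: [p] is at most [mu + eta], the numerator of
   [smooth]. *)
have h1 : cross_entropy p (smooth eta mu) - #|T|%:R * eta <= entropy p.
  have -> : #|T|%:R * eta = \sum_a p a * (#|T|%:R * eta) by rewrite -mulr_suml p1 mul1r.
  rewrite /cross_entropy /entropy -!sumrN -big_split /=.
  apply: ler_sum => a _; rewrite -mulrBr -[X in _ <= X]mulrN.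
  have [->|pa] := eqVneq (p a) 0; first by rewrite !mul0r.
  have pa0 : 0 < p a by rewrite lt_neqAle eq_sym pa p0.
  have me : p a <= mu a + eta.
    have := pm a; rewrite ler_norml le_min => /andP[_ /andP[h _]].
    by rewrite -lerBlDl.
  rewrite ler_pM2l // /smooth ln_div ?posrE // ?ltr_wpDl //.
  rewrite opprB lerBlDr addrC lerD //; last first.
    apply: le_ln1Dx; apply: lt_le_trans (_ : 0 <= _); first by rewrite ltrN10.
    by rewrite mulr_ge0 // ltW.
  by rewrite lerN2 ler_ln ?posrE // ltr_wpDl.
have h2 : cross_entropy mu (smooth eta mu) - e1 * slack eta mu <=
    cross_entropy p (smooth eta mu).
  rewrite /slack mulr_sumr -sumrN -big_split /=; apply: ler_sum => a _.
  rewrite -mulrBl ler_wpM2r ?oppr_ge0 ?smooth_ln_le0 //.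
  have := pm a; rewrite distrC ler_norml le_min => /andP[_ /andP[_ h]].
  by rewrite lerBlDr -lerBlDl.
have h3 : entropy mu <= cross_entropy mu (smooth eta mu).
  apply: gibbs => //; first by move=> a; exact: ltW.
  by rewrite smooth_sum // m1.
lra.
Qed.

(** Under the product of the laws [smooth eta mu], every member of [A] has mass at least the inverse
    of the bound. Upper bounds on the frequencies suffice because [- ln] of a probability is
    nonnegative. *)
Lemma card_close_le mu (delta : R) : is_dist mu -> 0 < delta ->
  exists2 eps, 0 < eps & forall n (A : {set {ffun 'I_n -> T}}),
    (forall t, t \in A -> forall a,
       #|[set v | t v == a]|%:R <= n%:R * (mu a + eps)) ->
    #|A|%:R <= expR (n%:R * (entropy mu + delta)).
Proof.
move=> md d0; have [m0 m1] := md.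
pose eta := delta / 2 / (1 + #|T|%:R).
have T0 : 0 < 1 + #|T|%:R :> R by rewrite ltr_pwDl.
have e0 : 0 < eta by rewrite !divr_gt0.
have Te : #|T|%:R * eta <= delta / 2.
  rewrite mulrC /eta mulrAC ler_pdivrMr // ler_pM2l ?divr_gt0 //.
  by rewrite lerDr.
have s0 := slack_ge0 e0 md.
pose e1 := delta / 2 / (1 + slack eta mu).
have s1 : 0 < 1 + slack eta mu by rewrite ltr_pwDl.
have e10 : 0 < e1 by rewrite !divr_gt0.
have e1s : e1 * slack eta mu <= delta / 2.
  by rewrite /e1 mulrAC ler_pdivrMr // ler_pM2l ?divr_gt0 // lerDr.
exists e1 => // n A hA; pose q := smooth eta mu.
have q0 a : 0 < q a := smooth_gt0 a e0 md.
have w t : t \in A -> expR (- (n%:R * (entropy mu + delta))) <= \prod_v q (t v).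
  move=> /hA ht.
  have -> : \prod_v q (t v) = expR (- \sum_v - ln (q (t v))).
    rewrite -sumrN expR_sum; apply: eq_bigr => v _.
    by rewrite opprK lnK ?posrE.
  rewrite ler_expR lerN2.
  have -> : \sum_v - ln (q (t v)) = \sum_a #|[set v | t v == a]|%:R * - ln (q a).
    rewrite (partition_big t predT) //=; apply: eq_bigr => a _.
    rewrite (eq_bigr (fun _ => - ln (q a))); last by move=> v /eqP ->.
    rewrite sumr_const mulr_natl; congr (_ *+ _).
    by apply: eq_card => v; rewrite !inE.
  apply: le_trans (_ : _ <= \sum_a n%:R * (mu a + e1) * - ln (q a)) _.
    by apply: ler_sum => a _; rewrite ler_wpM2r ?ht // oppr_ge0 smooth_ln_le0.
  under eq_bigr do rewrite -mulrA.
  rewrite -mulr_sumr ler_wpM2l //.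
  under eq_bigr do rewrite mulrDl.
  rewrite big_split /= -mulr_sumr -/(slack eta mu) -/(cross_entropy mu _).
  by have := cross_smooth_le e0 md; rewrite -/q; lra.
have : \sum_(t in A) \prod_v q (t v) <= 1.
  have h1 : \sum_(t : {ffun 'I_n -> T}) \prod_v q (t v) = 1.
    rewrite -(bigA_distr_bigA (fun _ => q)) /=.
    by rewrite big1 // => _ _; rewrite smooth_sum.
  rewrite -[X in _ <= X]h1 [X in _ <= X](bigID (mem A)) /= lerDl sumr_ge0 // => t _.
  by rewrite prodr_ge0 // => v _; exact: ltW.
have : \sum_(t in A) expR (- (n%:R * (entropy mu + delta))) <=
       \sum_(t in A) \prod_v q (t v) by apply: ler_sum.
rewrite sumr_const -[expR _ *+ _]mulr_natl => h1 /(le_trans h1).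
by rewrite expRN ler_pdivrMr ?expR_gt0 // mul1r.
Qed.

End entropy.

Lemma ler_sum_inj (R : numDomainType) (I J : finType) (P : pred I) (Q : pred J)
    (f : I -> J) (F : J -> R) :
  {in P &, injective f} -> (forall i, P i -> Q (f i)) ->
  (forall j, Q j -> 0 <= F j) ->
  \sum_(i | P i) F (f i) <= \sum_(j | Q j) F j.
Proof.
move=> fi PQ F0.
have -> : \sum_(i | P i) F (f i) = \sum_(j in f @: [set i | P i]) F j.
  rewrite big_imset; last by move=> i j; rewrite !inE; exact: fi.
  by apply: eq_bigl => i; rewrite inE.
rewrite [X in _ <= X](bigID (mem (f @: [set i | P i]))) /=.
rewrite -[X in X <= _]addr0; apply: lerD; last first.
  by apply: sumr_ge0 => j /andP[/F0].
rewrite le_eqVlt; apply/orP; left; apply/eqP; apply: eq_bigl => j.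
case: (boolP (j \in _)) => [/imsetP[i]|]; last by rewrite andbF.
by rewrite inE => /PQ Qi ->; rewrite Qi.
Qed.

(** * Marginals and submodularity of the entropy *)

Definition marginal (R : realType) (T U : finType) (f : T -> U) (p : T -> R) u : R :=
  \sum_(a | f a == u) p a.

Section marginal.
Variables (R : realType) (T U : finType) (f : T -> U) (p : T -> R).

Lemma marginal_dist : is_dist p -> is_dist (marginal f p).
Proof.
move=> [p0 p1]; split; first by move=> u; exact: sumr_ge0.
by rewrite -p1 (partition_big f predT).
Qed.

Lemma marginal_sum (F : U -> R) :
  \sum_u marginal f p u * F u = \sum_a p a * F (f a).
Proof.
rewrite [RHS](partition_big f predT) //=; apply: eq_bigr => u _.
by rewrite mulr_suml; apply: eq_bigr => a /eqP ->.
Qed.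

Lemma marginal_ge a : (forall a, 0 <= p a) -> p a <= marginal f p (f a).
Proof. by move=> p0; rewrite /marginal (bigD1 a) //= lerDl sumr_ge0. Qed.

Lemma marginal_comp (W : finType) (g : U -> W) w :
  marginal g (marginal f p) w = marginal (g \o f) p w.
Proof.
rewrite /marginal [RHS](partition_big f (fun u => g u == w)) //=.
apply: eq_bigr => u /eqP gu; apply: eq_bigl => a.
by case: eqP => [->|]; rewrite ?gu ?eqxx ?andbF.
Qed.

End marginal.

(** The Gibbs inequality against [px * py / pz], the coupling that makes [x] and [y] independent
    given their common part. *)
Lemma entropy_submodular (R : realType) (T U W Z : finType)
    (x : T -> U) (y : T -> W) (g : U -> Z) (h : W -> Z) (p : T -> R) :
  is_dist p -> (forall a, g (x a) = h (y a)) -> injective (fun a => (x a, y a)) ->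
  entropy p + entropy (marginal (g \o x) p) <=
  entropy (marginal x p) + entropy (marginal y p).
Proof.
move=> pd gh inj; have [p0 p1] := pd.
set px := marginal x p; set py := marginal y p; set pz := marginal (g \o x) p.
have [px0 px1] : is_dist px by exact: marginal_dist.
have [py0 py1] : is_dist py by exact: marginal_dist.
have [pz0 pz1] : is_dist pz by exact: marginal_dist.
pose q a := px (x a) * py (y a) / pz (g (x a)).
have xg a : 0 < p a -> 0 < px (x a).
  by move/lt_le_trans; apply; exact: marginal_ge.
have yg a : 0 < p a -> 0 < py (y a).
  by move/lt_le_trans; apply; exact: marginal_ge.
have zg a : 0 < p a -> 0 < pz (g (x a)).
  by move/lt_le_trans; apply; exact: (@marginal_ge _ _ _ (g \o x)).
have q0 a : 0 <= q a by rewrite divr_ge0 // mulr_ge0.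
have pzy z : pz z = marginal h py z.
  by rewrite marginal_comp; apply: eq_bigl => a /=; rewrite gh.
have qs : \sum_a q a <= \sum_a p a.
  (* By injectivity the sum over [a] is part of a sum over pairs with the same image in [Z]; summing
     over the second coordinate produces [pz], which cancels. *)
  pose Q (uw : U * W) := px uw.1 * py uw.2 / pz (g uw.1).
  apply: le_trans (_ : _ <= \sum_(uw | h uw.2 == g uw.1) Q uw) _.
    apply: (@ler_sum_inj _ _ _ predT _ (fun a => (x a, y a)) Q) => //=.
    - by move=> a b _ _; exact: inj.
    - by move=> a _; rewrite gh.
    - by move=> uw _; rewrite divr_ge0 // mulr_ge0.
  rewrite -(pair_big_dep predT (fun u w => h w == g u) (fun u w => Q (u, w))) /=.
  rewrite p1 -px1; apply: ler_sum => u _; rewrite /Q /=.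
  rewrite -mulr_suml -mulr_sumr -/(marginal h py (g u)) -pzy.
  have [->|z0] := eqVneq (pz (g u)) 0; first by rewrite mulr0 mul0r.
  by rewrite mulfK.
have G : entropy p <= cross_entropy p q.
  by apply: gibbs => // a pa; rewrite divr_gt0 ?mulr_gt0 ?xg ?yg ?zg.
apply: le_trans (lerD G (lexx _)) _.
have ent (V : finType) (f : T -> V) :
    entropy (marginal f p) = \sum_a p a * - ln (marginal f p (f a)).
  rewrite -(marginal_sum f p (fun v => - ln (marginal f p v))) /entropy -sumrN.
  by apply: eq_bigr => v _; rewrite mulrN.
rewrite !ent /cross_entropy -!big_split /= le_eqVlt; apply/orP; left; apply/eqP.
apply: eq_bigr => a _; rewrite -!mulrDr.
have [->|pa] := eqVneq (p a) 0; first by rewrite !mul0r.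
have pa0 : 0 < p a by rewrite lt_neqAle eq_sym pa p0.
congr (_ * _); rewrite /q ln_div ?posrE ?mulr_gt0 ?xg ?yg ?zg //.
by rewrite lnM ?posrE ?xg ?yg //; lra.
Qed.

Lemma entropy_inj (R : realType) (T U : finType) (f : T -> U) (g : U -> T)
    (p : T -> R) : cancel f g -> entropy (marginal f p) = entropy p.
Proof.
move=> fg; rewrite /entropy; congr (- _).
rewrite (marginal_sum f p (fun v => ln (marginal f p v))).
apply: eq_bigr => a _; congr (_ * ln _); rewrite /marginal (big_pred1 a) // => b /=.
by apply/eqP/eqP => [/(can_inj fg)|->].
Qed.

(** * Matchings compatible with half-edge types *)

Section factorial.
Variable R : realType.

(** The term of degree [n] in the exponential series at [n] is at most the sum of the series. *)
Lemma fact_ge n : expR (n%:R * ln n%:R - n%:R) <= n`!%:R :> R.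
Proof.
case: n => [|n]; first by rewrite mul0r subr0 expR0 fact0.
have h := @expR_ge1Dxn R n.+1%:R n (ler0n _ _).
rewrite expRB mulr_natl -lnXn ?ltr0n // lnK ?posrE ?exprn_gt0 ?ltr0n //.
rewrite ler_pdivrMr ?expR_gt0 //.
have : n.+1%:R ^+ n.+1 / n.+1`!%:R <= expR n.+1%:R :> R.
  by apply: le_trans h; rewrite lerDr.
by rewrite ler_pdivrMr ?ltr0n ?fact_gt0 // mulrC.
Qed.

(** The prefactor depends on [N] alone, so that one bound serves all the fibers of an assignment,
    empty ones included. *)
Lemma fact_le n N : (0 < N)%N -> (n <= N)%N ->
  n`!%:R <= N%:R * expR 1 * expR (n%:R * ln n%:R - n%:R) :> R.
Proof.
move=> N0; case: n => [_|n].
  rewrite mul0r subr0 expR0 mulr1 fact0 -[X in X <= _]mulr1 ler_pM ?ler1n //.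
  by rewrite -expR0 ler_expR.
move=> nN; apply: le_trans (_ : _ <= n.+1%:R * expR 1 * expR (n.+1%:R * ln n.+1%:R - n.+1%:R)) _; last first.
  by rewrite !ler_wpM2r ?expR_ge0 // ler_nat.
elim: n {nN} => [|n IH].
  by rewrite mul1r ln1 mulr0 sub0r -expRD subrr expR0.
rewrite factS natrM -mulrA ler_wpM2l //.
apply: le_trans IH _.
rewrite -expRD -[X in X * expR 1](@lnK R n.+1%:R) ?posrE ?ltr0n // -!expRD ler_expR.
have h : ln (n.+1%:R / n.+2%:R : R) <= - n.+2%:R^-1.
  have -> : n.+1%:R / n.+2%:R = 1 + - n.+2%:R^-1 :> R.
    rewrite -[n.+2]addn1 [in n.+1%:R / _](_ : n.+1 = (n.+1 + 1) - 1)%N ?addn1 ?subn1 //.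
    by rewrite -[(n.+2.-1)]subn1 natrB // mulrBl divff ?pnatr_eq0 // mul1r.
  apply: le_ln1Dx; rewrite ltrN2 invf_lt1 ?ltr0n // ltr1n //.
rewrite ln_div ?posrE ?ltr0n // in h.
have : n.+2%:R * (ln n.+1%:R - ln n.+2%:R) <= -1 :> R.
  apply: le_trans (_ : _ <= n.+2%:R * - n.+2%:R^-1) _; first by rewrite ler_wpM2l.
  by rewrite mulrN divff ?pnatr_eq0.
rewrite -[n.+2]addn1 natrD -[n.+1]addn1 natrD; set x := ln (n%:R + 1); set y := ln _.
lra.
Qed.

End factorial.

Section fiber_permutations.
Variables (H E : finType).

Definition fiber (t : {ffun H -> E}) (e : E) : {set H} := [set h | t h == e].

(** A permutation that preserves [t] is determined by its restrictions to the fibers. *)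
Lemma card_stab_le (t : {ffun H -> E}) :
  (#|[set s : {perm H} | [forall h, t (s h) == t h]]| <=
   \prod_e (#|fiber t e|)`!)%N.
Proof.
set A := [set s | _].
have AN s e : s \in A -> s \in ('N(fiber t e | 'P))%g.
  rewrite inE => /forallP As; rewrite inE; apply/andP; split; first by rewrite inE.
  rewrite inE; apply/fintype.subsetP => h; rewrite !inE => /eqP <-.
  by rewrite /aperm (eqP (As h)).
pose F (s : {perm H}) : {ffun E -> {perm H}} := [ffun e => restr_perm (fiber t e) s].
have Finj : {in A &, injective F}.
  move=> s u sA uA /ffunP Fsu; apply/permP => h.
  have hf : h \in fiber t (t h) by rewrite inE.
  have := Fsu (t h); rewrite !ffunE => /permP/(_ h).
  by rewrite !restr_permE ?AN.
rewrite -(card_in_imset Finj).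
have -> : (\prod_e (#|fiber t e|)`! = #|family (fun e => perm_on (fiber t e))|)%N.
  rewrite card_family foldrE big_map big_enum /=; apply: eq_bigr => e _.
  by rewrite card_perm.
apply: subset_leq_card; apply/fintype.subsetP => _ /imsetP[s sA ->].
by apply/familyP => e; rewrite ffunE; exact: restr_perm_on.
Qed.

Lemma card_perm_to_le (t t' : {ffun H -> E}) :
  (#|[set s : {perm H} | [forall h, t (s h) == t' h]]| <=
   \prod_e (#|fiber t e|)`!)%N.
Proof.
set A := [set s | _]; have [->|/finset.set0Pn[s0 s0A]] := eqVneq A finset.set0; first by rewrite cards0.
apply: leq_trans (card_stab_le t).
rewrite -(card_imset (mem A) (@mulgI _ s0^-1%g)).
apply: subset_leq_card; apply/fintype.subsetP => _ /imsetP[s sA ->].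
rewrite inE; apply/forallP => h; rewrite permM.
move: s0A sA; rewrite !inE => /forallP h0 /forallP h1.
by rewrite (eqP (h1 _)) -(eqP (h0 _)) permKV.
Qed.

End fiber_permutations.

Definition matchings (H : finType) : {set {perm H}} :=
  [set i : {perm H} | [forall h, (i (i h) == h) && (i h != h)]].

Section matching_count.
Variables (R : realType) (H E : finType) (bar : E -> E).
Hypothesis barK : involutive bar.

Definition compatible (t : {ffun H -> E}) (i : {perm H}) : bool :=
  [forall h, t (i h) == bar (t h)].

Definition empirical (t : {ffun H -> E}) (e : E) : R := #|fiber t e|%:R / #|H|%:R.

Lemma empirical_dist (t : {ffun H -> E}) : (0 < #|H|)%N -> is_dist (empirical t).
Proof.
move=> H0; split; first by move=> e; rewrite divr_ge0.
rewrite -mulr_suml -natr_sum.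
have -> : (\sum_e #|fiber t e| = #|H|)%N.
  rewrite -sum1_card (partition_big t predT) //=; apply: eq_bigr => e _.
  by rewrite -sum1_card; apply: eq_bigl => h; rewrite inE.
by rewrite divff // pnatr_eq0 -lt0n.
Qed.

Lemma prod_empirical (t t' : {ffun H -> E}) : (0 < #|H|)%N ->
  (forall e, #|fiber t' e| = #|fiber t e|) ->
  \prod_h empirical t (t' h) = expR (- (#|H|%:R * entropy (empirical t))).
Proof.
move=> H0 tt'.
have -> : \prod_h empirical t (t' h) = expR (\sum_h ln (empirical t (t' h))).
  rewrite expR_sum; apply: eq_bigr => h _; rewrite lnK // posrE.
  rewrite divr_gt0 ?ltr0n // -tt' card_gt0; apply/finset.set0Pn; exists h.
  by rewrite inE.
congr expR; rewrite /entropy mulrN opprK mulr_sumr.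
rewrite (partition_big t' predT) //=; apply: eq_bigr => e _.
rewrite (eq_bigr (fun _ => ln (empirical t e))); last by move=> v /eqP ->.
rewrite sumr_const -[ln _ *+ _]mulr_natl mulrA; congr (_ * _).
rewrite {1}/empirical mulrC divfK ?pnatr_eq0 -?lt0n // -tt'; congr (_%:R).
by apply: eq_card => h; rewrite !inE.
Qed.

(* A compatible [t'] is determined by its values on one half-edge of each pair, and
   the product law on these gives it mass [expR (- #|H|/2 * entropy)]. *)
Lemma card_compatible_le (t : {ffun H -> E}) (i : {perm H}) : (0 < #|H|)%N ->
  i \in matchings H -> (forall e, #|fiber t (bar e)| = #|fiber t e|) ->
  #|[set t' : {ffun H -> E} | compatible t' i &
       [forall e, #|fiber t' e| == #|fiber t e|]]|%:R <=
  expR (#|H|%:R / 2 * entropy (empirical t)) :> R.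
Proof.
move=> H0; rewrite inE => /forallP iM tb; set A := [set t' | _].
have iK h : i (i h) = h by have /andP[/eqP] := iM h.
have iN h : i h != h by have /andP[] := iM h.
have [p0 p1] := empirical_dist t H0; set p := empirical t in p0 p1 *.
have [h0 _] : exists h, h \in H by apply/card_gt0P.
pose e0 := t h0.
(* One half-edge of each pair, the one of smaller rank. *)
pose Rep := [set h : H | (enum_rank h < enum_rank (i h))%N].
have RepC h : (i h \in Rep) = (h \notin Rep).
  rewrite !inE iK -leqNgt ltn_neqAle; case: eqP => //= /ord_inj/enum_rank_inj/eqP.
  by rewrite (negbTE (iN h)).
have w t' : t' \in A ->
    \prod_(h in Rep) p (t' h) = expR (- (#|H|%:R / 2 * entropy p)).
  rewrite inE => /andP[/forallP c /forallP n].
  (* The law [p] is invariant under [bar], so the two half-edges of a pair have equal weights. *)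
  have e : \prod_h p (t' h) = (\prod_(h in Rep) p (t' h)) ^+ 2.
    rewrite (bigID (mem Rep)) /= expr2; congr (_ * _).
    rewrite (reindex_inj (@perm_inj _ i)) /=; apply: eq_big => [h|h _].
      by rewrite RepC negbK.
    by rewrite (eqP (c h)) /p /empirical tb.
  rewrite (prod_empirical H0) in e; last by move=> x; exact/eqP.
  have g0 : 0 <= \prod_(h in Rep) p (t' h) by exact: prodr_ge0.
  apply/eqP; rewrite -(eqrXn2 (n := 2)) ?expR_ge0 // -e -expRM_natl; apply/eqP.
  by congr expR; rewrite /p; lra.
have : \sum_(t' in A) \prod_(h in Rep) p (t' h) <= 1.
  have S1 : \sum_(f in pfamily e0 (mem Rep) (fun _ => predT)) \prod_(h in Rep) p (f h) = 1.
    by rewrite -(big_distr_big_dep e0 (mem Rep) (fun _ => predT) (fun _ => p)) big1.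
  rewrite -[X in _ <= X]S1; pose F (t' : {ffun H -> E}) := [ffun h => if h \in Rep then t' h else e0].
  have -> : \sum_(t' in A) \prod_(h in Rep) p (t' h) =
     \sum_(t' in A) \prod_(h in Rep) p (F t' h).
    by apply: eq_bigr => t' _; apply: eq_bigr => h hR; rewrite ffunE hR.
  apply: (@ler_sum_inj _ _ _ (mem A) _ F (fun f => \prod_(h in Rep) p (f h))).
  - move=> u v uA vA /ffunP uv; apply/ffunP => h.
    case: (boolP (h \in Rep)) => hR; first by have := uv h; rewrite !ffunE hR.
    move: uA vA; rewrite !inE => /andP[/forallP cu _] /andP[/forallP cv _].
    have := uv (i h); rewrite !ffunE RepC hR (eqP (cu h)) (eqP (cv h)).
    exact: (can_inj barK).
  - move=> u uA; apply/pfamilyP; split => //.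
    by apply/fintype.subsetP => h; rewrite unfold_in ffunE; case: ifP; rewrite ?eqxx.
  - by move=> f _; exact: prodr_ge0.
rewrite (eq_bigr _ w) sumr_const -[expR _ *+ _]mulr_natl expRN.
by rewrite ler_pdivrMr ?expR_gt0 // mul1r.
Qed.

(** Stirling bounds for a multinomial coefficient, with one polynomial factor for each symbol of
    [E]. *)
Lemma prod_fact_le (t : {ffun H -> E}) : (0 < #|H|)%N ->
  (\prod_e (#|fiber t e|)`!)%:R <=
  (#|H|%:R * expR 1) ^+ #|E| * expR (- (#|H|%:R * entropy (empirical t))) * (#|H|)`!%:R :> R.
Proof.
move=> H0; set N := #|H| in H0 *.
have fN e : (#|fiber t e| <= N)%N by exact: max_card.
have sN : \sum_e #|fiber t e|%:R = N%:R :> R.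
  have [_] := empirical_dist t H0; rewrite -mulr_suml => /divr1_eq; exact.
rewrite natr_prod.
apply: le_trans (_ : _ <= \prod_e (N%:R * expR 1 * expR (#|fiber t e|%:R * ln #|fiber t e|%:R - #|fiber t e|%:R))) _.
  by apply: ler_prod => e _; rewrite ler0n fact_le.
rewrite big_split /= prodr_const -expR_sum -mulrA ler_wpM2l ?exprn_ge0 ?mulr_ge0 ?expR_ge0 //.
apply: le_trans (_ : _ <= expR (- (N%:R * entropy (empirical t))) * expR (N%:R * ln N%:R - N%:R)) _; last first.
  by rewrite ler_wpM2l ?expR_ge0 ?fact_ge.
rewrite -expRD ler_expR sumrB sN addrA lerD2r /entropy mulrN opprK mulr_sumr.
rewrite -[X in _ <= _ + X * _]sN mulr_suml -big_split /=; apply: ler_sum => e _.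
rewrite /empirical -/N; set k := #|fiber t e|.
have [->|k0] := posnP k; first by rewrite !mul0r mulr0 addr0.
rewrite ln_div ?posrE ?ltr0n // mulrA (mulrCA N%:R) divff ?pnatr_eq0 -?lt0n // mulr1.
by rewrite -mulrDr subrK.
Qed.

(* Double counting of the pairs of a rearrangement of [t] and a matching compatible
   with it: the number of matchings does not depend on the rearrangement. *)
Lemma card_compatible_matchings (t : {ffun H -> E}) : (0 < #|H|)%N ->
  #|[set i in matchings H | compatible t i]|%:R <=
  #|matchings H|%:R * (#|H|%:R * expR 1) ^+ #|E| *
    expR (- (#|H|%:R / 2 * entropy (empirical t))) :> R.
Proof.
move=> H0; set K := [set i in _ | _].
have [->|/finset.set0Pn[i0]] := eqVneq K finset.set0.
  by rewrite cards0 !mulr_ge0 ?expR_ge0 ?exprn_ge0 ?mulr_ge0 ?expR_ge0.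
rewrite inE => /andP[i0M /forallP c0].
(* A compatible matching exchanges the fibers of [e] and [bar e]. *)
have tb e : #|fiber t (bar e)| = #|fiber t e|.
  have le e' : (#|fiber t e'| <= #|fiber t (bar e')|)%N.
    rewrite -(card_imset (mem (fiber t e')) (@perm_inj _ i0)).
    apply: subset_leq_card; apply/fintype.subsetP => _ /imsetP[h hf ->].
    by move: hf; rewrite !inE (eqP (c0 h)) => /eqP ->.
  by apply/eqP; rewrite eqn_leq le andbT -[X in (_ <= #|fiber t X|)%N]barK le.
pose sh (s : {perm H}) : {ffun H -> E} := [ffun h => t (s h)].
(* Conjugation by [s] carries the matchings compatible with the rearrangement to those compatible
   with [t]. *)
have Ks (s : {perm H}) : #|[set i in matchings H | compatible (sh s) i]| = #|K|.
  rewrite -(card_imset _ (@conjg_inj _ s)); apply: eq_card => i.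
  apply/imsetP/idP => [[j]|].
    rewrite !inE => /andP[/forallP jM /forallP jc] ->; apply/andP; split; apply/forallP => h.
      have jE x : (j ^ s)%g x = s (j (s^-1 x))%g by rewrite /conjg !permM.
      rewrite !jE permK; have /andP[/eqP -> jn] := jM (s^-1%g h).
      by rewrite permKV eqxx /= -[X in _ != X](permKV s) (inj_eq (@perm_inj _ s)).
    have jE x : (j ^ s)%g x = s (j (s^-1 x))%g by rewrite /conjg !permM.
    by have := jc (s^-1%g h); rewrite !ffunE jE permKV.
  rewrite !inE => /andP[/forallP iM /forallP ic]; exists (i ^ s^-1)%g; last by rewrite conjgKV.
  have iE x : (i ^ s^-1)%g x = (s^-1)%g (i (s x)) by rewrite /conjg !permM invgK.
  rewrite !inE; apply/andP; split; apply/forallP => h.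
    rewrite !iE permKV; have /andP[/eqP -> jn] := iM (s h).
    by rewrite permK eqxx /= -[X in _ != X](permK s) (inj_eq (@perm_inj _ _)).
  by rewrite !ffunE iE permKV.
pose B i := [set t' : {ffun H -> E} | compatible t' i &
       [forall e, #|fiber t' e| == #|fiber t e|]].
have bnd i : i \in matchings H ->
    (#|[set s | compatible (sh s) i]| <= #|B i| * \prod_e (#|fiber t e|)`!)%N.
  move=> iM; rewrite -sum1_card (partition_big sh (mem (B i))) /=; last first.
    move=> s; rewrite !inE => -> /=; apply/forallP => e; apply/eqP.
    rewrite -(card_imset (mem (fiber (sh s) e)) (@perm_inj _ s)).
    apply: eq_card => h; apply/imsetP/idP => [[x]|].
      by rewrite !inE ffunE => xe ->.
    by move=> hf; exists (s^-1 h)%g; rewrite ?permKV // !inE ffunE permKV; rewrite inE in hf.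
  rewrite -sum_nat_const; apply: leq_sum => t' _.
  apply: leq_trans (card_perm_to_le t t'); rewrite sum1_card.
  apply: subset_leq_card; apply/fintype.subsetP => s; rewrite [in X in X -> _]unfold_in => /andP[_ /eqP <-].
  by rewrite inE; apply/forallP => h; rewrite ffunE.
have dc : ((#|H|)`! * #|K| <= \sum_(i in matchings H) #|B i| * \prod_e (#|fiber t e|)`!)%N.
  have <- : #|{perm H}| = (#|H|)`!.
    rewrite -[in RHS]cardsT -card_perm; apply: eq_card => s.
    by rewrite inE [RHS]unfold_in; apply/esym/fintype.subsetP => h _; rewrite finset.in_setT.
  rewrite -sum_nat_const.
  under eq_bigr => s _ do rewrite -(Ks s) -sum1_card.
  apply: (@leq_trans (\sum_(i in matchings H) #|[set s | compatible (sh s) i]|)); last first.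
    by apply: leq_sum => i /bnd.
  under [X in (_ <= X)%N]eq_bigr => i _ do rewrite -sum1_card.
  rewrite (exchange_big_dep (mem (matchings H))) /=; last by move=> s i _; rewrite inE => /andP[].
  rewrite leq_eqVlt; apply/orP; left; apply/eqP; apply: eq_bigr => i iM.
  by apply: eq_bigl => s; rewrite [LHS]inE iM [RHS]inE.
have F0 : 0 < (#|H|)`!%:R :> R by rewrite ltr0n fact_gt0.
rewrite -(ler_pM2l F0) -natrM.
apply: le_trans (_ : _ <= (\sum_(i in matchings H) #|B i| * \prod_e (#|fiber t e|)`!)%:R) _.
  by rewrite ler_nat.
rewrite natr_sum; under eq_bigr do rewrite natrM.
rewrite -mulr_suml.
apply: le_trans (ler_wpM2l _ (prod_fact_le t H0)) _; first exact: sumr_ge0.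
(* Permutations yielding a given rearrangement are a proportion [e1 = e3 ^ 2] of all, up to
   polynomial factors; at most [e4 = 1 / e3] rearrangements fit a given matching. What remains is
   [e3]. *)
set e1 := expR (- (#|H|%:R * _)); set e3 := expR (- (_ / 2 * _)).
have -> : e1 = e3 * e3 by rewrite -expRD; congr expR; lra.
have : \sum_(i in matchings H) #|B i|%:R <=
    #|matchings H|%:R * expR (#|H|%:R / 2 * entropy (empirical t)) :> R.
  rewrite mulr_natl -sumr_const; apply: ler_sum => i iM; exact: card_compatible_le.
set e4 := expR _ => hB.
have e34 : e4 * e3 = 1 by rewrite /e3 /e4 expRN divff // gt_eqF // expR_gt0.
set c := (_ * expR 1) ^+ _; have cge0 : 0 <= c by rewrite exprn_ge0 // mulr_ge0 ?expR_ge0.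
apply: le_trans (ler_wpM2r _ hB) _; first by rewrite !mulr_ge0 ?expR_ge0.
set M := #|matchings H|%:R; set F := _`!%:R.
have -> : M * e4 * (c * (e3 * e3) * F) = F * (M * c * e3) * (e4 * e3) by lra.
by rewrite e34 mulr1.
Qed.

End matching_count.

(** Comparison with the term of degree [k + 1] of the exponential series. *)
Lemma poly_le_exp (R : realType) (C delta : R) (k : nat) : 0 <= C -> 0 < delta ->
  exists n0, forall n, (n0 <= n)%N -> (C * n%:R) ^+ k <= expR (n%:R * delta).
Proof.
move=> C0 d0; pose X := C ^+ k * k.+1`!%:R / delta ^+ k.+1.
exists (Num.truncn X).+1 => n nX.
have Xn : X <= n%:R.
  by apply: ltW; apply: lt_le_trans (truncnS_gt _) _; rewrite ler_nat.
have h := @expR_ge1Dxn R (n%:R * delta) k (mulr_ge0 (ler0n _ _) (ltW d0)).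
apply: le_trans (_ : _ <= (n%:R * delta) ^+ k.+1 / k.+1`!%:R) _; last first.
  by apply: le_trans h; rewrite lerDr.
rewrite ler_pdivlMr ?ltr0n ?fact_gt0 // !exprMn [n%:R ^+ k.+1]exprS.
rewrite ler_pdivrMr ?exprn_gt0 // in Xn.
have nk : 0 <= n%:R ^+ k :> R by rewrite exprn_ge0.
have := ler_wpM2r nk Xn; lra.
Qed.

(** * Pairs of a matching and a typical assignment of types *)

Section typical_pairs.
Variables (R : realType) (d : nat) (T E : finType) (e : 'I_d -> T -> E) (bar : E -> E).

Definition half_edge_types n (t : {ffun 'I_n -> T}) : {ffun 'I_n * 'I_d -> E} :=
  [ffun h => e h.2 (t h.1)].

(** The law of the type of a uniformly chosen half-edge at a vertex whose type has law [p]. *)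
Definition edge_marginal (p : T -> R) (b : E) : R :=
  d%:R^-1 * \sum_i marginal (e i) p b.

Lemma edge_marginal_dist p : (0 < d)%N -> is_dist p -> is_dist (edge_marginal p).
Proof.
move=> d0 pd; have [p0 p1] := pd; split.
  by move=> b; rewrite mulr_ge0 ?invr_ge0 // sumr_ge0 // => i _; exact: sumr_ge0.
rewrite -mulr_sumr exchange_big /=.
under eq_bigr => i _ do rewrite (marginal_dist (e i) pd).2.
by rewrite sumr_const card_ord -[1 *+ d]mulr_natl mulr1 mulVf // pnatr_eq0 -lt0n.
Qed.

Lemma empirical_half_edges n (t : {ffun 'I_n -> T}) b :
  empirical R (half_edge_types t) b = edge_marginal (empirical R t) b.
Proof.
rewrite /empirical card_prod !card_ord natrM /edge_marginal.
have -> : #|fiber (half_edge_types t) b| =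
    (\sum_(i : 'I_d) \sum_(a | e i a == b) #|fiber t a|)%N.
  rewrite -sum1_card.
  rewrite (eq_bigl (fun h : 'I_n * 'I_d => predT h.1 && (e h.2 (t h.1) == b))); last first.
    by move=> h; rewrite inE ffunE.
  rewrite -(pair_big_dep predT (fun v i => e i (t v) == b) (fun _ _ => 1%N)) /=.
  rewrite (exchange_big_dep predT) //=; apply: eq_bigr => i _.
  rewrite (partition_big t (fun a => e i a == b)) //=; apply: eq_bigr => a ea.
  rewrite -sum1_card; apply: eq_bigl => v; rewrite inE.
  by case: (t v =P a) => [->|]; rewrite ?ea ?andbF.
rewrite natr_sum [in RHS]mulr_sumr mulr_suml; apply: eq_bigr => i _.
rewrite natr_sum /marginal -mulr_suml invfM; lra.
Qed.

Lemma edge_marginal_close (p q : T -> R) (eps : R) b : (0 < d)%N ->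
  (forall a, `|p a - q a| <= eps) ->
  `|edge_marginal p b - edge_marginal q b| <= #|T|%:R * eps.
Proof.
move=> d0 pq; rewrite /edge_marginal -mulrBr -sumrB normrM ger0_norm ?invr_ge0 //.
rewrite mulrC ler_pdivrMr ?ltr0n //.
apply: le_trans (ler_norm_sum _ _ _) _.
apply: le_trans (_ : _ <= \sum_(i < d) #|T|%:R * eps) _; last first.
  by rewrite sumr_const card_ord mulr_natr.
apply: ler_sum => i _; rewrite /marginal -sumrB.
apply: le_trans (ler_norm_sum _ _ _) _.
have e0 a : 0 <= `|p a - q a| by [].
apply: le_trans (_ : _ <= \sum_a `|p a - q a|) _.
  by rewrite [X in _ <= X](bigID (fun a => e i a == b)) /= lerDl sumr_ge0.
by rewrite mulr_natl -sumr_const; exact: ler_sum.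
Qed.

Lemma card_typical_pairs (mu : T -> R) (delta : R) : (0 < d)%N -> involutive bar ->
  is_dist mu -> 0 < delta ->
  exists2 eps, 0 < eps & exists n0, forall n, (n0 <= n)%N ->
    #|[set it : {perm 'I_n * 'I_d} * {ffun 'I_n -> T} |
        [&& it.1 \in matchings ('I_n * 'I_d)%type,
            compatible bar (half_edge_types it.2) it.1 &
            [forall a, `|empirical R it.2 a - mu a| <= eps]]]|%:R <=
    #|matchings ('I_n * 'I_d)%type|%:R *
    expR (n%:R * (entropy mu - d%:R / 2 * entropy (edge_marginal mu) + delta)).
Proof.
move=> d0 barK mud delta0.
have dR : 0 < d%:R :> R by rewrite ltr0n.
have md := edge_marginal_dist d0 mud.
(* The half-edge entropy is multiplied by [n * d / 2], so an error [delta / d] costs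
   [n * delta / 2]. The number of assignments and the polynomial factor cost [n * delta / 4]
   each. *)
have [e1 e10 H1] := entropy_cont_lb md (divr_gt0 delta0 dR).
have d4 : 0 < delta / 4 by rewrite divr_gt0.
have [e2 e20 H2] := card_close_le mud d4.
have [n0 Hn0] := @poly_le_exp R (d%:R * expR 1) (delta / 4) #|E| (mulr_ge0 (ltW dR) (expR_ge0 1)) d4.
have T1 : 0 < 1 + #|T|%:R :> R by rewrite ltr_pwDl.
exists (Num.min (e1 / (1 + #|T|%:R)) e2); first by rewrite lt_min divr_gt0.
set eps := Num.min _ _.
exists n0.+1 => n nn0; set H := ('I_n * 'I_d)%type.
have n_gt0 : (0 < n)%N by exact: leq_ltn_trans nn0.
have HN : #|{: H}| = (n * d)%N by rewrite card_prod !card_ord.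
have H0 : (0 < #|{: H}|)%N by rewrite HN muln_gt0 n_gt0.
pose A := [set t : {ffun 'I_n -> T} | [forall a, `|empirical R t a - mu a| <= eps]].
set P := [set it : _ * _ | _].
pose K t := [set i in matchings H | compatible bar (half_edge_types t) i].
have PK : (#|P| <= \sum_(t in A) #|K t|)%N.
  rewrite -sum1_card (partition_big snd (mem A)) /=; last first.
    by move=> it; rewrite !inE => /and3P[].
  apply: leq_sum => t _; rewrite sum1_card.
  rewrite -(card_in_imset (f := fst)); last first.
    by move=> [i u] [j w] /andP[_ /eqP /= ->] /andP[_ /eqP /= ->] /= ->.
  apply: subset_leq_card; apply/fintype.subsetP => _ /imsetP[[i u] h ->] /=.
  by case/andP: h; rewrite !inE /= => /and3P[-> c _] /eqP <-.
have hA : #|A|%:R <= expR (n%:R * (entropy mu + delta / 4)) :> R.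
  apply: H2 => t; rewrite inE => /forallP tA a.
  have := tA a; rewrite ler_norml => /andP[_].
  rewrite /empirical card_ord lerBlDl -ler_pdivrMl ?ltr0n //.
  rewrite mulrC => /le_trans; apply; rewrite lerD2l /eps ge_min lexx orbT //.
have hK t : t \in A -> #|K t|%:R <= #|matchings H|%:R *
    (expR (n%:R * (delta / 4)) * expR (- (n%:R * (d%:R / 2 * entropy (edge_marginal mu) - delta / 2)))) :> R.
  rewrite inE => /forallP tA.
  apply: le_trans (@card_compatible_matchings R _ _ bar barK (half_edge_types t) H0) _.
  rewrite -mulrA ler_wpM2l //; apply: ler_pM; rewrite ?exprn_ge0 ?mulr_ge0 ?expR_ge0 //.
    have := Hn0 n (ltnW nn0); congr (_ ^+ _ <= _).
    by rewrite HN natrM; lra.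
  have h : entropy (edge_marginal mu) - delta / d%:R <= entropy (empirical R (half_edge_types t)).
    apply: H1 => [|b]; first exact: empirical_dist.
    rewrite empirical_half_edges.
    apply: le_trans (edge_marginal_close b d0 (eps := eps) _) _; first by move=> a; exact: tA.
    apply: le_trans (_ : _ <= (1 + #|T|%:R) * (e1 / (1 + #|T|%:R))) _; last first.
      by rewrite mulrC divfK // gt_eqF.
    have eps0 : 0 <= eps by rewrite ltW // lt_min divr_gt0.
    apply: ler_pM => //; first by rewrite lerDr.
    by rewrite /eps ge_min lexx.
  rewrite ler_expR lerN2 HN natrM.
  apply: le_trans (_ : _ <= n%:R * d%:R / 2 * (entropy (edge_marginal mu) - delta / d%:R)) _.
    have dd : d%:R * (delta / d%:R) = delta by rewrite mulrC divfK // gt_eqF.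
    have : n%:R * (d%:R * (delta / d%:R)) = n%:R * delta by rewrite dd.
    by set x := delta / d%:R; lra.
  by rewrite ler_wpM2l // divr_ge0 // mulr_ge0.
apply: le_trans (_ : _ <= (\sum_(t in A) #|K t|)%:R) _; first by rewrite ler_nat.
rewrite natr_sum; apply: le_trans (ler_sum _ hK) _.
rewrite sumr_const -[X in X <= _]mulr_natl mulrCA ler_wpM2l //.
apply: le_trans (ler_wpM2r _ hA) _; first by rewrite mulr_ge0 ?expR_ge0.
by rewrite -!expRD ler_expR; lra.
Qed.

End typical_pairs.

(** * Matchings without loops and multiple edges *)

(** Bernoulli's inequality [1 + k / m <= (1 + 1 / m) ^ k], cleared of denominators. *)
Lemma bernoulli_nat m k : (m ^ k * (m + k) <= m * m.+1 ^ k)%N.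
Proof.
elim: k => [|k IH]; first by rewrite !expn0 mul1n addn0 muln1.
rewrite !expnS.
have := leq_mul IH (leqnn m.+1); set a := (m ^ k)%N; set b := (m.+1 ^ k)%N => h.
apply: leq_trans (_ : _ <= m * b * m.+1)%N _; last by lia.
apply: leq_trans h; nia.
Qed.

Section switching.
Variables (n d : nat).
Local Notation V := 'I_n.
Local Notation H := ('I_n * 'I_d)%type.
Implicit Types (i : {perm H}) (h g k z : H) (u v x y : V).

Definition neighbors i u : {set V} := [set (i (u, j)).1 | j : 'I_d].

(** In a matching, the half-edges of a loop are parallel too: take [k = i h]. Excluding parallel
    half-edges thus excludes loops. *)
Definition parallel i h : bool :=
  [exists k, [&& k != h, k.1 == h.1 & (i k).1 == (i h).1]].

(* Loops count twice, so that switching two loops into a double edge decreases the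
   defect as well. *)
Definition defect i : nat := \sum_h (parallel i h + ((i h).1 == h.1)).

Definition simple_matchings : {set {perm H}} :=
  [set i in matchings H | [forall h, ~~ parallel i h]].

Lemma neighborsP i u x : reflect (exists2 k, k.1 = u & (i k).1 = x) (x \in neighbors i u).
Proof.
apply: (iffP imsetP) => [[j _ ->]|[[u' j] /= <- <-]]; last by exists j.
by exists (u, j).
Qed.

Lemma matchingP i : reflect (forall h, i (i h) = h /\ i h != h) (i \in matchings H).
Proof.
rewrite inE; apply: (iffP forallP) => h z; first by have /andP[/eqP] := h z.
by have [-> ->] := h z; rewrite eqxx.
Qed.

Section switch.
Variables (i : {perm H}) (h g : H).
Hypothesis iM : i \in matchings H.

Let iK z : i (i z) = z. Proof. by have /matchingP/(_ z)[] := iM. Qed.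
Let iN z : i z != z. Proof. by have /matchingP/(_ z)[] := iM. Qed.

Lemma neighbors_sym u x : (x \in neighbors i u) = (u \in neighbors i x).
Proof.
by apply/neighborsP/neighborsP => -[k ku kx]; exists (i k); rewrite ?iK.
Qed.

(** The two edges created by the switching are then neither loops nor parallel to an edge left in
    place. *)
Definition switchable : bool :=
  [&& parallel i h, g.1 \notin h.1 |: neighbors i h.1 &
      (i g).1 \notin (i h).1 |: neighbors i (i h).1].

(* The pairs [h, i h] and [g, i g] are replaced by [h, g] and [i h, i g]. *)
Definition switch : {perm H} := (i ^ tperm (i h) g)%g.

Hypothesis sw : switchable.
Local Notation u := h.1.
Local Notation v := (i h).1.
Local Notation x := g.1.
Local Notation y := (i g).1.

Let facts : [/\ [/\ x != u, y != v, x != v & y != u],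
  (x \notin neighbors i u), (u \notin neighbors i x),
  (y \notin neighbors i v) & (v \notin neighbors i y)].
Proof.
have /and3P[_] := sw; rewrite !in_setU1 !negb_or => /andP[xu xNu] /andP[yv yNv].
split=> //; try by rewrite -neighbors_sym.
split=> //; apply/eqP => e.
  by move: xNu; rewrite e => /neighborsP; case; exists h.
by move: yNv; rewrite e => /neighborsP; case; exists (i h); rewrite ?iK.
Qed.

Let gh : g != h.
Proof. by have [[xu _ _ _] _ _ _ _] := facts; apply: contraNneq xu => ->. Qed.
Let switchE z : switch z = tperm (i h) g (i (tperm (i h) g z)).
Proof. by rewrite /switch /conjg !permM tpermV. Qed.

Lemma switch_matching : switch \in matchings H.
Proof.
apply/matchingP => z; rewrite !switchE tpermK iK tpermK; split => //.
by rewrite -[X in _ != X](tpermK (i h) g) (inj_eq (@perm_inj _ _)).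
Qed.

Let ihg : i h != i g. Proof. by rewrite (inj_eq (@perm_inj _ _)) eq_sym gh. Qed.
Let gig : g != i g. Proof. by rewrite eq_sym iN. Qed.

Let sw_h : switch h = g.
Proof. by rewrite switchE (tpermD (iN h) gh) tpermL. Qed.
Let sw_g : switch g = h.
Proof. by rewrite switchE tpermR iK (tpermD (iN h) gh). Qed.
Let sw_ih : switch (i h) = i g.
Proof. by rewrite switchE tpermL (tpermD ihg gig). Qed.
Let sw_ig : switch (i g) = i h.
Proof. by rewrite switchE (tpermD ihg gig) iK tpermR. Qed.

Let Q := [set h; g; i h; i g].

Let sw_other z : z \notin Q -> switch z = i z.
Proof.
rewrite !inE !negb_or -!andbA => /and4P[zh zg zih zig].
rewrite switchE [tperm _ _ z]tpermD 1?eq_sym // tpermD //.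
  by rewrite (inj_eq (@perm_inj _ _)) eq_sym.
by apply: contraNneq zig => ->; rewrite iK.
Qed.

Let QP z : z \in Q -> [\/ z = h, z = g, z = i h | z = i g].
Proof.
rewrite !inE -!orbA => /or4P[]/eqP ->; [exact: Or41|exact: Or42|exact: Or43|exact: Or44].
Qed.

(** The created edges can only be parallel to each other, and this happens only when both removed
    edges were loops. *)
Let par_Q z : z \in Q -> parallel switch z -> u = v /\ x = y.
Proof.
have [[/eqP xu /eqP yv /eqP xv /eqP yu] /neighborsP n1 /neighborsP n2 /neighborsP n3 /neighborsP n4] := facts.
move=> zQ /existsP[k /and3P[kz /eqP k1 /eqP k2]].
have [kQ|kQ] := boolP (k \in Q); last first.
  rewrite (sw_other kQ) in k2; exfalso.
  by case: (QP zQ) => zE; rewrite zE ?sw_h ?sw_g ?sw_ih ?sw_ig in k1 k2;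
    [apply: n1|apply: n2|apply: n3|apply: n4]; exists k.
case: (QP zQ) => zE; case: (QP kQ) => kE; move: kz k1 k2;
  rewrite zE kE ?sw_h ?sw_g ?sw_ih ?sw_ig ?eqxx // => _ e1 e2; split; congruence.
Qed.

Let par_other z : z \notin Q -> parallel switch z -> parallel i z.
Proof.
have [_ /neighborsP n1 /neighborsP n2 /neighborsP n3 /neighborsP n4] := facts.
move=> zQ /existsP[k /and3P[kz /eqP k1 /eqP k2]].
rewrite (sw_other zQ) in k2.
have [kQ|kQ] := boolP (k \in Q).
  exfalso; case: (QP kQ) => kE; rewrite kE ?sw_h ?sw_g ?sw_ih ?sw_ig in k1 k2;
    [apply: n1|apply: n2|apply: n3|apply: n4]; exists z; exact/esym.
rewrite (sw_other kQ) in k2.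
by apply/existsP; exists k; rewrite kz k1 k2 !eqxx.
Qed.

Lemma switch_defect : (defect switch < defect i)%N.
Proof.
have [[/eqP xu /eqP yv /eqP xv /eqP yu] _ _ _ _] := facts.
have ph : parallel i h by have /and3P[] := sw.
rewrite /defect [X in (X < _)%N](bigID (mem Q)) [X in (_ < X)%N](bigID (mem Q)) /=.
rewrite -addSn; apply: leq_add; last first.
  apply: leq_sum => z zQ; rewrite (sw_other zQ) leq_add2r.
  by case: (boolP (parallel switch z)) => // /(par_other zQ) ->.
have l0 z : z \in Q -> ((switch z).1 == z.1) = false.
  move=> /QP zE; apply/eqP.
  by case: zE => ->; rewrite ?sw_h ?sw_g ?sw_ih ?sw_ig => e; [apply: xu|apply: xu|apply: yv|apply: yv].
have hQ : h \in Q by rewrite !inE eqxx.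
have [uvxy|uvxy] := boolP ((u == v) && (x == y)); last first.
  rewrite big1 => [|z zQ]; first by rewrite (bigD1 h) //= ph.
  rewrite l0 // addn0; apply/eqP; rewrite eqb0; apply/negP => /(par_Q zQ)[e1 e2].
  by rewrite e1 e2 !eqxx in uvxy.
have /andP[/eqP e1 /eqP e2] := uvxy.
(* Two loops become a double edge: each half-edge of [Q] now counts at most once, whereas before it
   counted at least once as part of a loop, and [h] counted twice. *)
apply: (@leq_ltn_trans (\sum_(z in Q) 1)).
  by apply: leq_sum => z zQ; rewrite l0 // addn0 leq_b1.
rewrite (bigD1 h) //= [X in (_ < X)%N](bigD1 h) //= ph -e1 eqxx -addSn.
apply: leq_add => //; apply: leq_sum => z /andP[/QP zE _].
by case: zE => ->; rewrite ?iK -?e1 -?e2 eqxx addn1.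
Qed.

(* Since [h] was parallel, [i h] is near [h] in the switched matching too: this
   bounds the number of preimages of a switching linearly in [n]. *)
Lemma switch_parallel : v \in u |: neighbors switch u.
Proof.
have [[/eqP xu /eqP yv /eqP xv /eqP yu] _ _ _ _] := facts.
rewrite in_setU1; case: eqP => //= vu; apply/neighborsP.
have /and3P[/existsP[k /and3P[/eqP kh /eqP k1 /eqP k2]] _ _] := sw.
exists k => //; rewrite sw_other //; apply/negP => /QP[] kE; move: kh k1 k2; rewrite kE // => _ *; congruence.
Qed.

(** The switched matching, [h] and [i h] determine [i] and [g]: switchings are counted by this
    data. *)
Lemma switch_inv : g = switch h /\ i = (switch ^ tperm (i h) (switch h))%g.
Proof. by rewrite sw_h /switch -conjgM tperm2 conjg1. Qed.

End switch.


(** Bounds the number of half-edges at a vertex or at one of its neighbors. *)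
Let c := (d.+1 * d)%N.

Lemma card_near i u : (#|[set g : H | g.1 \in u |: neighbors i u]| <= c)%N.
Proof.
set S := u |: neighbors i u.
have -> : [set g : H | g.1 \in S] = finset.setX S finset.setT.
  by apply/setP => g; rewrite !inE andbT.
rewrite cardsX cardsT card_ord leq_mul2r; apply/orP; right.
rewrite cardsU1 -add1n; apply: leq_add; first by case: (_ \notin _).
by apply: leq_trans (leq_imset_card _ _) _; rewrite card_ord.
Qed.

Lemma card_switchable i h : parallel i h ->
  (n * d <= #|[set g | switchable i h g]| + 2 * c)%N.
Proof.
move=> ph; set A := [set g | _].
have -> : (n * d)%N = #|[set: H]%SET| by rewrite cardsT card_prod !card_ord.
pose B1 := [set g : H | g.1 \in h.1 |: neighbors i h.1].
pose B2 := [set g : H | g.1 \in (i h).1 |: neighbors i (i h).1].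
have sub : [set: H]%SET \subset (A :|: (B1 :|: (i @^-1: B2)))%SET.
  apply/fintype.subsetP => g _; rewrite finset.in_setU finset.in_setU [g \in i @^-1: _]inE.
  rewrite [g \in A]inE [g \in B1]inE [i g \in B2]inE /switchable ph /=.
  by case: (_ \in _) => //; case: (_ \in _).
apply: leq_trans (subset_leq_card sub) _.
apply: leq_trans (leq_card_setU _ _) _; rewrite leq_add2l.
apply: leq_trans (leq_card_setU _ _) _; rewrite mul2n -addnn; apply: leq_add.
  exact: card_near.
apply: leq_trans (card_near i (i h).1); rewrite -(card_imset _ (@perm_inj _ i)).
by apply: subset_leq_card; apply/fintype.subsetP => _ /imsetP[g gB ->]; rewrite inE in gB.
Qed.

Lemma defect_parallel i : i \in matchings H ->
  (defect i <= 2 * #|[set h | parallel i h]|)%N.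
Proof.
move=> iM; rewrite -sum1_card big_distrr /= [X in (_ <= X)%N]big_mkcond /=.
apply: leq_sum => h _; rewrite inE.
case: (boolP (parallel i h)) => ph; first by case: eqP.
rewrite add0n leqn0 eqb0; apply: contra ph => /eqP e; apply/existsP; exists (i h).
by have /matchingP/(_ h)[-> ->] := iM; rewrite e eqxx.
Qed.

Definition defective b : {set {perm H}} := [set i in matchings H | defect i == b].
Definition defective_lt b : {set {perm H}} := [set i in matchings H | (defect i < b)%N].

(* The factor [b] is what makes the product of the successive ratios
   [1 + 4 * c / b] polynomial. *)
Lemma card_defective b : (4 * c <= n * d)%N -> (0 < n * d)%N ->
  (b * #|defective b| <= 4 * c * #|defective_lt b|)%N.
Proof.
move=> big nd0.
pose Tr := [set t : {perm H} * H * H | (t.1.1 \in defective b) && switchable t.1.1 t.1.2 t.2].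
(* A matching of defect [b] has at least [b / 2] parallel half-edges, and each leaves at least
   [n * d - 2 * c] choices of [g]. *)
have lower : (b * #|defective b| * (n * d - 2 * c) <= 2 * #|Tr|)%N.
  have -> : #|Tr| = (\sum_(i in defective b) \sum_h #|[set g | switchable i h g]|)%N.
    rewrite -sum1_card.
    rewrite (eq_bigl (fun t : {perm H} * H * H => (t.1.1 \in defective b) && switchable t.1.1 t.1.2 t.2)); last by move=> t; rewrite inE.
    rewrite -(pair_big_dep (fun ih : {perm H} * H => ih.1 \in defective b) (fun ih g => switchable ih.1 ih.2 g) (fun _ _ => 1%N)) /=.
    rewrite (eq_bigl (fun ih : {perm H} * H => (ih.1 \in defective b) && true)); last by move=> ?; rewrite andbT.
    rewrite -(pair_big_dep (fun i : {perm H} => i \in defective b) (fun _ _ => true) (fun i h => \sum_(g | switchable i h g) 1)%N) /=.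
    by apply: eq_bigr => i _; apply: eq_bigr => h _; rewrite sum1_card cardsE.
  rewrite big_distrr /=.
  rewrite [X in (X <= _)%N](_ : _ = \sum_(i in defective b) b * (n * d - 2 * c))%N; last first.
    by rewrite sum_nat_const mulnCA mulnA.
  apply: leq_sum => i; rewrite inE => /andP[iM /eqP <-].
  apply: leq_trans (_ : _ <= 2 * #|[set h | parallel i h]| * (n * d - 2 * c))%N _.
    by rewrite leq_mul2r defect_parallel ?orbT.
  rewrite -mulnA leq_mul2l /= -sum_nat_const.
  apply: leq_trans (_ : _ <= \sum_(h in [set h | parallel i h]) #|[set g | switchable i h g]|)%N _.
    by apply: leq_sum => h; rewrite inE => /card_switchable; rewrite leq_subLR addnC.
  by rewrite [X in (_ <= X)%N](bigID (mem [set h | parallel i h])) /= leq_addr.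
(* Given the switched matching and [h], only [c] values of [i h] are possible, by
   [switch_parallel]. *)
have upper : (#|Tr| <= #|defective_lt b| * (n * d) * c)%N.
  pose F (t : {perm H} * H * H) := (switch t.1.1 t.1.2 t.2, t.1.2, t.1.1 t.1.2).
  pose W := [set t : {perm H} * H * H | (t.1.1 \in defective_lt b) && (t.2.1 \in t.1.2.1 |: neighbors t.1.1 t.1.2.1)].
  have -> : (#|defective_lt b| * (n * d) * c)%N = (\sum_(i in defective_lt b) \sum_(h : H) c)%N.
    by rewrite !sum_nat_const card_prod !card_ord !mulnA.
  have FW : F @: Tr \subset W.
    apply/fintype.subsetP => _ /imsetP[[[i h] g] + ->].
    rewrite inE /= => /andP[]; rewrite inE => /andP[iM /eqP ib] sw.
    rewrite inE /= switch_parallel // andbT inE switch_matching //=.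
    by rewrite -ib switch_defect.
  have Finj : {in Tr &, injective F}.
    move=> [[i h] g] [[i' h'] g']; rewrite inE /= => /andP[].
    rewrite inE => /andP[iM _] sw; rewrite inE /= => /andP[].
    rewrite inE => /andP[iM' _] sw' [e1 e2 e3].
    have [gE iE] := switch_inv iM sw; have [gE' iE'] := switch_inv iM' sw'.
    have gg : g = g' by rewrite gE gE' e1 e2.
    have ii : i = i' by rewrite [LHS]iE [RHS]iE' e1 e3 e2.
    by rewrite ii e2 gg.
  rewrite -(card_in_imset Finj); apply: leq_trans (subset_leq_card FW) _.
  rewrite -sum1_card.
  rewrite (eq_bigl (fun t : {perm H} * H * H => (t.1.1 \in defective_lt b) && (t.2.1 \in t.1.2.1 |: neighbors t.1.1 t.1.2.1))); last by move=> t; rewrite inE.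
  rewrite -(pair_big_dep (fun ih : {perm H} * H => ih.1 \in defective_lt b) (fun ih g => g.1 \in ih.2.1 |: neighbors ih.1 ih.2.1) (fun _ _ => 1%N)) /=.
  rewrite (eq_bigl (fun ih : {perm H} * H => (ih.1 \in defective_lt b) && true)); last by move=> ?; rewrite andbT.
  rewrite -(pair_big_dep (fun i : {perm H} => i \in defective_lt b) (fun _ _ => true) (fun i h => \sum_(g : H | g.1 \in h.1 |: neighbors i h.1) 1)%N) /=.
  apply: leq_sum => i _; apply: leq_sum => h _; rewrite sum1_card.
  by apply: leq_trans (card_near i h.1); rewrite cardsE.
have h2 : (n * d <= 2 * (n * d - 2 * c))%N by lia.
rewrite -(leq_pmul2r nd0).
apply: leq_trans (leq_mul (leqnn _) h2) _.
have := leq_trans lower (leq_mul (leqnn 2) upper); lia.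
Qed.

Lemma card_matchings_le : (4 * c <= n * d)%N -> (0 < n * d)%N ->
  (#|matchings H| <= (2 * (n * d)).+1 ^ (4 * c) * #|simple_matchings|)%N.
Proof.
move=> big nd0.
have S0 : defective_lt 1 = simple_matchings.
  apply/setP => i; rewrite !inE; apply: andb_id2l => iM.
  rewrite ltnS leqn0 sum_nat_eq0; apply: eq_forallb => h /=.
  rewrite addn_eq0 !eqb0; case: (boolP (parallel i h)) => //= ph; apply/esym.
 
  rewrite -[LHS]/(~~ false); congr negb; apply/esym/eqP => e; move/negP: ph; apply; apply/existsP; exists (i h).
  by have /andP[/eqP -> ->] := forallP iM h; rewrite e eqxx.
(* The passage from [b + 1] to [b + 2] costs the factor [1 + 4 * c / (b + 1)], at most the ratio of
   the successive powers. *)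
have ind b : (#|defective_lt b.+1| <= b.+1 ^ (4 * c) * #|simple_matchings|)%N.
  elim: b => [|b IH]; first by rewrite S0 exp1n mul1n.
  have -> : #|defective_lt b.+2| = (#|defective_lt b.+1| + #|defective b.+1|)%N.
    rewrite -(cardsID (defective_lt b.+1)); congr (_ + _)%N; apply: eq_card => i.
      rewrite !inE; case: (boolP [forall _, _]) => //= _.
      by rewrite andbC; case: (ltnP (defect i) b.+1) => //= h; rewrite ltnS ltnW.
    rewrite !inE; case: (boolP [forall _, _]) => //= _.
    by rewrite -leqNgt ltnS eq_sym eqn_leq.
  have h1 := card_defective b.+1 big nd0.
  have h2 := bernoulli_nat b.+1 (4 * c).
  rewrite -(leq_pmul2l (ltn0Sn b)) mulnDr mulnA.
  set a := #|defective_lt b.+1| in h1 IH *; set s := #|simple_matchings| in IH *.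
  set e := (b.+1 ^ (4 * c))%N in IH h2; set e' := (b.+2 ^ (4 * c))%N in h2 *.
  apply: leq_trans (_ : _ <= (b.+1 + 4 * c) * (e * s))%N _.
    apply: leq_trans (_ : _ <= (b.+1 + 4 * c) * a)%N _; last by rewrite leq_mul2l IH orbT.
    by rewrite mulnDl leq_add2l.
  by rewrite mulnA [X in (X * _ <= _)%N]mulnC; apply: leq_mul.
apply: leq_trans (ind (2 * (n * d))%N); apply: subset_leq_card.
apply/fintype.subsetP => i iM; rewrite inE iM /= ltnS.
apply: leq_trans (defect_parallel iM) _; rewrite leq_mul2l /=.
by apply: leq_trans (max_card _) _; rewrite card_prod !card_ord.
Qed.

End switching.

(** * Local types read off ordered neighborhoods *)

Section descend.
Variables (V : eqType) (O : V -> seq V).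

(* A state is the current vertex together with the vertex it was reached from. *)
Definition step (s : option V * V) (k : nat) : option V * V :=
  (Some s.2, nth s.2 [seq w <- O s.2 | Some w != s.1] k.-1).

Definition walk s (l : label) : V := (foldl step s l).2.

(** For an ordered regular graph this is the covering map from the tree. Labels are read as
    non-backtracking walks, whether or not the ball of [v] is a tree. *)
Definition descend v (l : label) : V := walk (None, v) l.

(** The tree seen from [v] when [w] is its child 1. The other neighbors of [v] are ranked without
    [w], whence [k.-1], as for a walk that arrives from [w]. *)
Definition arc_descend v w (l : label) : V :=
  match l with
  | [::] => v
  | k :: s => if k == 1 then walk (Some v, w) s else walk (Some w, v) (k.-1 :: s)
  end.

Lemma walk_cons s k l : walk s (k :: l) = walk (step s k) l.
Proof. by []. Qed.

Lemma descend_rcons v l k : descend v (rcons l k) =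
  nth (descend v l) [seq w <- O (descend v l) |
    Some w != (if l is [::] then None else Some (descend v (take (size l).-1 l)))] k.-1.
Proof.
rewrite /descend /walk foldl_rcons /=; case/lastP: l => [//|l j].
rewrite foldl_rcons size_rcons /= -cats1 take_size_cat //.
by case: (l ++ [:: j]) (f_equal size (cats1 l j)); rewrite ?size_rcons.
Qed.

(* [first_arc i] maps the edge from the root to [1] onto the edge from the root to
   the [i]-th child ([i] starting at 0), keeping the order of the other children;
   [flip_arc] exchanges the root and its child [1]. *)
Definition first_arc (i : nat) (l : label) : label :=
  if l is k :: s then (if k == 1 then i.+1 else (bump i k.-2).+1) :: s else [::].

Definition flip_arc (l : label) : label :=
  match l with
  | [::] => [:: 1%N]
  | k :: s => if k == 1 then (if s is b :: s' then b.+1 :: s' else [::])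
              else 1%N :: k.-1 :: s
  end.

Lemma nth_filter_bump (s : seq V) x i j : uniq s -> (i < size s)%N ->
  nth x [seq y <- s | y != nth x s i] j = nth x s (bump i j).
Proof.
move=> us si; rewrite -(rem_filter _ us) remE index_uniq //.
rewrite nth_cat size_takel ?(ltnW si) // /bump.
case: (ltnP j i) => ij; first by rewrite nth_take.
by rewrite nth_drop; congr nth; rewrite addSn subnKC.
Qed.

Lemma descend_first_arc v i l : uniq (O v) -> (i < size (O v))%N ->
  all (fun k => 0 < k)%N l ->
  descend v (first_arc i l) = arc_descend v (nth v (O v) i) l.
Proof.
move=> uO iO; case: l => [//|k s] /= /andP[k0 _].
rewrite /descend walk_cons; case: eqP => k1 /=.
  by rewrite /step /= filter_predT.
rewrite walk_cons /step /= filter_predT; congr (walk (_, _) _).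
by rewrite -nth_filter_bump.
Qed.

(** The two ends of an edge see the same map up to [flip_arc]; compatibility of types with the
    matching rests on this. *)
Lemma arc_descend_flip v w l : all (fun k => 0 < k)%N l ->
  arc_descend v w (flip_arc l) = arc_descend w v l.
Proof.
case: l => [//|k s] /= /andP[k0 s0].
case: eqP => k1 /=; last by rewrite /walk.
by case: s s0 => [//|b s] /= /andP[b0 _]; rewrite eqSS -[b == 0]negbK -lt0n b0.
Qed.

Lemma flip_arcK l : all (fun k => 0 < k)%N l -> flip_arc (flip_arc l) = l.
Proof.
case: l => [//|k s] /= /andP[k0 s0]; case: eqP => k1 /=.
  case: s s0 => [|b s] /=; first by rewrite k1.
  by move=> /andP[b0 _]; rewrite eqSS -[b == 0]negbK -lt0n b0 /= k1.
by rewrite prednK.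
Qed.

End descend.

Section tree_sets.
Variable d : nat.
Local Notation tree := (tree d).

Lemma tree_label_pos (t : tree) : all (fun k => 0 < k)%N (val t).
Proof.
have := valP t; case: (val t) => [//|k s] /= /andP[/andP[-> _] /allP h] /=.
by apply/allP => j /h /andP[].
Qed.

Lemma tree_ball_sizeP r (t : tree) :
  tree_ball r [set v | val v = [::]]%classic t <-> (size (val t) <= r)%N.
Proof.
split.
  move=> [u /= u0 [p [pu <- pr]]]; apply: leq_trans pr.
  have -> : size p = (size (tree_val u) + size p)%N by rewrite u0.
  elim: p u {u0} pu => [|w p IH] u /=; first by rewrite addn0.
  move=> /andP[uw /IH/leq_trans]; apply; rewrite addnS -addSn leq_add2r.
  by case: (tree_edge_size uw) => /= h; lia.
have [k] := ubnP (size (val t)); elim: k t r => // k IH t r tk tr.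
case/lastP E: (val t) => [|l j].
  by exists t => //; exists [::].
have tl : tree_label d l.
  by have := valP t; rewrite E tree_label_rcons => /and3P[].
rewrite E size_rcons in tk tr.
have /= [] := IH (Tree tl) r.-1; first by lia.
  by rewrite /=; lia.
move=> u u0 [p [pp pl ps]]; exists u => //; exists (rcons p t).
rewrite rcons_path pp pl last_rcons size_rcons; split => //; last by lia.
by rewrite /= E /tree_edge parent_of_rcons.
Qed.

Definition edge_label r (l : label) : bool :=
  (size l <= r)%N || (if l is k :: s then (k == 1) && (size s <= r)%N else false).

Lemma tree_ball_edgeP r (t : tree) : (0 < d)%N ->
  tree_ball r [set v | val v = [::] \/ val v = [:: 1%N]]%classic t <->
  edge_label r (val t).
Proof.
move=> d0; split.
  move=> [u /= u0 [p [pu <- pr]]].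
  have : edge_label 0 (tree_val u) by case: u0 => ->.
  move: (0%N) (leq0n (r - size p)) => m mr um.
  suff h : edge_label (m + size p) (tree_val (last u p)).
    apply/orP; case/orP: h => [h|h]; [left|right]; first by lia.
    by case: (tree_val _) h => // k s /andP[-> /=]; lia.
  elim: p m u {u0 pr mr} um pu => [|w p IH] m u um /=; first by rewrite addn0.
  move=> /andP[uw pw]; rewrite addnS -addSn; apply: IH => //.
  move: um uw; rewrite /edge_label /tree_edge => /orP[um|].
    by move=> uw; apply/orP; left; case: (tree_edge_size uw) => h; lia.
  case E: (tree_val u) => [//|k s] /andP[/eqP k1 sm] /orP[/parent_ofP[j ->]|].
    by apply/orP; right; rewrite /= k1 eqxx size_rcons.
  case: (lastP s) sm => [|s' j] sm.
    by move=> /parent_of_size /= [] /esym/size0nil ->.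
  rewrite -rcons_cons => /parent_ofP[j' /rcons_inj[<- _]].
  by rewrite k1 eqxx size_rcons in sm *; apply/orP; right; rewrite /=; lia.
case/orP => [tr|].
  have /tree_ball_sizeP[u /= u0 h] := tr.
  by exists u => //; left.
have [k] := ubnP (size (val t)); elim: k t r => // k IH t r tk.
case E: (val t) => [//|a s] /andP[/eqP a1 sr]; rewrite {}a1 in E.
case: (lastP s) E sr => [|s' j] E sr.
  by exists t; [right|exists [::]].
have tl : tree_label d (1%N :: s').
  by have := valP t; rewrite E -rcons_cons tree_label_rcons => /and3P[].
rewrite E /= size_rcons in tk; rewrite size_rcons in sr.
have /= [||u u0 [p [pp pl ps]]] := IH (Tree tl) r.-1; first by rewrite /=; lia.
  by rewrite /=; lia.
exists u => //; exists (rcons p t).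
rewrite rcons_path pp pl last_rcons size_rcons; split => //; last by lia.
by rewrite /= E -rcons_cons /tree_edge parent_of_rcons.
Qed.

Lemma finite_small_labels r (S : set tree) :
  (forall t, S t -> (size (val t) <= r)%N) -> finite_set S.
Proof.
move=> Sr; have [s hs] := tree_ball_seq d r.
apply: sub_finite_set (finite_seq s) => t /Sr; exact: hs.
Qed.

Lemma S_ballE r t : (t \in fset_set (@S_ball d r)) = (size (val t) <= r)%N.
Proof.
have Sf : finite_set (@S_ball d r).
  by apply: (@finite_small_labels r) => u /tree_ball_sizeP.
by rewrite in_fset_set //; apply/idP/idP => [/set_mem/tree_ball_sizeP|/tree_ball_sizeP/mem_set].
Qed.

(** [E_ball r.+1] has radius [r] around its edge, so it lies in the ball of radius [r + 1] around
    either end. *)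
Lemma E_ballE r t : (0 < d)%N -> (t \in fset_set (@E_ball d r.+1)) = edge_label r (val t).
Proof.
move=> d0; have Ef : finite_set (@E_ball d r.+1).
  apply: (@finite_small_labels r.+1) => u /(tree_ball_edgeP _ _ d0)/orP[|].
    by move/leq_trans; apply.
  by case: (val u) => [//|k s] /andP[].
rewrite in_fset_set //; apply/idP/idP.
  by move/set_mem/(tree_ball_edgeP _ _ d0).
by move/(tree_ball_edgeP _ _ d0)/mem_set.
Qed.

Lemma first_arc_label i l : (i < d)%N -> tree_label d l -> tree_label d (first_arc i l).
Proof.
case: l => [//|k s] id /= /andP[/andP[k0 kd] ->]; rewrite andbT.
by case: eqP => k1 //=; rewrite /bump; lia.
Qed.

Lemma flip_arc_label l : (0 < d)%N -> tree_label d l -> tree_label d (flip_arc l).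
Proof.
case: l => [|k s] d0 /=; first by rewrite d0.
move=> /andP[/andP[k0 kd] sd]; case: eqP => k1.
  case: s sd => [//|b s] /= /andP[/andP[b0 bd] ->].
  by rewrite andbT; lia.
by rewrite /= sd andbT; lia.
Qed.

Lemma first_arc_size i l : size (first_arc i l) = size l.
Proof. by case: l. Qed.

Lemma flip_arc_edge r l : all (fun k => 0 < k)%N l -> edge_label r l ->
  edge_label r (flip_arc l).
Proof.
rewrite /edge_label; case: l => [|k s] /=; first by rewrite orbT.
move=> /andP[k0 s0].
case: eqP => k1 /=.
  case: s s0 => [//|b s] /= _; lia.
by rewrite orbF => ->; rewrite orbT.
Qed.

End tree_sets.

(** * Types of vertices and of half-edges *)

Section local_types.
Variables (d : nat) (A : Type).

Definition lookup (S : {fset tree d}) (t : {ffun S -> A}) (a : A) (l : label) : A :=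
  if [pick b : S | val (val b) == l] is Some b then t b else a.

Lemma lookupE (S : {fset tree d}) (t : {ffun S -> A}) a (b : S) : lookup t a (val (val b)) = t b.
Proof.
rewrite /lookup; case: pickP => [c /eqP/val_inj/val_inj -> //|/(_ b)].
by rewrite eqxx.
Qed.

Lemma lookup_fun (S : {fset tree d}) (F : label -> A) a l (tl : tree_label d l) : Tree tl \in S ->
  lookup [ffun b : S => F (val (val b))] a l = F l.
Proof.
move=> lS; have -> : l = val (val [` lS]%fset) by [].
by rewrite lookupE ffunE.
Qed.

End local_types.

Section ball_types.
Variables (d r : nat) (M : finPointedType).
Hypothesis d0 : (0 < d)%N.

Definition ball_type : finType := {ffun fset_set (@S_ball d r.+1) -> M}.
Definition arc_type : finType := {ffun fset_set (@E_ball d r.+1) -> M}.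

Definition type_at (V : eqType) (O : V -> seq V) (f : V -> M) (v : V) : ball_type :=
  [ffun b : fset_set (@S_ball d r.+1) => f (descend O v (val (val b)))].

(** The default [point] is never reached: [first_arc] preserves length, and labels of [E_ball r.+1]
    have length at most [r + 1]. *)
Definition arc_of (i : 'I_d) (t : ball_type) : arc_type :=
  [ffun b : fset_set (@E_ball d r.+1) => lookup t point (first_arc i (val (val b)))].

Definition reverse (t : arc_type) : arc_type :=
  [ffun b : fset_set (@E_ball d r.+1) => lookup t point (flip_arc (val (val b)))].

Lemma lookup_type_at (V : eqType) (O : V -> seq V) (f : V -> M) v l :
  tree_label d l -> (size l <= r.+1)%N ->
  lookup (type_at O f v) point l = f (descend O v l).
Proof.
move=> tl lr.
by rewrite (@lookup_fun d M _ (fun l => f (descend O v l)) _ _ tl) // S_ballE.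
Qed.

Lemma edge_label_size l : edge_label r l -> (size l <= r.+1)%N.
Proof. by case/orP => [/leqW //|]; case: l => [//|k s] /andP[]. Qed.

Lemma edge_memE (b : fset_set (@E_ball d r.+1)) : edge_label r (val (val b)).
Proof. by rewrite -E_ballE //; exact: valP. Qed.

Lemma reverseK : involutive reverse.
Proof.
move=> t; apply/ffunP => b; rewrite ffunE.
pose l := flip_arc (val (val b)).
have tl : tree_label d l by apply: flip_arc_label => //; exact: valP (val b).
have lE : Tree tl \in fset_set (@E_ball d r.+1).
  by rewrite E_ballE //; apply: flip_arc_edge (edge_memE b); exact: tree_label_pos.
rewrite -/l (lookup_fun (fun l => lookup t point (flip_arc l)) _ lE) /l flip_arcK ?lookupE //.
exact: tree_label_pos.
Qed.

Lemma arc_of_reverse (V : eqType) (O : V -> seq V) (f : V -> M) v w (i j : 'I_d) :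
  (forall u, uniq (O u)) -> (forall u, size (O u) = d) ->
  nth v (O v) i = w -> nth w (O w) j = v ->
  arc_of j (type_at O f w) = reverse (arc_of i (type_at O f v)).
Proof.
move=> Ou Os vw wv; apply/ffunP => b; rewrite !ffunE.
have tb := valP (val b); have eb := edge_memE b.
have pb := tree_label_pos (val b).
rewrite lookup_type_at ?first_arc_label ?first_arc_size ?edge_label_size //.
rewrite descend_first_arc ?Os // wv.
pose l := flip_arc (val (val b)).
have tl : tree_label d l by exact: flip_arc_label.
have lb : edge_label r l by exact: flip_arc_edge.
have lE : Tree tl \in fset_set (@E_ball d r.+1) by rewrite E_ballE.
rewrite -/l (lookup_fun (fun l => lookup (type_at O f v) point (first_arc i l)) _ lE).
rewrite lookup_type_at ?first_arc_label ?first_arc_size ?edge_label_size //.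
have pl := tree_label_pos (Tree tl).
by rewrite descend_first_arc ?Os // vw /l arc_descend_flip.
Qed.

End ball_types.

(** * Ordered regular graphs as matchings *)

Section order_systems.
Variables n d : nat.
Local Notation V := 'I_n.
Local Notation H := ('I_n * 'I_d)%type.
Local Notation orders := {ffun V -> {ffun 'I_d -> V}}.
Implicit Types (G : simple_graph n) (s : orders).

Definition order_systems G : {set orders} :=
  [set s : orders | [forall u, injectiveb (s u) && [forall i, s u i \in G u]]].

Definition order_list s (u : V) : seq V := [seq s u i | i <- enum 'I_d].

Lemma order_systemP G s : reflect (forall u, injective (s u) /\ forall i, s u i \in G u)
  (s \in order_systems G).
Proof.
rewrite inE; apply: (iffP forallP) => h u.
  by have /andP[/injectiveP ? /forallP ?] := h u.
by have [/injectiveP -> iG] := h u; apply/forallP.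
Qed.

Lemma size_order_list s u : size (order_list s u) = d.
Proof. by rewrite size_map size_enum_ord. Qed.

Lemma nth_order_list s u x (i : 'I_d) : nth x (order_list s u) i = s u i.
Proof. by rewrite (nth_map i) ?size_enum_ord // nth_ord_enum. Qed.

Lemma simple_graph_sym G u w : (w \in G u) = (u \in G w).
Proof. by have /andP[_ /forallP/(_ u)/forallP/(_ w)/eqP] := valP G. Qed.

Lemma simple_graph_irr G u : u \notin G u.
Proof. by have /andP[/forallP] := valP G. Qed.

Lemma card_order_systems G : is_regular d G -> #|order_systems G| = (d`! ^ n)%N.
Proof.
move=> /forallP reg.
have -> : #|order_systems G| = #|family (fun u => [set g : {ffun 'I_d -> V} in ffun_on (mem (G u)) | injectiveb g])|.
  apply: eq_card => s; rewrite inE [RHS]unfold_in; apply: eq_forallb => u.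
  rewrite inE andbC; congr (_ && _).
rewrite card_family foldrE big_map big_enum /= (eq_bigr (fun=> d`!)).
  by rewrite prod_nat_const card_ord.
by move=> u _; rewrite card_inj_ffuns_on card_ord (eqP (reg u)) ffactnn.
Qed.

Definition opposite s (h : H) : H :=
  (s h.1 h.2, odflt h.2 [pick j | s (s h.1 h.2) j == h.1]).

(** Picking a permutation makes this total in [s]; for an order system of a regular graph it is
    [opposite s]. *)
Definition arc_matching s : {perm H} :=
  odflt 1%g [pick p : {perm H} | [forall h, p h == opposite s h]].

Section one_system.
Variables (G : simple_graph n) (s : orders).
Hypotheses (reg : is_regular d G) (sG : s \in order_systems G).

Let s_inj u : injective (s u). Proof. by have /order_systemP/(_ u)[] := sG. Qed.
Let s_in u i : s u i \in G u. Proof. by have /order_systemP/(_ u)[] := sG. Qed.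

Lemma order_system_onto u w : w \in G u -> exists i, s u i = w.
Proof.
move=> wG; have : w \in [set s u i | i : 'I_d].
  have -> : [set s u i | i : 'I_d] = G u.
    apply/eqP; rewrite eqEcard; apply/andP; split.
      by apply/fintype.subsetP => _ /imsetP[i _ ->].
    by rewrite card_imset // card_ord (eqP (forallP reg u)).
  by [].
by move=> /imsetP[i _ ->]; exists i.
Qed.

Lemma order_list_uniq u : uniq (order_list s u).
Proof. by rewrite map_inj_uniq ?enum_uniq. Qed.

Lemma mem_order_list u w : (w \in order_list s u) = (w \in G u).
Proof.
apply/mapP/idP => [[i _ ->]|/order_system_onto[i <-]]; first exact: s_in.
by exists i; rewrite ?mem_enum.
Qed.

Lemma oppositeP h : s (s h.1 h.2) (opposite s h).2 = h.1.
Proof.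
rewrite /opposite /=; case: pickP => [j /eqP //|no].
have [|i e] := @order_system_onto (s h.1 h.2) h.1.
  by rewrite simple_graph_sym s_in.
by have := no i; rewrite e eqxx.
Qed.

Lemma oppositeK : involutive (opposite s).
Proof.
move=> h; have e := oppositeP h; have e' := oppositeP (opposite s h).
rewrite [LHS]surjective_pairing [RHS]surjective_pairing; congr (_, _); first exact: e.
by apply: (@s_inj h.1); rewrite -{1}e; exact: e'.
Qed.

Lemma arc_matchingE h : arc_matching s h = opposite s h.
Proof.
rewrite /arc_matching; case: pickP => [p /forallP/(_ h)/eqP //|].
move=> /(_ (perm (inv_inj oppositeK)))/negbT/forallPn[x].
by rewrite permE eqxx.
Qed.

Lemma arc_matching_matching : arc_matching s \in matchings H.
Proof.
apply/matchingP => h; rewrite !arc_matchingE oppositeK; split => //.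
apply/eqP => /(congr1 fst) /= e; have := s_in h.1 h.2.
by rewrite e (negbTE (simple_graph_irr _ _)).
Qed.

Lemma arc_matching_compatible r (M : finPointedType) (f : V -> M) : (0 < d)%N ->
  compatible (@reverse d r M)
    (half_edge_types (@arc_of d r M) [ffun v => type_at d r (order_list s) f v])
    (arc_matching s).
Proof.
move=> d0; apply/forallP => h; rewrite !ffunE arc_matchingE.
apply/eqP; apply: arc_of_reverse => //.
- exact: order_list_uniq.
- exact: size_order_list.
- by rewrite nth_order_list.
- by rewrite nth_order_list oppositeP.
Qed.

End one_system.

Definition regular_systems : {set simple_graph n * orders} :=
  [set x | is_regular d x.1 && (x.2 \in order_systems x.1)].

Lemma card_regular_systems : #|regular_systems| =
  (#|[pred G : simple_graph n | is_regular d G]| * d`! ^ n)%N.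
Proof.
rewrite -sum1_card (eq_bigl (fun x : simple_graph n * orders => is_regular d x.1 && (x.2 \in order_systems x.1))); last by move=> x; rewrite inE.
rewrite -(pair_big_dep (fun G => is_regular d G) (fun G s => s \in order_systems G) (fun _ _ => 1%N)) /=.
rewrite -sum_nat_const; apply: eq_big => [G|G reg]; first by rewrite inE.
by rewrite sum1_card card_order_systems.
Qed.

(** The image of the half-edge [(u, i)] is based at [s u i], and the values of [s u] are the
    neighbors of [u]. *)
Lemma arc_matching_inj x y : x \in regular_systems -> y \in regular_systems ->
  arc_matching x.2 = arc_matching y.2 -> x = y.
Proof.
case: x y => [G s] [G' s']; rewrite !inE /= => /andP[reg sG] /andP[reg' sG'] e.
have sG1 : s \in order_systems G by rewrite inE.
have sG1' : s' \in order_systems G' by rewrite inE.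
have ss : s = s'.
  apply/ffunP => u; apply/ffunP => i.
  have := congr1 (fun p : {perm H} => (p (u, i)).1) e.
  by rewrite (arc_matchingE reg sG1) (arc_matchingE reg' sG1').
congr (_, _) => //; apply: val_inj; apply/ffunP => u; apply/setP => w.
by rewrite -(mem_order_list reg sG1) -(mem_order_list reg' sG1') ss.
Qed.

Lemma simple_matching_system (i : {perm H}) : i \in simple_matchings n d ->
  exists2 x, x \in regular_systems & arc_matching x.2 = i.
Proof.
rewrite inE => /andP[iM /forallP np].
have iK h : i (i h) = h by have /matchingP/(_ h)[] := iM.
have iN h : i h != h by have /matchingP/(_ h)[] := iM.
pose N : {ffun V -> {set V}} := [ffun u => neighbors i u].
have Nax : simple_graph_axiom N.
  apply/andP; split; apply/forallP => u.
    rewrite ffunE; apply/negP => /neighborsP[k ku ik].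
    move/negP: (np k); apply; apply/existsP; exists (i k).
    by rewrite iN iK ku ik eqxx.
  by apply/forallP => w; rewrite !ffunE neighbors_sym.
pose G := SimpleGraph Nax.
pose s : orders := [ffun u => [ffun j => (i (u, j)).1]].
have inj u : injective (s u).
  move=> j k; rewrite !ffunE => e; apply/eqP/negPn/negP => jk.
  move/negP: (np (u, j)); apply; apply/existsP; exists (u, k).
  by rewrite /= e !eqxx !andbT xpair_eqE eqxx eq_sym jk.
have reg : is_regular d G.
  apply/forallP => u; rewrite /= ffunE /neighbors card_imset ?card_ord //.
  by move=> j k e; apply: (inj u); rewrite !ffunE.
have sG : s \in order_systems G.
  apply/order_systemP => u; split => // j; rewrite !ffunE.
  by apply/neighborsP; exists (u, j).
exists (G, s); first by rewrite inE reg.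
apply/permP => h; rewrite (arc_matchingE reg sG).
have e1 : (opposite s h).1 = (i h).1 by rewrite /= !ffunE; case: h.
rewrite [LHS]surjective_pairing [RHS]surjective_pairing e1; congr (_, _).
apply: (inj (i h).1); rewrite -[X in s X _]e1 (oppositeP reg sG).
rewrite !ffunE -[X in (i X).1](surjective_pairing) iK //.
Qed.

Lemma card_simple_matchings_le : (#|simple_matchings n d| <=
  #|[pred G : simple_graph n | is_regular d G]| * d`! ^ n)%N.
Proof.
rewrite -card_regular_systems.
apply: leq_trans (leq_imset_card (fun x => arc_matching x.2) (mem regular_systems)).
apply: subset_leq_card; apply/fintype.subsetP => i /simple_matching_system[x xR <-].
exact: imset_f.
Qed.

End order_systems.

(** * Concentration of the empirical type law *)

Lemma card_bigcup_le (I S : finType) (P : pred I) (F : I -> {set S}) :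
  (#|\bigcup_(i | P i) F i| <= \sum_(i | P i) #|F i|)%N.
Proof.
elim/big_rec2: _ => [|i a B _ h]; first by rewrite cards0.
by apply: leq_trans (leq_card_setU _ _) _; rewrite leq_add2l.
Qed.

Section local_statistics.
Variables (R : realType) (V S : finType).
Local Notation config := {ffun V -> S}.
Implicit Types (D : {set V}) (s t : config).

Definition mix D s t : config := [ffun u => if u \in D then s u else t u].

Variable Omega : {set config}.
Definition depends_on D (F : pred config) : Prop :=
  forall s t, s \in Omega -> {in D, s =1 t} -> F s = F t.

(** [Omega] is thus a product set: the coordinates of a uniform element are independent. *)
Hypothesis mix_closed : forall D s t, s \in Omega -> t \in Omega -> mix D s t \in Omega.

(* Exchanging the coordinates in [D] of two configurations is an involution. *)
Lemma card_indep D D' (F F' : pred config) : depends_on D F -> depends_on D' F' ->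
  [disjoint D & D'] ->
  (#|Omega| * #|[set s in Omega | F s && F' s]| =
   #|[set s in Omega | F s]| * #|[set s in Omega | F' s]|)%N.
Proof.
move=> FD FD' dis; rewrite [LHS]mulnC -!cardsX.
pose h (st : config * config) := (mix D st.1 st.2, mix D st.2 st.1).
have hK : involutive h.
  by move=> [s t]; congr (_, _); apply/ffunP => u; rewrite !ffunE /=; case: (u \in D).
have hF s t : s \in Omega -> F (mix D s t) = F s.
  by move=> sO; apply/esym/FD => // u uD; rewrite ffunE uD.
have hF' s t : t \in Omega -> F' (mix D s t) = F' t.
  move=> tO; apply/esym/FD' => // u uD; rewrite ffunE; case: ifP => // uD'.
  by have := disjointFr dis uD'; rewrite uD.
rewrite -(card_imset _ (inv_inj hK)); apply: eq_card => -[s t].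
apply/imsetP/idP => [[[s' t'] + ->]|].
  rewrite !inE /= => /andP[/andP[sO /andP[Fs Fs']] tO].
  by rewrite !mix_closed //= hF // hF' // Fs Fs'.
rewrite !inE /= => /andP[/andP[sO Fs] /andP[tO Ft]].
exists (h (s, t)); last by rewrite hK.
by rewrite !inE /= !mix_closed //= hF // hF' // Fs Ft.
Qed.

Variables (D : V -> {set V}) (F : V -> pred config) (C : nat).
Hypothesis FD : forall v, depends_on (D v) (F v).
Hypothesis DC : forall v, (#|[set w | ~~ [disjoint D v & D w]]| <= C)%N.

Definition occurrences s : nat := #|[set v | F v s]|.

Definition mean_occurrences : R :=
  \sum_v #|[set s in Omega | F v s]|%:R / #|Omega|%:R.

(** Chebyshev's inequality in counting form. The covariance of two events vanishes when their
    domains are disjoint and is at most 1 otherwise, which concerns at most [#|V| * C] pairs. *)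
Lemma occurrences_deviation (lambda : R) : 0 <= lambda ->
  #|[set s in Omega | lambda <= `|(occurrences s)%:R - mean_occurrences|]|%:R * lambda ^+ 2
  <= (#|V| * C)%:R * #|Omega|%:R :> R.
Proof.
move=> l0; have [N0e | Npos] := posnP #|Omega|.
  suff -> : [set s in Omega | lambda <= `|(occurrences s)%:R - mean_occurrences|] = finset.set0.
    by rewrite cards0 mul0r mulr_ge0.
  by apply/setP => s; rewrite !inE (cards0_eq N0e) inE.
set m := mean_occurrences; set N := #|Omega|%:R : R.
have N0 : 0 < N by rewrite ltr0n.
pose p v : R := #|[set s in Omega | F v s]|%:R / N.
apply: (@le_trans _ _ (\sum_(s in Omega) ((occurrences s)%:R - m) ^+ 2)).
  rewrite mulr_natl -sumr_const.
  rewrite [X in _ <= X](bigID (mem [set s in Omega | lambda <= `|(occurrences s)%:R - m|])) /=.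
  rewrite -[X in X <= _]addr0; apply: lerD; last by apply: sumr_ge0 => s _; exact: sqr_ge0.
  rewrite [X in _ <= X](eq_bigl (mem [set s in Omega | lambda <= `|(occurrences s)%:R - m|])); last first.
    by move=> s; rewrite /= inE andbA andbb.
  apply: ler_sum => s; rewrite inE => /andP[_ h].
  by rewrite -[X in _ <= X]real_normK ?num_real // ler_sqr ?nnegrE.
have oE s : (occurrences s)%:R = \sum_v (F v s)%:R :> R.
  by rewrite -natr_sum /occurrences -sum1_card big_mkcond; congr (_%:R); apply: eq_bigr => v _; rewrite inE; case: (F v s).
have cE (P : pred config) : \sum_(s in Omega) (P s)%:R = #|[set s in Omega | P s]|%:R :> R.
  rewrite -natr_sum -sum1_card [X in _ = X%:R]big_mkcond [X in X%:R = _]big_mkcond.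
  by congr (_%:R); apply: eq_bigr => s _; rewrite inE; case: (s \in Omega); case: (P s).
have -> : \sum_(s in Omega) ((occurrences s)%:R - m) ^+ 2 =
    \sum_v \sum_w (#|[set s in Omega | F v s && F w s]|%:R - N * (p v * p w)).
  transitivity (\sum_(s in Omega) \sum_v \sum_w ((F v s)%:R - p v) * ((F w s)%:R - p w)).
    apply: eq_bigr => s _; rewrite oE /m /mean_occurrences -sumrB expr2 mulr_suml.
    by apply: eq_bigr => v _; rewrite mulr_sumr.
  rewrite exchange_big /=; apply: eq_bigr => v _.
  rewrite exchange_big /=; apply: eq_bigr => w _.
  transitivity (\sum_(s in Omega) ((F v s && F w s)%:R - p w * (F v s)%:R - p v * (F w s)%:R + p v * p w)).
    apply: eq_bigr => s _.
    by case: (F v s); case: (F w s) => /=; lra.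
  rewrite big_split /= sumr_const -[X in _ + X]mulr_natl -/N !sumrB -!mulr_sumr !cE.
  have e u : #|[set s in Omega | F u s]|%:R = p u * N by rewrite /p divfK // gt_eqF.
  by rewrite (e v) (e w); lra.
have term v w : #|[set s in Omega | F v s && F w s]|%:R - N * (p v * p w) <=
    N * (w \in [set w | ~~ [disjoint D v & D w]])%:R.
  rewrite inE; case: (boolP [disjoint D v & D w]) => dis /=.
    rewrite mulr0 subr_le0 -(ler_pM2l N0) -natrM (card_indep (@FD v) (@FD w) dis) natrM.
    rewrite /p le_eqVlt; apply/orP; left; apply/eqP.
    set a := _%:R; set b := _%:R; have : N * N^-1 = 1 by rewrite divff // gt_eqF.
    set M := N^-1 => NM; have -> : N * (N * (a / N * (b / N))) = a * b * (N * M) * (N * M) by rewrite -/M; lra.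
    by rewrite NM !mulr1.
  rewrite mulr1 lerBlDr; apply: le_trans (_ : N <= _).
    by rewrite /N ler_nat; apply: subset_leq_card; apply/fintype.subsetP => s; rewrite inE => /andP[].
  by rewrite lerDl mulr_ge0 ?(ltW N0) // mulr_ge0 // divr_ge0 // ltW.
apply: le_trans (ler_sum _ (fun v _ => ler_sum _ (fun w _ => term v w))) _.
under eq_bigr => v _ do rewrite -mulr_sumr.
rewrite -mulr_sumr mulrC ler_wpM2r ?(ltW N0) // natrM.
apply: le_trans (_ : _ <= \sum_(v : V) C%:R) _; last by rewrite sumr_const mulr_natl.
apply: ler_sum => v _; rewrite -natr_sum ler_nat; apply: leq_trans (DC v).
rewrite -sum1_card [X in (_ <= X)%N]big_mkcond; apply: leq_sum => w _.
by case: (w \in _).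
Qed.

End local_statistics.

(** * Balls in a regular graph and locality of walks *)

Section graph_balls.
Variables (n d : nat) (G : simple_graph n).
Hypothesis reg : is_regular d G.
Local Notation V := 'I_n.

Fixpoint graph_ball (k : nat) (v : V) : {set V} :=
  if k is k'.+1 then graph_ball k' v :|: \bigcup_(w in G v) graph_ball k' w
  else [set v].

Lemma graph_ballS k v : graph_ball k v \subset graph_ball k.+1 v.
Proof. exact: finset.subsetUl. Qed.

Lemma graph_ball_cons k v w : w \in G v -> graph_ball k w \subset graph_ball k.+1 v.
Proof.
move=> wG; apply: fintype.subset_trans (finset.subsetUr _ _).
exact: (bigcup_max w).
Qed.

Lemma graph_ball_center k v : v \in graph_ball k v.
Proof.
elim: k => [|k IH]; first by rewrite inE.
exact: (fintype.subsetP (graph_ballS k v)).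
Qed.

Lemma graph_ball_rcons k v u w : u \in graph_ball k v -> w \in G u ->
  w \in graph_ball k.+1 v.
Proof.
elim: k v => [|k IH] v.
  rewrite inE => /eqP -> wG; apply: (fintype.subsetP (graph_ball_cons 0 wG)).
  by rewrite inE.
rewrite [graph_ball k.+1 v]/= finset.in_setU => /orP[uv wu|/bigcupP[x xv ux] wu].
  exact: (fintype.subsetP (graph_ballS _ _)) (IH _ uv wu).
exact: (fintype.subsetP (graph_ball_cons _ xv)) (IH _ ux wu).
Qed.

Lemma graph_ball_sym k u v : u \in graph_ball k v -> v \in graph_ball k u.
Proof.
elim: k u v => [|k IH] u v; first by rewrite !inE eq_sym.
rewrite [graph_ball k.+1 v]/= finset.in_setU => /orP[/IH|/bigcupP[w wv /IH uw]].
  exact: (fintype.subsetP (graph_ballS _ _)).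
by apply: graph_ball_rcons uw _; rewrite simple_graph_sym.
Qed.

Lemma card_graph_ball k v : (#|graph_ball k v| <= d.+1 ^ k)%N.
Proof.
elim: k v => [|k IH] v; first by rewrite cards1.
rewrite /= expnS mulSn; apply: leq_trans (leq_card_setU _ _) _; apply: leq_add => //.
apply: leq_trans (card_bigcup_le _ _) _; apply: leq_trans (leq_sum _ (fun w _ => IH w)) _.
by rewrite sum_nat_const (eqP (forallP reg v)).
Qed.

Lemma card_meeting_balls k v :
  (#|[set w | ~~ [disjoint graph_ball k v & graph_ball k w]]| <= d.+1 ^ k * d.+1 ^ k)%N.
Proof.
have sub : [set w | ~~ [disjoint graph_ball k v & graph_ball k w]] \subset
    \bigcup_(u in graph_ball k v) graph_ball k u.
  apply/fintype.subsetP => w; rewrite inE -setI_eq0 => /finset.set0Pn[u].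
  rewrite inE => /andP[uv uw]; apply/bigcupP; exists u => //.
  exact: graph_ball_sym.
apply: leq_trans (subset_leq_card sub) _.
apply: leq_trans (card_bigcup_le _ _) _; apply: leq_trans (leq_sum _ (fun u _ => card_graph_ball k u)) _.
by rewrite sum_nat_const leq_mul2r card_graph_ball orbT.
Qed.

Lemma walk_local (s t : {ffun V -> {ffun 'I_d -> V}}) k (u : option V) v l :
  s \in order_systems d G -> {in graph_ball k v, s =1 t} -> (size l <= k)%N ->
  walk (order_list s) (u, v) l = walk (order_list t) (u, v) l.
Proof.
move=> sG; elim: l k u v => [//|j l IH] [//|k] u v st lk; rewrite !walk_cons.
have Ov : order_list s v = order_list t v.
  by rewrite /order_list st ?graph_ball_center.
rewrite /step /= -Ov; set w := nth _ _ _; apply: (IH k) => // x xw; apply: st.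
(* An index out of range leaves the walk in place, so [w] is a neighbor of [v] or [v] itself. *)
have [wv|] := boolP (w \in G v); first exact: (fintype.subsetP (graph_ball_cons k wv)).
move=> wnG; have -> : v = w; last exact: (fintype.subsetP (graph_ballS k w)).
apply/eqP; rewrite eq_sym; apply: contraNT wnG => wv.
have : w \in [seq x <- order_list s v | Some x != u].
  case: (ltnP j.-1 (size [seq x <- order_list s v | Some x != u])) => jL.
    exact: mem_nth.
  by rewrite /w nth_default ?eqxx in wv.
by rewrite mem_filter (mem_order_list reg sG) => /andP[].
Qed.

End graph_balls.

Section typical_systems.
Variables (R : realType) (n d r : nat) (M : finPointedType) (G : simple_graph n).
Variable f : 'I_n -> M.
Hypothesis reg : is_regular d G.

Definition types_of (s : {ffun 'I_n -> {ffun 'I_d -> 'I_n}}) :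
    {ffun 'I_n -> ball_type d r M} :=
  [ffun v => type_at d r (order_list s) f v].

Definition mean_type (a : ball_type d r M) : R :=
  (\sum_v #|[set s in order_systems d G | types_of s v == a]|%:R / #|order_systems d G|%:R) / n%:R.

Lemma mean_type_ge0 a : 0 <= mean_type a.
Proof. by rewrite divr_ge0 // sumr_ge0 // => v _; rewrite divr_ge0. Qed.

Lemma order_systems_gt0 : (0 < #|order_systems d G|)%N.
Proof. by rewrite card_order_systems // expn_gt0 fact_gt0. Qed.

Lemma mean_type_dist : (0 < n)%N -> is_dist mean_type.
Proof.
move=> n0; split; first exact: mean_type_ge0.
have N0 := order_systems_gt0.
rewrite /mean_type -mulr_suml exchange_big /= (eq_bigr (fun=> 1)) => [|v _].
  by rewrite sumr_const card_ord divff // pnatr_eq0 -lt0n.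
rewrite -mulr_suml -natr_sum.
suff -> : (\sum_a #|[set s in order_systems d G | types_of s v == a]| = #|order_systems d G|)%N.
  by rewrite divff // pnatr_eq0 -lt0n.
rewrite -[RHS]sum1_card (partition_big (fun s => types_of s v) predT) //=.
by apply: eq_bigr => a _; rewrite -sum1_card; apply: eq_bigl => s; rewrite inE.
Qed.

(** The lower bound on [n] makes each type deviate for at most a proportion
    [1 / (2 * #|ball_type d r M|)] of the orders; a union bound over types leaves half of them. *)
Lemma typical_systems (eta : R) : 0 < eta -> (0 < n)%N ->
  (2 * #|ball_type d r M| * (d.+1 ^ r.+1 * d.+1 ^ r.+1))%:R <= n%:R * eta ^+ 2 ->
  (#|order_systems d G| <=
   2 * #|[set s in order_systems d G |
          [forall a, (`|empirical R (types_of s) a - mean_type a| < eta)%R]]|)%N.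
Proof.
move=> eta0 n0 nbig; set Om := order_systems d G; set good := [set s in Om | _].
set C := (d.+1 ^ r.+1 * d.+1 ^ r.+1)%N in nbig.
have mixO D s t : s \in Om -> t \in Om -> mix D s t \in Om.
  move=> /order_systemP sO /order_systemP tO; apply/order_systemP => u.
  rewrite ffunE; case: ifP => _ //.
pose bad a := [set s in Om | n%:R * eta <= `|(occurrences (fun v s => types_of s v == a) s)%:R -
   mean_occurrences R Om (fun v s => types_of s v == a)|].
have badC a : (2 * #|ball_type d r M| * #|bad a| <= #|Om|)%N.
  have nR : 0 < n%:R :> R by rewrite ltr0n.
  have dev : #|bad a|%:R * (n%:R * eta) ^+ 2 <= (#|'I_n| * C)%:R * #|Om|%:R :> R.
    apply: (@occurrences_deviation R _ _ Om mixO (graph_ball G r.+1)).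
    - move=> v s t sO st; rewrite !ffunE; congr (_ == _); apply/ffunP => b.
      rewrite !ffunE; congr f; rewrite /descend (walk_local reg _ sO st) //.
      by rewrite -S_ballE; exact: valP.
    - exact: card_meeting_balls.
    - by rewrite mulr_ge0 // ltW.
  rewrite card_ord natrM in dev.
  have dev2 : #|bad a|%:R * (n%:R * eta ^+ 2) <= C%:R * #|Om|%:R :> R.
    by rewrite -(ler_pM2l nR); move: dev; rewrite exprMn expr2; lra.
  have [C0|Cpos] := posnP C.
    move: dev2; rewrite C0 mul0r pmulr_lle0 ?mulr_gt0 ?exprn_gt0 //.
    by rewrite lern0 => /eqP ->; rewrite muln0.
  have CR : 0 < C%:R :> R by rewrite ltr0n.
  rewrite -(ler_nat R) natrM -(ler_pM2l CR); apply: le_trans dev2.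
  rewrite natrM in nbig; have := ler_wpM2r (ler0n R #|bad a|) nbig; lra.
pose B := \bigcup_a bad a.
have BC : (#|ball_type d r M| * (2 * #|B|) <= #|ball_type d r M| * #|Om|)%N.
  have bB : (#|B| <= \sum_a #|bad a|)%N by exact: (card_bigcup_le predT).
  apply: leq_trans (_ : _ <= \sum_(a : ball_type d r M) 2 * #|ball_type d r M| * #|bad a|)%N _.
    by rewrite -big_distrr /= mulnCA mulnA leq_mul2l bB orbT.
  rewrite -sum_nat_const; apply: leq_sum => a _; exact: badC.
have T0 : (0 < #|ball_type d r M|)%N.
  by apply/card_gt0P; exists [ffun=> point].
rewrite leq_pmul2l // in BC.
have sub : Om \subset good :|: B.
  apply/fintype.subsetP => s sO; rewrite finset.in_setU; apply/orP.
  have [|] := boolP [forall a, `|empirical R (types_of s) a - mean_type a| < eta].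
    by move=> h; left; rewrite inE sO.
  move/forallPn => [a]; rewrite -leNgt => h; right; apply/bigcupP; exists a => //.
  rewrite inE sO /=; apply: le_trans (_ : n%:R * `|empirical R (types_of s) a - mean_type a| <= _).
    by rewrite ler_wpM2l.
  rewrite -{1}[n%:R]ger0_norm // -normrM mulrBr /empirical card_ord /mean_type.
  have nn : n%:R != 0 :> R by rewrite pnatr_eq0 -lt0n.
  rewrite mulrC divfK // mulrC divfK //.
have := leq_trans (subset_leq_card sub) (leq_card_setU _ _).
set g := #|good|; set b := #|B| in BC *; lia.
Qed.

End typical_systems.

(** * Tree balls: permutations against local orders *)

Section embeddings.
Variables (n d k : nat) (G : simple_graph n) (v : 'I_n).
Hypothesis reg : is_regular d G.
Local Notation V := 'I_n.
Local Notation orders := {ffun V -> {ffun 'I_d -> V}}.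
Implicit Types (y z : label -> V) (l m : label) (w u : V).

(** Inner vertices see exactly their neighborhoods in [G], while edges between two vertices at depth
    [k] are left free: walks of length at most [k] do not follow them. *)
Record embedding y : Prop := Embedding {
  emb_root : y [::] = v ;
  emb_inj : forall l m, tree_label d l -> tree_label d m ->
    (size l <= k)%N -> (size m <= k)%N -> y l = y m -> l = m ;
  emb_adj : forall l w, tree_label d l -> (size l < k)%N ->
    w \in G (y l) <-> exists m, [/\ tree_label d m, tree_edge l m & y m = w] }.

Definition enumerates (O : V -> seq V) : Prop :=
  forall u, uniq (O u) /\ O u =i G u.

Lemma enumerates_size O u : enumerates O -> size (O u) = d.
Proof.
move=> /(_ u)[uO OG]; rewrite -(eqP (forallP reg u)) -(card_uniqP uO).
exact: eq_card.
Qed.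

Lemma tree_label_prefix l j : tree_label d (rcons l j) -> tree_label d l.
Proof. by rewrite tree_label_rcons => /and3P[]. Qed.

Lemma tree_edgeP l m : tree_edge l m <->
  (exists j, m = rcons l j) \/ (exists j, l = rcons m j).
Proof.
split; first by case/orP => /parent_ofP[j ->]; [left|right]; exists j.
by case=> -[j ->]; rewrite /tree_edge parent_of_rcons ?orbT.
Qed.

Definition parent y l : option V :=
  if l is [::] then None else Some (y (take (size l).-1 l)).

Lemma parent_rcons y l j : parent y (rcons l j) = Some (y l).
Proof.
rewrite /parent size_rcons /= -cats1 take_size_cat //.
by case: (l ++ [:: j]) (f_equal size (cats1 l j)); rewrite ?size_rcons.
Qed.

Section descend_embedding.
Variables (O : V -> seq V) (x : label -> V).
Hypotheses (EO : enumerates O) (ex : embedding x).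
Let z := descend O v.
Let children l := [seq w <- O (z l) | Some w != parent z l].

Let z_rcons l j : z (rcons l j) = nth (z l) (children l) j.-1.
Proof. by rewrite /z descend_rcons. Qed.

Let children_uniq l : uniq (children l).
Proof. by rewrite filter_uniq //; have [] := EO (z l). Qed.

Let mem_children l w : (w \in children l) = (Some w != parent z l) && (w \in G (z l)).
Proof. by rewrite mem_filter; have [_ ->] := EO (z l). Qed.

Let size_children l : (if l is [::] then true else
    if parent z l is Some p then p \in G (z l) else false) ->
  size (children l) = nb_offspring d l.
Proof.
rewrite /children; case: l => [|a l] /=.
  by rewrite filter_predT enumerates_size.
set p := z _ => pG; have [uO OG] := EO (z (a :: l)).
rewrite (eq_filter (a2 := predC1 p)); last by move=> w.
rewrite -rem_filter // size_rem ?OG //.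
by rewrite enumerates_size.
Qed.

Let stepA l j : tree_label d (rcons l j) -> size (children l) = nb_offspring d l ->
  z (rcons l j) \in children l.
Proof.
rewrite tree_label_rcons => /and3P[j0 jn _] sc.
by rewrite z_rcons mem_nth // sc prednK.
Qed.

Let sizes l : tree_label d l -> size (children l) = nb_offspring d l.
Proof.
elim/last_ind: l => [|l j IH] tl; first exact: size_children.
apply: size_children; rewrite parent_rcons.
have tl' := tree_label_prefix tl.
have := stepA tl (IH tl'); rewrite mem_children => /andP[_].
by rewrite simple_graph_sym; case: (rcons l j).
Qed.

Let child_mem l j : tree_label d (rcons l j) -> z (rcons l j) \in children l.
Proof. by move=> tl; apply: stepA => //; apply: sizes; exact: tree_label_prefix tl. Qed.

(** Depth increases along a non-backtracking walk in a tree. Keeping track of the predecessor is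
    what excludes a step back towards the root. *)
Let stepB l : tree_label d l -> (size l <= k)%N -> exists m,
  [/\ tree_label d m, size m = size l, z l = x m &
   forall a j, l = rcons a j -> exists b i, m = rcons b i /\ z a = x b].
Proof.
elim/last_ind: l => [|l j IH] tl lk.
  exists [::]; split => //; first by rewrite (emb_root ex).
  by case.
have tl' := tree_label_prefix tl; rewrite size_rcons in lk.
have [m [tm sm zm mp]] := IH tl' (ltnW lk).
have := child_mem tl; rewrite mem_children => /andP[np]; rewrite zm.
rewrite -sm in lk; move/(emb_adj ex _ tm lk) => [q [tq mq xq]].
case/tree_edgeP: mq => -[i qE].
  exists q; split => //; first by rewrite qE !size_rcons sm.
  by move=> a j' /rcons_inj[<- _]; exists m, i.
exfalso; clear lk; case/lastP: l IH tl tl' sm zm mp np xq => [|l j'] IH tl tl' sm zm mp np xq.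
  by rewrite qE size_rcons in sm.
have [b [i' [mE zl]]] := mp _ _ erefl.
move: mE; rewrite qE => /rcons_inj[qb _].
by move: np; rewrite parent_rcons zl -qb xq eqxx.
Qed.

Lemma descend_embedding : embedding z.
Proof.
have inj l m : tree_label d l -> tree_label d m ->
    (size l <= k)%N -> (size m <= k)%N -> z l = z m -> l = m.
  elim/last_ind: l m => [|l j IH] m tl tm lk mk e.
    have [l0 [tl0 sl0 xl0 _]] := stepB tl lk; have [m0 [tm0 sm0 xm0 _]] := stepB tm mk.
    have : l0 = m0 by apply: (emb_inj ex); rewrite ?sl0 ?sm0 // -xl0 e.
    by move=> lm; move: sm0; rewrite -lm sl0 => /esym/size0nil.
  have [l0 [tl0 sl0 xl0 lp]] := stepB tl lk; have [m0 [tm0 sm0 xm0 mp]] := stepB tm mk.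
  have lm : l0 = m0 by apply: (emb_inj ex); rewrite ?sl0 ?sm0 // -xl0 e.
  case/lastP: m tm mk e sm0 xm0 mp => [|m i] tm mk e sm0 xm0 mp.
    by move: sm0; rewrite -lm sl0 size_rcons.
  have [a [ja [la za]]] := lp _ _ erefl; have [b [jb [mb zb]]] := mp _ _ erefl.
  have ab : a = b by move: lm; rewrite la mb => /rcons_inj[].
  have lme : l = m.
    apply: IH; rewrite ?za ?zb ?ab //; try exact: tree_label_prefix tl; try exact: tree_label_prefix tm.
      by rewrite size_rcons in lk; exact: ltnW.
    by rewrite size_rcons in mk; exact: ltnW.
  rewrite lme in tl e *; congr rcons.
  move: (tl) (tm); rewrite !tree_label_rcons => /and3P[j0 jn tm'] /and3P[i0 iN _].
  move/eqP: e; rewrite !z_rcons nth_uniq ?sizes ?prednK //.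
  by move/eqP => e; rewrite -(prednK j0) e prednK.
split => // l w tl lk; split.
  move=> wG; have [wp|wp] := eqVneq (Some w) (parent z l).
    case/lastP: l tl lk wG wp => [//|l j] tl lk wG; rewrite parent_rcons => -[wE].
    exists l; split => //; first exact: tree_label_prefix tl.
    by apply/tree_edgeP; right; exists j.
  have wc : w \in children l by rewrite mem_children wp.
  exists (rcons l (index w (children l)).+1); split.
  - by rewrite tree_label_rcons tl -sizes // index_mem wc.
  - by apply/tree_edgeP; left; eexists.
  - by rewrite z_rcons nth_index.
move=> [m [tm /tree_edgeP[[j mE]|[j lE]] <-]].
  by rewrite mE in tm *; have := child_mem tm; rewrite mem_children => /andP[].
rewrite lE in tl *; have := child_mem tl; rewrite mem_children => /andP[_].
by rewrite simple_graph_sym.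
Qed.

End descend_embedding.

Lemma embedding_image y z : embedding y -> embedding z -> forall l,
  tree_label d l -> (size l <= k)%N ->
  exists m, [/\ tree_label d m, (size m <= size l)%N & z m = y l].
Proof.
move=> ey ez; elim/last_ind => [|l j IH] tl lk.
  by exists [::]; rewrite (emb_root ey) (emb_root ez).
have tl' := tree_label_prefix tl; rewrite size_rcons in lk *.
have [m [tm ml zm]] := IH tl' (ltnW lk).
have yG : y (rcons l j) \in G (y l).
  apply/(emb_adj ey _ tl' lk); exists (rcons l j); split => //.
  by apply/tree_edgeP; left; exists j.
move: yG; rewrite -zm => /(emb_adj ez _ tm (leq_ltn_trans ml lk))[q [tq mq zq]].
exists q; split => //; case/tree_edgeP: mq => -[i qE].
  by rewrite qE size_rcons ltnS.
by move: ml; rewrite qE size_rcons => h; apply: leq_trans (leqnSn _) _; apply: leq_trans h _; exact: leqnSn.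
Qed.

(** Descent commutes with a relabeling that carries along the lists of inner vertices; up to depth
    [k] no other list is consulted. *)
Lemma descend_transfer (O O' : V -> seq V) (pi : V -> V) y z :
  injective pi -> embedding y -> embedding z ->
  (forall l, tree_label d l -> (size l <= k)%N -> pi (y l) = z l) ->
  (forall l, tree_label d l -> (size l < k)%N -> O' (z l) = map pi (O (y l))) ->
  (forall l, tree_label d l -> (size l <= k)%N -> descend O v l = y l) ->
  forall l, tree_label d l -> (size l <= k)%N -> descend O' v l = z l.
Proof.
move=> pinj ey ez pyz OO' Oy l; have [b] := ubnP (size l).
elim: b l => // b IH; case/lastP => [|l j] lb tl lk; first by rewrite (emb_root ez).
have tl' := tree_label_prefix tl; rewrite size_rcons in lk lb.
have lk' := ltnW lk; have IHl := IH l lb tl' lk'.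
rewrite descend_rcons IHl OO' // filter_map -[z (rcons _ _)]pyz ?size_rcons // -pyz //.
rewrite -(Oy _ tl) ?size_rcons // descend_rcons (Oy _ tl' lk').
rewrite -!/(parent _ _).
have -> : [seq w <- O (y l) | preim pi (fun w => Some w != parent (descend O' v) l) w] =
    [seq w <- O (y l) | Some w != parent (descend O v) l].
  apply: eq_filter => w /=; case/lastP: l IH IHl tl tl' lk lk' lb => [//|l i] IH IHl tl tl' lk lk' lb.
  have tl2 := tree_label_prefix tl'; rewrite size_rcons in lk' lb.
  rewrite !parent_rcons (Oy _ tl2 (ltnW lk')) (IH _ (ltnW lb) tl2 (ltnW lk')) -pyz //; last exact: ltnW.
  by rewrite !(inj_eq Some_inj) (inj_eq pinj).
set L := [seq _ <- _ | _]; case: (ltnP j.-1 (size L)) => jL; first by rewrite (nth_map (y l)).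
by rewrite !nth_default ?size_map.
Qed.

End embeddings.

(** * Uniformity of the traced embedding *)

Section comparison.
Variables (n d k : nat) (G : simple_graph n) (v : 'I_n).
Hypothesis reg : is_regular d G.
Local Notation V := 'I_n.
Local Notation orders := {ffun V -> {ffun 'I_d -> V}}.
Local Notation B := (fset_set (@S_ball d k)).
Local Notation maps := {ffun B -> V}.
Local Notation lab b := (val (val b)).

Definition embeddings : {set maps} :=
  [set x : maps | `[< embedding d k G v (lookup x v) >]].

Definition traced_by (O : V -> seq V) : maps := [ffun b : B => descend O v (lab b)].

Let lab_size (b : B) : (size (lab b) <= k)%N.
Proof. by rewrite -S_ballE; exact: valP. Qed.

Let lab_tree (b : B) : tree_label d (lab b). Proof. exact: valP (val b). Qed.

Let labP l : tree_label d l -> (size l <= k)%N -> exists b : B, lab b = l.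
Proof.
move=> tl lk; have lS : Tree tl \in B by rewrite S_ballE.
by exists [` lS]%fset.
Qed.

Let lookup_traced O l : tree_label d l -> (size l <= k)%N ->
  lookup (traced_by O) v l = descend O v l.
Proof. by move=> tl lk; have [b <-] := labP tl lk; rewrite lookupE ffunE. Qed.

Let embP (x : maps) : x \in embeddings -> embedding d k G v (lookup x v).
Proof. by rewrite inE => /asboolP. Qed.

Let emb_map_inj (x : maps) : x \in embeddings -> injective x.
Proof.
move=> /embP ex b c e; do 2 apply: val_inj.
by apply: (emb_inj ex); rewrite ?lookupE //; exact: lab_size.
Qed.

Lemma traced_embedding O : embedding d k G v (descend O v) -> traced_by O \in embeddings.
Proof.
case=> r1 r2 r3; rewrite inE; apply/asboolP.
have szm l m : (size l < k)%N -> tree_edge l m -> (size m <= k)%N.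
  by move=> lk /tree_edge_size[] e; [rewrite e | rewrite ltnW // -e ltnW].
apply: Embedding; first by rewrite lookup_traced.
  by move=> l m tl tm lk mk; rewrite (lookup_traced O tl lk) (lookup_traced O tm mk); exact: r2.
move=> l w tl lk; rewrite (lookup_traced O tl (ltnW lk)).
apply: iff_trans (r3 l w tl lk) _; split => -[m [tm em mw]]; exists m.
  by split=> //; rewrite (lookup_traced O tm (szm l m lk em)).
by split=> //; rewrite -(lookup_traced O tm (szm l m lk em)).
Qed.

(** Both embeddings have the same image, so the bijection from one to the other extends by the
    identity. *)
Lemma embeddings_perm (x y : maps) : x \in embeddings -> y \in embeddings ->
  exists pi : {perm V}, forall b, pi (x b) = y b.
Proof.
move=> xX yX; have ex := embP xX; have ey := embP yX.
have im (z w : maps) : z \in embeddings -> w \in embeddings ->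
    forall b, exists c, w c = z b.
  move=> /embP ez /embP ew b.
  have [m [tm ml wm]] := embedding_image ez ew (lab_tree b) (lab_size b).
  have [c cm] := labP tm (leq_trans ml (lab_size b)).
  by exists c; rewrite -cm !lookupE in wm.
pose p u := if [pick b | x b == u] is Some b then y b else u.
have px b : p (x b) = y b.
  rewrite /p; case: pickP => [c /eqP/(emb_map_inj xX) -> //|/(_ b)].
  by rewrite eqxx.
have pn u : (forall b, x b <> u) -> p u = u.
  by move=> h; rewrite /p; case: pickP => // c /eqP /h.
have pinj : injective p.
  have key u w : p u = p w -> (exists b, x b = u) -> u = w.
    move=> e [b xb]; rewrite -xb px in e.
    have [[c xc]|nw] := pselect (exists c, x c = w).
      by rewrite -xc px in e; rewrite -xb -xc (emb_map_inj yX e).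
    rewrite (pn w) in e; last by move=> c xc; apply: nw; exists c.
    by have [c xc] := im _ _ yX xX b; case: nw; exists c; rewrite xc.
  move=> u w e; have [hu|hu] := pselect (exists b, x b = u); first exact: key.
  have [hw|hw] := pselect (exists b, x b = w); first by apply/esym/key.
  move: e; rewrite (pn u) ?(pn w) //.
    by move=> c xc; apply: hw; exists c.
  by move=> c xc; apply: hu; exists c.
by exists (perm pinj) => b; rewrite permE.
Qed.

Let pi_lookup (x y : maps) (pi : {perm V}) : (forall b, pi (x b) = y b) ->
  forall l, tree_label d l -> (size l <= k)%N -> pi (lookup x v l) = lookup y v l.
Proof. by move=> pxy l tl lk; have [b <-] := labP tl lk; rewrite !lookupE. Qed.

(* Embeddings send neighbors of inner vertices onto all neighbors, so a relabeling
   of the image carries neighborhoods to neighborhoods. *)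
Let pi_adj (x y : maps) (pi : {perm V}) : x \in embeddings -> y \in embeddings ->
  (forall b, pi (x b) = y b) -> forall l w, tree_label d l -> (size l < k)%N ->
  (pi w \in G (lookup y v l)) = (w \in G (lookup x v l)).
Proof.
move=> /embP ex /embP ey pxy l w tl lk.
have sz m : tree_edge l m -> (size m <= k)%N.
  by move=> /tree_edge_size[] e; rewrite ?e // -ltnS -e ltnW // ltnW.
apply/idP/idP => [/(emb_adj ey _ tl lk)|/(emb_adj ex _ tl lk)] [m [tm em e]].
  apply/(emb_adj ex _ tl lk); exists m; split => //.
  by apply: (@perm_inj _ pi); rewrite -e (pi_lookup pxy) // sz.
apply/(emb_adj ey _ tl lk); exists m; split => //.
by rewrite -e (pi_lookup pxy) // sz.
Qed.

Let traced_transfer (O O' : V -> seq V) (x y : maps) (pi : {perm V}) :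
  x \in embeddings -> y \in embeddings -> (forall b, pi (x b) = y b) ->
  (forall l, tree_label d l -> (size l < k)%N ->
     O' (lookup y v l) = map pi (O (lookup x v l))) ->
  traced_by O = x -> traced_by O' = y.
Proof.
move=> /embP ex /embP ey pxy OO' Ox; apply/ffunP => b; rewrite ffunE -[RHS](lookupE y v).
apply: (descend_transfer (@perm_inj _ pi) ex ey (pi_lookup pxy) OO') => //.
by move=> l tl lk; rewrite -lookup_traced // Ox.
Qed.

Lemma mem_sorted_adj s u w : (w \in sorted_adj G s u) = (w \in G u).
Proof. by rewrite mem_sort mem_enum. Qed.

Lemma sorted_adj_uniq s u : uniq (sorted_adj G s u).
Proof. by rewrite sort_uniq enum_uniq. Qed.

(** At inner vertices, [pi^-1 * s] sorts the neighbors of the image by [pi] as [s] sorts the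
    original ones; translation by [pi^-1] is thus an injection between the two sets. *)
Lemma card_perm_traced (x y : maps) : x \in embeddings -> y \in embeddings ->
  (#|[set s | traced_by (sorted_adj G s) == x]| <=
   #|[set s | traced_by (sorted_adj G s) == y]|)%N.
Proof.
move=> xX yX; have [pi pxy] := embeddings_perm xX yX.
rewrite -(card_imset _ (@mulgI _ pi^-1%g)); apply: subset_leq_card.
apply/fintype.subsetP => _ /imsetP[s + ->]; rewrite !inE => /eqP sx; apply/eqP.
apply: (traced_transfer xX yX pxy) sx => l tl lk.
have tot (t : {perm V}) : total (fun a b => (t a <= t b)%N) by move=> a b; exact: leq_total.
apply: (@sorted_eq _ (fun a b => ((pi^-1 * s)%g a <= (pi^-1 * s)%g b)%N)).
- by move=> a b c; exact: leq_trans.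
- by move=> a b /anti_leq/ord_inj/perm_inj.
- exact: sort_sorted.
- rewrite sorted_map (@eq_sorted _ _ (fun a b => (s a <= s b)%N)) ?sort_sorted // => a b.
  by rewrite /relpre /= !permM !permK.
apply: uniq_perm; rewrite ?sorted_adj_uniq ?map_inj_uniq ?sorted_adj_uniq //; try exact: perm_inj.
move=> w; rewrite mem_sorted_adj -[w](permKV pi) (mem_map (@perm_inj _ pi)).
by rewrite mem_sorted_adj (pi_adj xX yX pxy).
Qed.

(** The permutation [pi] need not be an automorphism of [G]: it respects neighborhoods only at inner
    vertices, so only the orders there are transported. *)
Lemma card_order_traced (x y : maps) : x \in embeddings -> y \in embeddings ->
  (#|[set s in order_systems d G | traced_by (order_list s) == x]| <=
   #|[set s in order_systems d G | traced_by (order_list s) == y]|)%N.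
Proof.
move=> xX yX; have [pi pxy] := embeddings_perm xX yX.
pose inner (z : maps) u := [exists b : B, (size (lab b) < k)%N && (z b == u)].
have in_im (z w : maps) : z \in embeddings -> w \in embeddings ->
    forall u, inner z u -> inner w u.
  move=> /embP ez /embP ew u /existsP[b /andP[bk /eqP <-]].
  have [m [tm ml wm]] := embedding_image ez ew (lab_tree b) (lab_size b).
  have [c cm] := labP tm (leq_trans ml (lab_size b)).
  apply/existsP; exists c; rewrite -cm !lookupE in wm; rewrite cm wm eqxx andbT.
  exact: leq_ltn_trans bk.
have inE' u : inner x u = inner y u by apply/idP/idP; apply: in_im.
have inner_pi u : inner y (pi u) = inner x u.
  apply/existsP/existsP => -[b /andP[bk e]]; exists b; rewrite bk /=.
    by rewrite -(inj_eq (@perm_inj _ pi)) pxy.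
  by rewrite -pxy (inj_eq (@perm_inj _ pi)).
pose F (s : orders) : orders := [ffun u => if inner y u then
   [ffun i => pi (s (pi^-1%g u) i)] else s u].
have Finj : injective F.
  move=> s t /ffunP st; apply/ffunP => u; have [iu|iu] := boolP (inner x u).
    apply/ffunP => i; have := st (pi u); rewrite !ffunE inner_pi iu => /ffunP/(_ i).
    by rewrite !ffunE permK => /perm_inj.
  by have := st u; rewrite !ffunE -inE' (negbTE iu).
rewrite -(card_imset _ Finj); apply: subset_leq_card.
apply/fintype.subsetP => _ /imsetP[s + ->]; rewrite inE => /andP[/order_systemP sO /eqP sx].
rewrite inE; apply/andP; split.
  apply/order_systemP => u; rewrite ffunE; case: ifP => // iu.
  have [b /andP[bk /eqP bu]] := existsP iu.
  have xb : pi^-1%g u = x b by rewrite -bu -pxy permK.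
  have [sinj sin] := sO (x b).
  split => [i j|i]; rewrite !ffunE xb; first by move/perm_inj/sinj.
  have := sin i; rewrite -bu -(lookupE x v) -(lookupE y v).
  by rewrite (pi_adj xX yX pxy) // lab_tree.
apply/eqP; apply: (traced_transfer xX yX pxy) sx => l tl lk.
have [b bl] := labP tl (ltnW lk); rewrite -bl !lookupE.
rewrite /order_list -[RHS]map_comp; apply: eq_map => i /=; rewrite !ffunE.
have -> : inner y (y b) by apply/existsP; exists b; rewrite bl lk eqxx.
by rewrite ffunE -pxy permK.
Qed.

Lemma enumerates_order_list (s : orders) : s \in order_systems d G ->
  enumerates G (order_list s).
Proof. by move=> sO u; split; [exact: order_list_uniq sO u | exact: mem_order_list]. Qed.

(* The permutations and the order systems each induce the uniform distribution on
   embeddings as soon as one embedding exists. *)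
Lemma card_traced_le (Q : {set maps}) : Q \subset embeddings ->
  (#|[set s | traced_by (sorted_adj G s) \in Q]| * #|order_systems d G| <=
   #|[set s in order_systems d G | traced_by (order_list s) \in Q]| * #|{perm V}|)%N.
Proof.
move=> QX; have [->|/finset.set0Pn[q qQ]] := eqVneq Q finset.set0.
  by rewrite (eq_card0 (A := [set s | _])) // => s; rewrite !inE.
have qX : q \in embeddings := fintype.subsetP QX _ qQ.
pose cs x := #|[set s | traced_by (sorted_adj G s) == x]|.
pose co x := #|[set s in order_systems d G | traced_by (order_list s) == x]|.
have csq x : x \in embeddings -> cs x = cs q.
  by move=> xX; apply/eqP; rewrite eqn_leq !card_perm_traced.
have coq x : x \in embeddings -> co x = co q.
  by move=> xX; apply/eqP; rewrite eqn_leq !card_order_traced.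
have sums (A : {set maps}) : A \subset embeddings ->
    #|[set s | traced_by (sorted_adj G s) \in A]| = (#|A| * cs q)%N.
  move=> AX; rewrite -sum1_card (partition_big (fun s => traced_by (sorted_adj G s)) (mem A)) /=; last first.
    by move=> s; rewrite inE.
  rewrite -sum_nat_const; apply: eq_bigr => x xA; rewrite -(csq x) ?(fintype.subsetP AX) //.
  rewrite /cs -sum1_card; apply: eq_bigl => s; rewrite !inE.
  by case: eqP => [->|]; rewrite ?xA ?andbF.
have sumo (A : {set maps}) : A \subset embeddings ->
    #|[set s in order_systems d G | traced_by (order_list s) \in A]| = (#|A| * co q)%N.
  move=> AX; rewrite -sum1_card (partition_big (fun s => traced_by (order_list s)) (mem A)) /=; last first.
    by move=> s; rewrite inE => /andP[].
  rewrite -sum_nat_const; apply: eq_bigr => x xA; rewrite -(coq x) ?(fintype.subsetP AX) //.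
  rewrite /co -sum1_card; apply: eq_bigl => s; rewrite [in RHS]inE [in LHS]inE -andbA; congr (_ && _).
  by case: eqP => [->|]; rewrite ?xA ?andbF.
(* As soon as one embedding exists, every order system traces one. *)
have Ord : #|order_systems d G| = (#|embeddings| * co q)%N.
  rewrite -sumo //; apply: eq_card => s; rewrite [in RHS]inE.
  case sO: (s \in order_systems d G) => //=; apply/esym.
  exact/traced_embedding/(descend_embedding reg (enumerates_order_list sO) (embP qX)).
have tot : (#|embeddings| * cs q <= #|{perm V}|)%N.
  by rewrite -sums //; exact: max_card.
rewrite Ord sums // sumo //.
apply: leq_trans (_ : _ <= #|Q| * co q * (#|embeddings| * cs q))%N _; last by rewrite leq_mul2l tot orbT.
by rewrite leq_eqVlt; apply/orP; left; apply/eqP; lia.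
Qed.

End comparison.

(** * Breadth-first search in a tree ball *)

Section bfs_order.
Variables (V : eqType) (adj : V -> seq V).

Lemma mem_zip_children l (c : seq V) j w u :
  ((rcons l j, w) \in zip [seq rcons l j | j <- iota 1 (size c)] c) =
  [&& (0 < j)%N, (j <= size c)%N & w == nth u c j.-1].
Proof.
have sz : size [seq rcons l j | j <- iota 1 (size c)] = size c by rewrite size_map size_iota.
apply/(nthP ([::], u))/and3P => [[i]|[j0 jc /eqP ->]].
  rewrite size_zip sz minnn nth_zip // => ic.
  rewrite (nth_map 0%N) ?size_iota // nth_iota // => -[/rcons_inj[<-] <-].
  by rewrite add1n.
exists j.-1; first by rewrite size_zip sz minnn prednK.
rewrite nth_zip // (nth_map 0%N) ?size_iota ?prednK // nth_iota ?prednK //.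
by rewrite add1n prednK.
Qed.

(** The witness [s'] is the list of vertices discovered when the turn of [u] comes. *)
Lemma sweep_children s L l u : uniq (unzip1 L) -> (l, u) \in L ->
  exists s', forall j w, ((rcons l j, w) \in sweep adj s L) =
    [&& (0 < j)%N, (j <= size (offspring adj s' u))%N & w == nth u (offspring adj s' u) j.-1].
Proof.
elim: L s => [//|[a b] L IH] s /= /andP[aL uL]; rewrite inE xpair_eqE.
have [-> /=|la /= lL] := eqVneq l a.
  case: (eqVneq u b) => [-> _|_ /= lL]; last by move/negP: aL; case; apply/mapP; exists (a, u).
  exists s => j w; rewrite mem_cat (mem_zip_children _ _ _ _ b).
  case: (boolP (_ \in sweep _ _ _)) => [/sweep_mem[q [i [qL /= /rcons_inj[aq _] _ _]]]|]; last by rewrite orbF.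
  by move/negP: aL; case; apply/mapP; exists q.
have [s' h] := IH (s ++ offspring adj s b) uL lL; exists s' => j w.
rewrite mem_cat h; case: (boolP (_ \in zip _ _)) => [/child_mem[i /= /rcons_inj[e _] _]|//].
by rewrite e eqxx in la.
Qed.

Hypothesis adj_uniq : forall u, uniq (adj u).
Variable v : V.

Lemma level_uniq2 k : uniq (unzip2 (level adj v k)).
Proof.
case: k => [//|k]; have := seen_uniq v adj_uniq k.+1.
by rewrite seenS cat_uniq => /and3P[].
Qed.

Lemma vertex_at_inj l m u : vertex_at adj v l = Some u -> vertex_at adj v m = Some u ->
  l = m.
Proof.
move=> /eqP/vertex_atP lu /eqP/vertex_atP mu.
have e : size l = size m.
  apply: (@level_index _ adj v adj_uniq _ _ u); apply/mapP.
    by exists (l, u).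
  by exists (m, u).
rewrite e in lu; have := level_uniq2 (size m).
move: lu mu; elim: (level _ _ _) => [//|[a b] L IH] /=.
rewrite !inE !xpair_eqE => lu mu /andP[bL uL].
have no x : (x, u) \in L -> u != b.
  by move=> xL; apply: contraNneq bL => <-; apply/mapP; exists (x, u).
case/orP: lu => [/andP[/eqP -> /eqP ub]|lL].
  case/orP: mu => [/andP[/eqP -> //]|/no]; by rewrite ub eqxx.
case/orP: mu => [/andP[_ /eqP ub]|mL]; first by move/no: lL; rewrite ub eqxx.
exact: IH.
Qed.

Lemma vertex_at_children l u : vertex_at adj v l = Some u ->
  exists s, forall j w, (vertex_at adj v (rcons l j) == Some w) =
    [&& (0 < j)%N, (j <= size (offspring adj s u))%N & w == nth u (offspring adj s u) j.-1].
Proof.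
move=> /eqP/vertex_atP lu.
have [s h] := sweep_children (seen adj v (size l)) (level_uniq1 adj v _) lu.
exists s => j w; rewrite -h -levelS -(size_rcons l j).
by apply/vertex_atP/idP.
Qed.

End bfs_order.

Section bfs_tree.
Variables (n d k : nat) (G : simple_graph n) (v : 'I_n) (adj : 'I_n -> seq 'I_n).
Variables (M : finPointedType) (f : 'I_n -> M) (x : tree d -> M).
Hypothesis adjG : enumerates G adj.
Hypothesis ball_tree : restrict_ball k (labeling adj v f) = restrict_ball k (tree_graph x).

Let adj_uniq u : uniq (adj u). Proof. by have [] := adjG u. Qed.
Let at_ := vertex_at adj v.

Let at_tree (t : tree d) : (size (val t) <= k)%N ->
  exists2 u, at_ (val t) = Some u & f u = x t.
Proof.
move=> tk; have := congr1 (fun g => color g (val t)) ball_tree.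
rewrite /= [X in _ = (if X then _ else _)]tree_dist_le tk insubT /=; first exact: valP.
move=> tl; rewrite (_ : Sub _ tl = t); last exact: val_inj.
by case: ifP => // _; rewrite -/at_; case: (at_ _) => //= u [<-]; exists u.
Qed.

Let at_label l u : at_ l = Some u -> (size l <= k)%N -> tree_label d l.
Proof.
move=> lu lk; have := congr1 (fun g => color g l) ball_tree.
rewrite /= (dist_leP f k adj_uniq lu) lk -/at_ lu /=.
by case: ifP => // _; case: insubP.
Qed.

Let at_edge l m u w : at_ l = Some u -> at_ m = Some w -> (size l <= k)%N ->
  (size m <= k)%N -> tree_edge l m = (w \in adj u).
Proof.
move=> lu mw lk mk; have := congr1 (fun g => edge g l m) ball_tree.
rewrite /= (dist_leP f k adj_uniq lu) (dist_leP f k adj_uniq mw) lk mk -/at_ lu mw.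
have tl := at_label lu lk; have tm := at_label mw mk.
have := @tree_dist_le d M x k (Tree tl); have := @tree_dist_le d M x k (Tree tm).
by rewrite /= => -> ->; rewrite lk mk tl tm !andbT.
Qed.

Let at_root : at_ [::] = Some v.
Proof. by apply/eqP/vertex_atP; rewrite ?inE. Qed.

Let at_neighbor l u w : at_ l = Some u -> (size l < k)%N -> w \in adj u ->
  exists2 m, at_ m = Some w & (size m <= k)%N.
Proof.
move=> lu lk wu; have us : u \in seen adj v (size l).
  apply/seenP; exists (size l) => //; apply/mapP; exists (l, u) => //.
  by apply/vertex_atP/eqP.
have /seenP[j jl /mapP[[m w'] mj /= ->]] := adj_seen us wu.
have mj' := level_size mj; rewrite /= in mj'.
exists m; last by rewrite mj'; exact: leq_trans jl lk.
by apply/eqP/vertex_atP; rewrite mj'.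
Qed.

(** In a tree, the only neighbor already discovered when a vertex is processed is its parent, so
    offspring and non-backtracking steps are read off the same list. *)
Lemma bfs_descend l : tree_label d l -> (size l <= k)%N -> at_ l = Some (descend adj v l).
Proof.
have [b] := ubnP (size l); elim: b l => // b IH; case/lastP => [|l j] lb tl lk.
  exact: at_root.
have tl' := tree_label_prefix tl; rewrite size_rcons in lb lk.
have lu := IH l lb tl' (ltnW lk); set u := descend adj v l in lu.
have [s h] := vertex_at_children lu.
have [w jw _] := @at_tree (Tree tl) ltac:(by rewrite /= size_rcons).
rewrite /= in jw; rewrite jw.
have := h j w; rewrite -/at_ jw eqxx => /esym/and3P[j0 jc /eqP ->].
congr Some; rewrite descend_rcons -/u; congr nth; apply: eq_in_filter => y yu.
have [m my mk] := at_neighbor lu lk yu.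
have em : tree_edge l m by rewrite (at_edge lu my) // ltnW.
rewrite -/(parent (descend adj v) l).
have childE : (y \notin s) = (y \in offspring adj s u) by rewrite mem_filter yu andbT.
have inj := vertex_at_inj adj_uniq.
(* A child [y] of [u] is among its offspring and differs from the parent, whose label is shorter.
   The parent, treated next, was already discovered: otherwise it would get a second label. *)
case/tree_edgeP: em => -[i mE].
  have := h i y; rewrite -mE -/at_ my eqxx => /esym/and3P[i0 ic /eqP yE].
  rewrite childE [in LHS]yE mem_nth ?prednK //; apply/esym/eqP.
  rewrite /parent; case El: l => [//|a l2] [yp]; rewrite -El in yp.
  have t2 : tree_label d (take (size l).-1 l).
    case/lastP: (l) tl' => [//|l3 i3] /tree_label_prefix.
    by rewrite size_rcons /= -cats1 take_size_cat.
  have s2 : (size (take (size l).-1 l) < size l)%N.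
    by rewrite size_take El /= ltnSn.
  have tE : take (size l).-1 l = take (size l2) l by rewrite El.
  have := IH _ (leq_trans s2 (ltnW (lb : size l < b)%N)) t2 (ltnW (ltn_trans s2 lk)).
  rewrite tE -yp -tE => /(inj _ _ _ _ my) e; move: s2; rewrite -e mE size_rcons.
  by rewrite ltnNge leqW.
have tm : tree_label d m by apply: (@tree_label_prefix d m i); rewrite -mE.
have sm : size l = (size m).+1 by rewrite mE size_rcons.
have mb : (size m < b)%N by lia.
have := IH m mb tm mk; rewrite my => -[yE].
rewrite [in RHS]mE parent_rcons -yE eqxx childE; apply/negP => yo.
have io : (index y (offspring adj s u) < size (offspring adj s u))%N by rewrite index_mem.
have := h (index y (offspring adj s u)).+1 y.
rewrite /= io nth_index // eqxx => /eqP/(inj _ _ _ _ my) e.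
by move: sm; rewrite e size_rcons; lia.
Qed.

Lemma bfs_color (t : tree d) : (size (val t) <= k)%N -> f (descend adj v (val t)) = x t.
Proof.
by move=> tk; have [u tu <-] := at_tree tk; move: tu; rewrite bfs_descend //; [case=> ->|exact: valP].
Qed.

Lemma bfs_embedding : embedding d k G v (descend adj v).
Proof.
split => //.
  move=> l m tl tm lk mk e; apply: (vertex_at_inj adj_uniq (bfs_descend tl lk)).
  by rewrite e; exact: bfs_descend.
move=> l w tl lk; have [_ aG] := adjG (descend adj v l); rewrite -aG.
have lu := bfs_descend tl (ltnW lk); split.
  move=> wl; have [m mw mk] := at_neighbor lu lk wl; have tm := at_label mw mk.
  exists m; split => //; first by rewrite (at_edge lu mw) // ltnW.
  by move: mw; rewrite bfs_descend // => -[].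
move=> [m [tm em <-]].
have mk : (size m <= k)%N.
  by case/tree_edge_size: em => e; [rewrite e | rewrite ltnW // -e ltnW].
by rewrite -(at_edge lu (bfs_descend tm mk)) // ltnW.
Qed.

End bfs_tree.

(** * Finite-dimensional laws of an invariant process *)

Section finite_laws.
Variables (R : realType) (d : nat) (M : finPointedType).
Variable mu : probability (config d M) R.
Implicit Types (S : {fset tree d}).

Definition restrict_config S (x : config d M) : {ffun S -> M} := [ffun b => x (val b)].

Definition law S (a : {ffun S -> M}) : R :=
  fine (mu [set x : config d M | forall b : S, x (val b) = a b]%classic).

Lemma shannon_law (A : set (tree d)) : shannon mu A = entropy (law (S := fset_set A)).
Proof. by []. Qed.

Lemma restrict_eq S x (a : {ffun S -> M}) :
  (forall b : S, x (val b) = a b) <-> restrict_config S x = a.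
Proof.
split => [h|<- b]; last by rewrite ffunE.
by apply/ffunP => b; rewrite ffunE h.
Qed.

Lemma measurable_restrict_config S (P : pred {ffun S -> M}) :
  measurable [set x : config d M | P (restrict_config S x)]%classic.
Proof.
have cyl (a : {ffun S -> M}) : measurable [set x : config d M | restrict_config S x = a]%classic.
  rewrite [X in measurable X](_ : _ = \bigcap_(b in [set: S]) [set x : config d M | x (val b) = a b])%classic.
    apply: fin_bigcap_measurable => [|b _]; first exact: finite_finset.
    by apply: sub_sigma_algebra; exists (val b), (a b).
  apply/funext => x; apply/propext; split => [/restrict_eq h b _|h]; first exact: h.
  by apply/restrict_eq => b; exact: h.
rewrite [X in measurable X](_ : _ = \bigcup_(a in [set a | P a]) [set x : config d M | restrict_config S x = a])%classic.
  by apply: fin_bigcup_measurable => [|a _]; [exact: finite_finset|exact: cyl].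
by apply/seteqP; split => x /= => [h|[a /= Pa ->] //]; exists (restrict_config S x).
Qed.

Lemma sum_law S (P : pred {ffun S -> M}) :
  \sum_(a | P a) law a = fine (mu [set x : config d M | P (restrict_config S x)]%classic).
Proof.
have cyl (a : {ffun S -> M}) : [set x : config d M | forall b : S, x (val b) = a b]%classic =
    [set x : config d M | pred1 a (restrict_config S x)]%classic.
  by apply/seteqP; split => x /= => [/restrict_eq/eqP|/eqP/restrict_eq].
have mcyl (a : {ffun S -> M}) : measurable [set x : config d M | forall b : S, x (val b) = a b]%classic.
  by rewrite cyl; exact: measurable_restrict_config.
rewrite /law sum_fine; last by move=> a _; exact: fin_num_measure.
congr fine; rewrite bigfs ?index_enum_uniq //; last by move=> a _; rewrite mem_index_enum.
rewrite -measure_fin_bigcup; [|exact: finite_finset| |by move=> a _; exact: mcyl]; last first.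
  by move=> a b _ _ [y [/= /restrict_eq ya /restrict_eq yb]]; congruence.
congr (mu _); apply/seteqP; split => x /=.
  by move=> [a /= Pa /restrict_eq ->].
by move=> Px; exists (restrict_config S x) => //= b; rewrite ffunE.
Qed.

Lemma law_dist S : is_dist (law (S := S)).
Proof.
split; first by move=> a; rewrite fine_ge0.
rewrite (sum_law (S := S) xpredT) [X in mu X](_ : _ = setT) ?probability_setT //.
by apply/seteqP; split.
Qed.

Lemma marginal_law S S' (g : {ffun S -> M} -> {ffun S' -> M}) (Psi : config d M -> config d M) :
  (forall A, measurable A -> mu [set x | A (Psi x)]%classic = mu A) ->
  (forall x, g (restrict_config S x) = restrict_config S' (Psi x)) ->
  marginal g (law (S := S)) =1 law (S := S').
Proof.
move=> Pmu gP a; rewrite /marginal (sum_law (S := S) (fun b => g b == a)) /law; congr fine.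
have -> : [set x : config d M | forall b : S', x (val b) = a b]%classic =
    [set x : config d M | pred1 a (restrict_config S' x)]%classic.
  by apply/seteqP; split => x /= => [/restrict_eq/eqP|/eqP/restrict_eq].
rewrite -[RHS]Pmu; last exact: measurable_restrict_config.
by congr (mu _); apply/seteqP; split => x /=; rewrite gP.
Qed.

Lemma entropy_ext (T : finType) (p q : T -> R) : p =1 q -> entropy p = entropy q.
Proof. by move=> /funext ->. Qed.

Lemma law_submodular (A B : {fset tree d}) :
  entropy (law (S := (A `|` B)%fset)) + entropy (law (S := (A `&` B)%fset)) <=
  entropy (law (S := A)) + entropy (law (S := B)).
Proof.
pose sub S S' (a : {ffun S -> M}) : {ffun S' -> M} := [ffun b => lookup a point (val (val b))].
have subE S S' x : (S' `<=` S)%fset -> sub S S' (restrict_config S x) = restrict_config S' x.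
  move=> /fsubsetP SS; apply/ffunP => b; rewrite !ffunE.
  by have bS := SS _ (valP b); have -> : val b = val [` bS]%fset by []; rewrite lookupE ffunE.
have subL S S' : (S' `<=` S)%fset -> marginal (sub S S') (law (S := S)) =1 law (S := S').
  by move=> SS; apply: (@marginal_law _ _ _ id) => // x; exact: subE.
have AU := fsubsetUl A B; have BU := fsubsetUr A B.
have IA := fsubsetIl A B; have IB := fsubsetIr A B.
rewrite -(entropy_ext (subL _ _ AU)) -(entropy_ext (subL _ _ BU)).
have -> : entropy (law (S := (A `&` B)%fset)) =
    entropy (marginal (sub A (A `&` B)%fset \o sub (A `|` B)%fset A) (law (S := (A `|` B)%fset))).
  apply: entropy_ext => a; rewrite -marginal_comp -(subL _ _ IA).
  by rewrite (funext (subL _ _ AU)).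
have full S (a : {ffun S -> M}) : a = restrict_config S (fun t => lookup a point (val t)).
  by apply/ffunP => b; rewrite ffunE lookupE.
apply: (entropy_submodular (h := sub B (A `&` B)%fset)); first exact: law_dist.
  by move=> a; rewrite [a]full !subE.
move=> a b [ea eb]; apply/ffunP => c; have := valP c; rewrite in_fsetU => /orP[cA|cB].
  have := congr1 (fun g : {ffun A -> M} => g [` cA]%fset) ea; rewrite !ffunE.
  by rewrite (_ : val [` cA]%fset = val c) // !lookupE.
have := congr1 (fun g : {ffun B -> M} => g [` cB]%fset) eb; rewrite !ffunE.
by rewrite (_ : val [` cB]%fset = val c) // !lookupE.
Qed.

Lemma law_aut (phi : tree d -> tree d) (A B : {fset tree d}) : aut_invariant mu ->
  tree_aut phi -> (forall t, (t \in A) = (phi t \in B)) ->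
  entropy (law (S := A)) = entropy (law (S := B)).
Proof.
move=> inv aphi AB; have [[psi pK Kp] _] := aphi.
pose g (a : {ffun B -> M}) : {ffun A -> M} := [ffun b => lookup a point (val (phi (val b)))].
pose h (a : {ffun A -> M}) : {ffun B -> M} := [ffun b => lookup a point (val (psi (val b)))].
have lookK (S : {fset tree d}) (a : {ffun S -> M}) t (tS : t \in S) : lookup a point (val t) = a [` tS]%fset.
  exact: (lookupE a point [` tS]%fset).
have gh : cancel g h.
  move=> a; apply/ffunP => b; rewrite ffunE.
  have bA : psi (val b) \in A by rewrite AB Kp; exact: valP.
  by rewrite lookK ffunE /= Kp lookupE.
rewrite -(entropy_inj (law (S := B)) gh); apply/esym/entropy_ext.
apply: (@marginal_law _ _ _ (fun x => x \o phi)); first exact: inv.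
move=> x; apply/ffunP => b; rewrite !ffunE /=.
have bB : phi (val b) \in B by rewrite -AB; exact: valP.
by rewrite lookK ffunE.
Qed.

End finite_laws.

(** * Automorphisms of the tree *)

Section automorphisms.
Variable d : nat.
Hypothesis d0 : (0 < d)%N.
Local Notation tree := (tree d).

Definition first_arc_tree (i : 'I_d) (t : tree) : tree :=
  Tree (first_arc_label (ltn_ord i) (valP t)).

Definition flip_tree (t : tree) : tree := Tree (flip_arc_label d0 (valP t)).

Definition first_arc_inv (i : nat) (l : label) : label :=
  if l is k :: s then (if k == i.+1 then 1%N else (unbump i k.-1).+2) :: s else [::].

Lemma first_arcK i l : all (fun k => 0 < k)%N l ->
  first_arc_inv i (first_arc i l) = l.
Proof.
case: l => [//|k s] /= /andP[k0 _]; have [->|k1] := eqVneq k 1%N; first by rewrite eqxx.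
by rewrite eqSS eq_sym (negbTE (neq_bump _ _)) bumpK; congr (_ :: _); lia.
Qed.

Lemma first_arc_invK i l : all (fun k => 0 < k)%N l ->
  first_arc i (first_arc_inv i l) = l.
Proof.
case: l => [//|k s] /= /andP[k0 _]; have [->|k1] := eqVneq k i.+1; first by [].
rewrite /= unbumpK ?inE; last by apply/eqP; lia.
by rewrite prednK.
Qed.

Lemma first_arc_inv_label i l : (i < d)%N -> tree_label d l ->
  tree_label d (first_arc_inv i l).
Proof.
case: l => [//|k s] id /= /andP[/andP[k0 kd] ->]; rewrite andbT.
by case: eqP => k1 //=; rewrite /unbump; case: ltnP => h /=; lia.
Qed.

Lemma first_arc_take i m l : take m (first_arc i l) = first_arc i (take m l).
Proof. by case: l => [|k s]; case: m. Qed.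

Lemma first_arc_aut (i : 'I_d) : tree_aut (first_arc_tree i).
Proof.
have inj (t u : tree) : first_arc i (val t) = first_arc i (val u) -> val t = val u.
  move=> e; rewrite -(first_arcK i (tree_label_pos t)) e first_arcK //.
  exact: tree_label_pos.
split.
  exists (fun t => Tree (first_arc_inv_label (ltn_ord i) (valP t))) => t; apply: val_inj => /=.
    by rewrite first_arcK // tree_label_pos.
  by rewrite first_arc_invK // tree_label_pos.
have par (t u : tree) : parent_of (first_arc i (val t)) (first_arc i (val u)) = parent_of (val t) (val u).
  rewrite /parent_of first_arc_size first_arc_take; congr (_ && _); first by case: (val u).
  have tk : tree_label d (take (size (val u)).-1 (val u)).
    case/lastP E : (val u) => [//|l j]; have := valP u; rewrite E => /tree_label_prefix.
    by rewrite size_rcons /= -cats1 take_size_cat.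
  by apply/eqP/eqP => [/(inj t (Tree tk))|->].
by move=> t u; rewrite /tree_edge !par.
Qed.

Lemma flip_treeK : involutive flip_tree.
Proof. by move=> t; apply: val_inj; rewrite /= flip_arcK // tree_label_pos. Qed.

Lemma flip_aut : tree_aut flip_tree.
Proof.
split; first exact: inv_bij flip_treeK.
have par (t u : tree) : parent_of (val t) (val u) -> tree_edge (flip_arc (val t)) (flip_arc (val u)).
  move=> /parent_ofP[j uE]; have := tree_label_pos u; rewrite uE {uE}.
  case: (val t) => [|k s] /=.
    case: eqP => [->|j1] _; first by rewrite -(cats0 [:: 1%N]).
    by apply/orP; left; apply/parent_ofP; exists j.-1.
  move=> _; case: eqP => k1; last first.
    by apply/orP; left; apply/parent_ofP; exists j.
  by case: s => [|b s] /=; apply/orP; left; apply/parent_ofP; [exists j.+1|exists j].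
have imp (t u : tree) : tree_edge (val t) (val u) -> tree_edge (flip_arc (val t)) (flip_arc (val u)).
  by case/orP => /par //; rewrite tree_edge_sym.
move=> t u; apply/idP/idP => [|]; last exact: imp.
by move=> /(imp (flip_tree t) (flip_tree u)); rewrite /= !flip_arcK ?tree_label_pos.
Qed.

End automorphisms.

(** * Half-edge laws and monotonicity of the annealed entropy *)

Section annealed.
Variables (R : realType) (d : nat) (M : finPointedType).
Variable mu : probability (config d M) R.
Hypotheses (d0 : (0 < d)%N) (inv : aut_invariant mu).

Lemma marginal_arc_of r (i : 'I_d) :
  marginal (@arc_of d r M i) (law mu (S := fset_set (@S_ball d r.+1))) =1
  law mu (S := fset_set (@E_ball d r.+1)).
Proof.
apply: (@marginal_law _ _ _ _ _ _ _ (fun x => x \o first_arc_tree i)).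
  by apply: inv; exact: first_arc_aut.
move=> x; apply/ffunP => b; rewrite !ffunE /=.
have bS : first_arc_tree i (val b) \in fset_set (@S_ball d r.+1).
  rewrite S_ballE /= first_arc_size; apply: edge_label_size.
  exact: edge_memE.
by have := lookupE (restrict_config (fset_set (@S_ball d r.+1)) x) point [` bS]%fset; rewrite ffunE.
Qed.

(** An automorphism fixing the root carries the edge to 1 onto any other edge at the root, so by
    invariance the [d] averaged laws coincide. *)
Lemma edge_marginal_arc_of r :
  entropy (edge_marginal (@arc_of d r M) (law mu (S := fset_set (@S_ball d r.+1)))) =
  shannon mu (@E_ball d r.+1).
Proof.
rewrite shannon_law; apply: entropy_ext => a; rewrite /edge_marginal.
under eq_bigr => i _ do rewrite marginal_arc_of.
by rewrite sumr_const card_ord -[X in _ * X]mulr_natl mulrA mulVf ?mul1r // pnatr_eq0 -lt0n.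
Qed.

Definition label_set (P : pred label) : {fset tree d} :=
  fset_set [set t : tree d | P (val t)]%classic.

Lemma label_setE m (P : pred label) t : (forall l, P l -> (size l <= m)%N) ->
  (t \in label_set P) = P (val t).
Proof.
move=> Pm; rewrite in_fset_set; last by apply: (@finite_small_labels d m) => u /= /Pm.
by apply/idP/idP => [/set_mem|/mem_set].
Qed.

(** Submodularity is used twice. The larger ball is glued from [d] copies of [E2] along the smaller
    one, so [H S2 <= d * H E2 - (d - 1) * H S1]. The smaller ball and its flip have union [E2] and
    intersection [E1], so [H E2 + H E1 <= 2 * H S1]. Add the first bound to [d / 2] times the
    second. *)
Lemma Sigma_r_nonincreasing r : Sigma_r mu r.+2 <= Sigma_r mu r.+1.
Proof.
rewrite /Sigma_r !shannon_law.
set S1 := fset_set (S_ball r.+1); set S2 := fset_set (S_ball r.+2).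
set E1 := fset_set (E_ball r.+1); set E2 := fset_set (E_ball r.+2).
pose H (S : {fset tree d}) : R := entropy (law mu (S := S)).
rewrite -!/(H _).
pose arc i (l : label) := (size l <= r.+1)%N || (if l is k :: s then (k == i.+1) && (size s <= r.+1)%N else false).
(* The union of the first [i] copies of [E2]; for [i = 0] only the smaller ball remains. *)
pose arcs i (l : label) := (size l <= r.+1)%N || (if l is k :: s then (0 < k <= i)%N && (size s <= r.+1)%N else false).
have arc_sz i l : arc i l -> (size l <= r.+2)%N.
  by case/orP => [/leqW //|]; case: l => [//|k s] /andP[].
have arcs_sz i l : arcs i l -> (size l <= r.+2)%N.
  by case/orP => [/leqW //|]; case: l => [//|k s] /andP[].
have arcE (i : 'I_d) : H (label_set (arc i)) = H E2.
  rewrite /H; apply/esym; apply: (law_aut inv (first_arc_aut d0 i)) => t.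
  rewrite E_ballE // (label_setE _ (arc_sz i)) /arc /edge_label /= first_arc_size.
  congr (_ || _); have := tree_label_pos t; rewrite /=.
  case: (tree_val t) => [//|k s] /= /andP[k0 _].
  case: eqP => k1 /=; first by rewrite eqxx.
  by rewrite eqSS eq_sym (negbTE (neq_bump _ _)).
have arcs_step (i : 'I_d) :
    H (label_set (arcs i.+1)) + H S1 <= H (label_set (arcs i)) + H E2.
  rewrite -(arcE i); apply: le_trans (law_submodular mu _ _).
  rewrite le_eqVlt; apply/orP; left; apply/eqP; congr (H _ + H _); apply/fsetP => t.
    rewrite in_fsetU !(label_setE _ (arcs_sz _)) (label_setE _ (arc_sz _)) /arcs /arc.
    case: (size (val t) <= r.+1)%N => //=; case: (val t) => [//|k s].
    by case: (size s <= r.+1)%N; rewrite ?andbF ?andbT //; lia.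
  rewrite in_fsetI (label_setE _ (arcs_sz _)) (label_setE _ (arc_sz _)) S_ballE /arcs /arc.
  case: (size (val t) <= r.+1)%N => //=; case: (val t) => [//|k s].
  by case: (size s <= r.+1)%N; rewrite ?andbF ?andbT //; lia.
have arcs0 : H (label_set (arcs 0%N)) = H S1.
  congr (H _); apply/fsetP => t; rewrite (label_setE _ (arcs_sz _)) S_ballE /arcs.
  by case: (val t) => [//|k s]; case: k => [|k]; rewrite ?orbF.
have arcsd : H (label_set (arcs d)) = H S2.
  congr (H _); apply/fsetP => t; rewrite (label_setE _ (arcs_sz _)) S_ballE /arcs.
  have := valP t; case: (val t) => [//|k s] /= /andP[-> _] /=.
  by lia.
have h1 i : (i <= d)%N -> H (label_set (arcs i)) <= i%:R * H E2 - i%:R * H S1 + H S1.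
  elim: i => [|i IH] id; first by rewrite arcs0 !mul0r subrr add0r.
  have := arcs_step (Ordinal id); have := IH (ltnW id).
  by rewrite -[i.+1]addn1 natrD !mulrDl !mul1r /= addn1; lra.
have h2 : H E2 + H E1 <= 2 * H S1.
  pose flip_ball (l : label) := (size (flip_arc l) <= r.+1)%N.
  have flip_sz l : flip_ball l -> (size l <= r.+2)%N.
    rewrite /flip_ball; case: l => [//|k s] /=; case: eqP => k1 /=; last by move=> h; lia.
    by case: s => [//|b s] /=; lia.
  have fS : H (label_set flip_ball) = H S1.
    rewrite /H; apply: (law_aut inv (flip_aut d0)) => t.
    by rewrite (label_setE _ flip_sz) S_ballE.
  have -> : 2 * H S1 = H S1 + H (label_set flip_ball) by rewrite fS; lra.
  apply: le_trans (law_submodular mu _ _).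
  rewrite le_eqVlt; apply/orP; left; apply/eqP; congr (H _ + H _); apply/fsetP => t.
    rewrite in_fsetU S_ballE (label_setE _ flip_sz) E_ballE // /edge_label /flip_ball.
    case: (val t) => [//|k s] /=; case: eqP => k1 /=; last by lia.
    by case: s => [|b s] /=; lia.
  rewrite in_fsetI S_ballE (label_setE _ flip_sz) E_ballE // /edge_label /flip_ball.
  case: (val t) => [//|k s] /=; case: eqP => k1 /=; last by lia.
  by case: s => [|b s] /=; lia.
have := h1 d (leqnn d); rewrite arcsd.
have dR : 0 < d%:R :> R by rewrite ltr0n.
have := ler_wpM2l (divr_ge0 (ltW dR) (ler0n R 2)) h2; lra.
Qed.

End annealed.

(** * Weak convergence and restriction to balls *)

(** A path of length at most [k] from the root survives the restriction, since its own prefixes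
    witness that its vertices are in the ball. *)
Lemma restrict_ball_comp (M : Type) r k (g : lgraph M) : (r <= k)%N ->
  restrict_ball r (restrict_ball k g) = restrict_ball r g.
Proof.
move=> rk.
have sub s l : dist_le g s l -> (s <= k)%N -> dist_le (restrict_ball k g) s l.
  move=> [p [pp pl ps]] sk; exists p; split => //.
  suff h q l0 m : path (edge g) [::] q -> last [::] q = l0 -> (size q + size m <= k)%N ->
      path (edge g) l0 m -> path (edge (restrict_ball k g)) l0 m.
    by apply: (h [::] [::] p) => //=; exact: leq_trans ps sk.
  elim: m q l0 => [//|l1 m IH] q l0 pq ql sz /= /andP[e pm].
  rewrite e /=; apply/andP; split.
    apply/andP; split; apply/asboolP.
      by exists q; split => //; apply: leq_trans sz; exact: leq_addr.
    exists (rcons q l1); rewrite rcons_path pq ql e last_rcons size_rcons; split => //.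
    by apply: leq_trans sz; rewrite /= addnS ltnS leq_addr.
  apply: (IH (rcons q l1)) => //; rewrite ?rcons_path ?pq ?ql ?last_rcons ?size_rcons //.
  by rewrite addSn -addnS.
have D l : `[< dist_le (restrict_ball k g) r l >] = `[< dist_le g r l >].
  apply/asboolP/asboolP => [[p [pp pl ps]]|h]; last exact: sub.
  exists p; split => //; apply: sub_path pp => a b /= /and3P[] //.
have K l : `[< dist_le g r l >] -> `[< dist_le g k l >].
  by move=> /asboolP[p [pp pl ps]]; apply/asboolP; exists p; split => //; exact: leq_trans ps rk.
apply: lgraph_ext => l; first by rewrite /= D; case: ifP => // /K ->.
move=> m; rewrite /= !D.
case El: `[< dist_le g r l >]; last by rewrite /= !andbF.
case Em: `[< dist_le g r m >]; last by rewrite /= !andbF.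
by rewrite (K _ El) (K _ Em) !andbT.
Qed.

Lemma ball_restrict_comp (R : realType) (M : finPointedType) r k (g : graph_space R M) :
  (r <= k)%N -> ball_restrict r (ball_restrict k g) = ball_restrict r g.
Proof.
move=> rk; apply: eq_sig_hprop => [*|/=]; first exact: Prop_irrelevance.
exact: restrict_ball_comp.
Qed.

Section weak.
Variables (R : realType) (M : finPointedType).
Local Notation graphs := (graph_space R M).
Implicit Types (p q : probability graphs R).

Lemma near_ball_restrict k (g : graphs) :
  \forall h \near g, ball_restrict k h = ball_restrict k g.
Proof.
apply/nbhs_ballP; exists (2 ^- k) => /=; first by rewrite invr_gt0 exprn_gt0.
by move=> h; rewrite ballEmdist => /graph_dist_lt.
Qed.

Lemma continuous_local k (F : graphs -> R) :
  (forall g h, ball_restrict k g = ball_restrict k h -> F g = F h) -> continuous F.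
Proof.
move=> Fk g; apply: (@cvg_near_cst graphs R (F g) F (nbhs g)).
by apply: filterS (near_ball_restrict k g) => h; exact: Fk.
Qed.

Lemma integrals_continuous (F : bounded_continuous R M) :
  continuous ((fun q => integrals q F) : weak_topology R M -> R).
Proof.
move=> q; apply: (@continuous_comp (weak_topology R M) _ _ (@integrals R M) (proj F)).
  exact: initial_continuous.
move=> A /(@initial_continuous _ _ (proj F : (bounded_continuous R M -> R) -> R)) h.
have /cvg_sup/(_ F) c : (nbhs (integrals q) --> (integrals q : {ptws bounded_continuous R M -> R}))%classic by exact: cvg_id.
exact: (c _ h).
Qed.

(** Such sets are clopen, so their indicators are admissible test functions for the weak
    topology. *)
Definition local_set k (U : set graphs) : Prop :=
  forall g h, ball_restrict k g = ball_restrict k h -> U g -> U h.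

Lemma measurable_local_set k U : local_set k U -> measurable U.
Proof.
move=> Uk; apply: open_measurable_graphs.
rewrite openE => g Ug; apply: filterS (near_ball_restrict k g) => h hg.
exact: Uk Ug.
Qed.

Definition local_indicator k U (Uk : local_set k U) : bounded_continuous R M.
exists \1_U; split.
  apply: (@continuous_local k) => g h gh; rewrite !indicE; congr ((nat_of_bool _)%:R).
  by apply/idP/idP => /set_mem Ug; apply/mem_set; [apply: Uk Ug|apply: Uk Ug; rewrite gh].
exists 1; split => // x x1 g _; rewrite /= indicE.
by apply: le_trans (ltW x1); case: (_ \in _); rewrite ?normr1 ?normr0.
Defined.

Lemma integrals_local_indicator k U (Uk : local_set k U) q :
  integrals q (local_indicator Uk) = fine (q U).
Proof.
rewrite /integrals /Rintegral /= integral_indic ?setIT //.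
exact: measurable_local_set Uk.
Qed.

Variable dist : probability graphs R -> probability graphs R -> R.
Hypothesis wd : weak_distance dist.

Lemma weak_local_set k U p (eta : R) : local_set k U -> 0 < eta ->
  exists2 e, 0 < e & forall q, dist p q < e -> `|fine (q U) - fine (p U)| < eta.
Proof.
move=> Uk eta0; have [_ _ _ wopen] := wd.
pose W : set (weak_topology R M) := [set q | `|integrals q (local_indicator Uk) - integrals p (local_indicator Uk)| < eta]%classic.
have oW : open W.
  rewrite (_ : W = ((fun q => integrals q (local_indicator Uk)) : weak_topology R M -> R) @^-1`
     ball (integrals p (local_indicator Uk)) eta)%classic.
    apply: open_comp; last exact: ball_open.
    by move=> q _; exact: integrals_continuous.
  by apply/seteqP; split => q; rewrite /W /= /ball /= distrC.
have /wopen/(_ p)[|e e0 he] := oW; first by rewrite /W /= subrr normr0.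
by exists e => // q /he; rewrite /W /= !integrals_local_indicator.
Qed.

Lemma weak_local_sets (T : finType) k (U : T -> set graphs) p (eta : R) :
  (forall a, local_set k (U a)) -> 0 < eta ->
  exists2 e, 0 < e & forall q, dist p q < e -> forall a, `|fine (q (U a)) - fine (p (U a))| < eta.
Proof.
move=> Uk eta0.
suff [e e0 he] : exists2 e, 0 < e & forall q, dist p q < e ->
    forall a, a \in enum T -> `|fine (q (U a)) - fine (p (U a))| < eta.
  by exists e => // q /he h a; apply: h; rewrite mem_enum.
elim: (enum T) => [|a s [e e0 he]]; first by exists 1.
have [e1 e10 he1] := weak_local_set p (Uk a) eta0.
exists (Num.min e e1); first by rewrite lt_min e0.
move=> q; rewrite lt_min => /andP[qe qe1] b; rewrite inE => /orP[/eqP ->|bs].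
  exact: he1.
exact: he.
Qed.

Definition pull_ball (k : nat) (F : bounded_continuous R M) : bounded_continuous R M.
exists (sval F \o @ball_restrict R M k); split.
  by apply: (@continuous_local k) => g h /= ->.
case: (svalP F).2 => m [mr hm]; exists m; split => // x mx g _.
exact: (hm x mx (ball_restrict k g)).
Defined.

Lemma bounded_continuous_measurable (F : bounded_continuous R M) :
  measurable_fun [set: graphs] (sval F).
Proof.
apply: (measurability _ (RGenOInfty.measurableE R)) => //.
move=> _ [_ [a ->] <-]; rewrite setTI; apply: open_measurable_graphs.
apply: open_comp; last exact: interval_open.
by move=> g _; exact: (svalP F).1.
Qed.

Lemma integrals_ball_law (k : nat) F q : integrals (ball_law k q) F = integrals q (pull_ball k F).
Proof.
rewrite /integrals /Rintegral /=; congr fine.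
have mF : measurable_fun [set: graphs] (EFin \o sval F).
  by apply/measurable_EFinP; exact: bounded_continuous_measurable.
rewrite (integral_pushforward (measurable_ball_restrict k) _ _ measurableT) //.
rewrite preimage_setT; apply: (@measurable_bounded_integrable _ _ _ q (sval (pull_ball k F))) => //.
- exact: le_lt_trans (probability_le1 q measurableT) (ltry 1).
- exact: bounded_continuous_measurable.
- exact: (svalP (pull_ball k F)).2.
Qed.

(** Integrating [F] against a restricted law amounts to integrating [pull_ball k F], which is again
    bounded and continuous. *)
Lemma ball_law_continuous k : continuous (ball_law k : weak_topology R M -> weak_topology R M).
Proof.
apply: continuous_comp_initial => q.
have FF : Filter ((integrals (R:=R) (M:=M) \o ball_law k) @ nbhs (q : weak_topology R M))%classic.
  exact: fmap_filter.
apply/cvg_sup => F.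
apply: (@continuous_comp_initial _ (weak_topology R M) R (proj F) (integrals (R:=R) (M:=M) \o ball_law k)).
rewrite (_ : proj F \o _ = (fun q => integrals q (pull_ball k F))); last first.
  by apply/funext => q'; rewrite /= /proj integrals_ball_law.
exact: integrals_continuous.
Qed.

Lemma weak_ball_law k p (eta : R) : 0 < eta -> exists2 e, 0 < e &
  forall q, dist p q < e -> dist (ball_law k p) (ball_law k q) < eta.
Proof.
move=> eta0; have [d00 dsym dtri wopen] := wd.
have dist0 p' : dist p' p' = 0 by apply/d00.
pose V : set (weak_topology R M) := [set q | dist (ball_law k p) q < eta]%classic.
have oV : open V.
  apply/wopen => q Vq; exists (eta - dist (ball_law k p) q); first by rewrite subr_gt0.
  by move=> s; rewrite ltrBrDl; exact: le_lt_trans (dtri _ _ _).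
have oW : open (ball_law k @^-1` V : set (weak_topology R M))%classic.
  by apply: open_comp oV => q _; exact: ball_law_continuous.
have /wopen/(_ p)[|e e0 he] := oW; first by rewrite /= /V /= dist0.
by exists e.
Qed.

Lemma ball_law_comp r k q A : (r <= k)%N -> measurable A ->
  ball_law r (ball_law k q) A = ball_law r q A.
Proof.
move=> rk mA; rewrite /ball_law /distribution /pushforward /=; congr (q _).
by apply/seteqP; split => g; rewrite /= ball_restrict_comp.
Qed.

(** Restricting in two stages or in one gives laws known to agree on measurable sets only; they are
    at distance zero, and the triangle inequality concludes. *)
Lemma dist_ball_law r k p q : (r <= k)%N ->
  dist (ball_law r (ball_law k p)) (ball_law r (ball_law k q)) = dist (ball_law r p) (ball_law r q).
Proof.
move=> rk; have [d00 dsym dtri _] := wd.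
have z s : dist (ball_law r (ball_law k s)) (ball_law r s) = 0.
  by apply/d00 => A mA; exact: ball_law_comp.
have z' s : dist (ball_law r s) (ball_law r (ball_law k s)) = 0 by rewrite dsym.
apply/eqP; rewrite eq_le; apply/andP; split.
  apply: le_trans (dtri _ (ball_law r p) _) _; rewrite z add0r.
  by apply: le_trans (dtri _ (ball_law r q) _) _; rewrite z' addr0.
apply: le_trans (dtri _ (ball_law r (ball_law k p)) _) _; rewrite z' add0r.
by apply: le_trans (dtri _ (ball_law r (ball_law k q)) _) _; rewrite z addr0.
Qed.

End weak.

(** * From the random labeling to the mean type *)

Lemma averageE (disp : measure_display) (T : measurableType disp) (R : realType)
    (I : finType) (P : I -> probability T R) A : (0 < #|I|)%N ->
  average P A = ((#|I|%:R^-1)%:E * \sum_(i : I) P i A)%E.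
Proof. by move=> I0; rewrite /average -[(_ == 0)%N]negbK -lt0n I0. Qed.

Section ball_patterns.
Variables (R : realType) (d r : nat) (M : finPointedType).
Local Notation graphs := (graph_space R M).
Local Notation T := (ball_type d r M).
Local Notation k := (r.+1).
Implicit Types (a : T).

Definition extension a : config d M := fun t => lookup a point (val t).

Definition pattern a : set graphs :=
  [set g | ball_restrict k g = ball_restrict k (rooted_tree R (extension a))]%classic.

Lemma pattern_local a : local_set k (pattern a).
Proof. by move=> g h gh; rewrite /pattern /= gh. Qed.

Lemma pattern_restrict a g : pattern a (ball_restrict k g) = pattern a g.
Proof. by rewrite /pattern /= ball_restrict_comp. Qed.

Lemma rooted_tree_pattern a (x : config d M) :
  (forall b : fset_set (@S_ball d k), x (val b) = a b) -> pattern a (rooted_tree R x).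
Proof.
move=> xa; apply: eq_sig_hprop => [*|/=]; first exact: Prop_irrelevance.
have xE (t : tree d) : (size (val t) <= k)%N -> x t = extension a t.
  move=> tk; have tS : t \in fset_set (@S_ball d k) by rewrite S_ballE.
  have := xa [` tS]%fset; rewrite /= => ->.
  by have := lookupE a point [` tS]%fset; rewrite /extension.
apply: lgraph_ext => l //=.
case: insubP => [u _ ul|_] /=; last by do !case: ifP.
by rewrite -ul !tree_dist_le; case: ifP => // /xE ->.
Qed.

Lemma law_le_pattern (mu : probability (config d M) R) a :
  law mu a <= fine (ball_law k (tree_law mu) (pattern a)).
Proof.
have mp : measurable (pattern a) by exact: measurable_local_set (@pattern_local a).
have mA : measurable [set x : config d M | forall b : fset_set (@S_ball d k), x (val b) = a b]%classic.
  rewrite (_ : (mkset _) = [set x : config d M | pred1 a (restrict_config _ x)]%classic).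
    exact: measurable_restrict_config.
  by apply/seteqP; split => x /= => [/restrict_eq/eqP|/eqP/restrict_eq].
have mB : measurable (ball_restrict k @^-1` pattern a)%classic.
  by have := @measurable_ball_restrict R M k measurableT (pattern a) mp; rewrite setTI.
have mC : measurable (@rooted_tree R d M @^-1` (ball_restrict k @^-1` pattern a))%classic.
  by have := @measurable_rooted_tree R d M measurableT _ mB; rewrite setTI.
apply: (@fine_le _ (mu _) (mu (@rooted_tree R d M @^-1` (ball_restrict k @^-1` pattern a))%classic));
  rewrite ?fin_num_measure //.
apply: le_measure; rewrite ?inE // => x /= xa.
by rewrite pattern_restrict; exact: rooted_tree_pattern.
Qed.

Variables (n : nat) (G : simple_graph n) (f : {ffun 'I_n -> M}).

Definition bfs_pattern v a : {set {perm 'I_n}} :=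
  [set s | `[< pattern a (labeled_graph R G f v s) >]].

Lemma ball_law_distr a : (0 < n)%N ->
  fine (ball_law k (distr R G f) (pattern a)) =
  (\sum_v #|bfs_pattern v a|%:R / #|{perm 'I_n}|%:R) / n%:R.
Proof.
move=> n0.
have P0 : (0 < #|{perm 'I_n}|)%N by apply/card_gt0P; exists 1%g.
have at_v v : distr_at R G f v (@ball_restrict R M k @^-1` pattern a)%classic =
    (#|bfs_pattern v a|%:R / #|{perm 'I_n}|%:R)%:E.
  apply: (etrans (averageE (fun s => \d_(labeled_graph R G f v s)) _ P0)).
  rewrite [X in (_ * X)%E](_ : _ = #|bfs_pattern v a|%:R%:E) -?EFinM 1?mulrC //.
  transitivity (\sum_(s : {perm 'I_n})
      (labeled_graph R G f v s \in (@ball_restrict R M k @^-1` pattern a)%classic)%:R%:E : \bar R)%E.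
    by apply: eq_bigr => s _; exact: diracE.
  rewrite sumEFin -natr_sum; congr (_%:R%:E).
  rewrite -sum1_card [RHS]big_mkcond; apply: eq_bigr => s _; rewrite inE.
  case: asboolP => h; first by rewrite mem_set //= pattern_restrict.
  by rewrite memNset //= pattern_restrict.
have V0 : (0 < #|'I_n|)%N by rewrite card_ord.
rewrite /ball_law /distribution /pushforward /=.
rewrite [X in fine X](_ : _ = (n%:R^-1%:E * \sum_(v : 'I_n) distr_at R G f v (@ball_restrict R M k @^-1` pattern a)%classic)%E); last first.
  by apply: (etrans (averageE (distr_at R G f) _ V0)); rewrite card_ord.
rewrite (eq_bigr _ (fun v _ => at_v v)).
by rewrite sumEFin -EFinM /= mulrC.
Qed.

Hypothesis reg : is_regular d G.

Definition colored_embeddings v a : {set {ffun fset_set (@S_ball d k) -> 'I_n}} :=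
  [set x in embeddings d k G v | [forall b, f (x b) == a b]].

Lemma bfs_pattern_traced v a :
  bfs_pattern v a \subset [set s | traced_by d k v (sorted_adj G s) \in colored_embeddings v a].
Proof.
apply/fintype.subsetP => s; rewrite inE => /asboolP h; rewrite inE.
have ball_tree : restrict_ball k (labeling (sorted_adj G s) v f) =
    restrict_ball k (tree_graph (extension a)) := congr1 sval h.
have eG : enumerates G (sorted_adj G s).
  by move=> u; split; [exact: sorted_adj_uniq|exact: mem_sorted_adj].
rewrite inE; apply/andP; split.
  exact: traced_embedding (bfs_embedding eG ball_tree).
apply/forallP => b; rewrite ffunE; apply/eqP.
rewrite (bfs_color eG ball_tree).
  by rewrite /extension lookupE.
by rewrite -S_ballE; exact: valP.
Qed.

(** The left side vanishes unless the ball of [v] is a tree. In that case permutations and orders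
    both trace uniform embeddings, and an embedding with colors [a] gives the type [a]. *)
Lemma bfs_pattern_le v a :
  #|bfs_pattern v a|%:R / #|{perm 'I_n}|%:R <=
  #|[set s in order_systems d G | @types_of n d r M f s v == a]|%:R / #|order_systems d G|%:R :> R.
Proof.
have O0 : 0 < #|order_systems d G|%:R :> R by rewrite ltr0n order_systems_gt0.
have P0 : 0 < #|{perm 'I_n}|%:R :> R by rewrite ltr0n; apply/card_gt0P; exists 1%g.
rewrite ler_pdivrMr // mulrAC ler_pdivlMr // -!natrM ler_nat.
apply: leq_trans (leq_mul (subset_leq_card (bfs_pattern_traced v a)) (leqnn _)) _.
have QX : colored_embeddings v a \subset embeddings d k G v.
  by apply/fintype.subsetP => x; rewrite inE => /andP[].
apply: leq_trans (card_traced_le reg QX) _; rewrite leq_mul2r; apply/orP; right.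
apply: subset_leq_card; apply/fintype.subsetP => s.
move=> /setIdP[sO /setIdP[_ /forallP fa]]; rewrite inE sO /=.
by apply/eqP; rewrite ffunE; apply/ffunP => b; have /eqP := fa b; rewrite !ffunE.
Qed.

Lemma pattern_le_mean a : (0 < n)%N ->
  fine (ball_law k (distr R G f) (pattern a)) <= mean_type R G f a.
Proof.
move=> n0; rewrite ball_law_distr // ler_wpM2r ?invr_ge0 //.
by apply: ler_sum => v _; exact: bfs_pattern_le.
Qed.

End ball_patterns.

(** * The first moment bound *)

Section first_moment.
Variables (R : realType) (d r : nat) (M : finPointedType).
Variable dist : probability (graph_space R M) R -> probability (graph_space R M) R -> R.
Variable mu : probability (config d M) R.
Hypotheses (d0 : (0 < d)%N) (wd : weak_distance dist) (inv : aut_invariant mu).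
Local Notation T := (ball_type d r M).
Local Notation k := (r.+1).

(* [mean_type] dominates the law of the tree patterns up to an error, and two
   probabilities that are ordered up to an error are close: no separate estimate is
   needed for vertices whose ball is not a tree. *)
Lemma mean_type_close (eta : R) : 0 < eta -> exists2 e, 0 < e &
  forall n (G : simple_graph n) (f : {ffun 'I_n -> M}), (0 < n)%N -> is_regular d G ->
    good_coloring dist mu G k e f ->
    forall a : T, `|mean_type R G f a - law mu a| <= eta.
Proof.
move=> eta0; have T0 : (0 < #|{: T}|)%N by apply/card_gt0P; exists [ffun=> point].
have TR : 0 < #|{: T}|%:R :> R by rewrite ltr0n.
have [_ dsym _ _] := wd.
have [e e0 he] := weak_local_sets wd (ball_law k (tree_law mu))
  (fun a : T => @pattern_local R d r M a) (divr_gt0 eta0 TR).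
exists (e / 2); first by rewrite divr_gt0.
move=> n G f n0 reg good.
have lb (a : T) : law mu a - eta / #|{: T}|%:R <= mean_type R G f a.
  refine (le_trans _ (@pattern_le_mean R d r M n G f reg a n0)).
  apply: le_trans (lerB (law_le_pattern mu a) (lexx _)) _.
  have close : dist (ball_law k (tree_law mu)) (ball_law k (distr R G f)) < e.
    rewrite dsym; apply: le_lt_trans good _.
    by rewrite ltr_pdivrMr // mulr_natr mulr2n ltrDl.
  by have := he _ close a; rewrite ltr_norml => /andP[h _]; lra.
have [m0 m1] := @mean_type_dist R n d r M G f reg n0.
have [l0 l1] := law_dist mu (fset_set (@S_ball d k)).
have Teta : #|{: T}|%:R * (eta / #|{: T}|%:R) = eta by rewrite mulrC divfK // gt_eqF.
move=> a; rewrite ler_norml; apply/andP; split.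
  have := lb a; have : eta / #|{: T}|%:R <= eta.
    by rewrite ler_pdivrMr // ler_peMr ?(ltW eta0) // ler1n.
  lra.
(* By [lb] the summands are nonnegative, so none exceeds their total; this is why the error for each
   type was [eta / #|T|]. *)
have : \sum_(b : T) (mean_type R G f b - law mu b + eta / #|{: T}|%:R) = eta.
  rewrite big_split /= sumrB m1 l1 subrr add0r sumr_const -[_ *+ _]mulr_natl.
  exact: Teta.
rewrite (bigD1 a) //= => <-; rewrite -addrA lerDl; apply: addr_ge0.
  by rewrite divr_ge0 // ltW.
by apply: sumr_ge0 => b _; have := lb b; lra.
Qed.

Definition good_pairs n (e : R) : {set simple_graph n * {ffun 'I_n -> M}} :=
  [set x | is_regular d x.1 && good_coloring dist mu x.1 k e x.2].

(** Each good pair has at least [d! ^ n / 2] typical orders, and the ordered colored graphs so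
    obtained inject into the typical pairs. The factor [d! ^ n] cancels against the orders counted
    in [card_simple_matchings_le]. *)
Lemma card_good_pairs (delta : R) : 0 < delta -> exists2 e, 0 < e &
  exists n0, forall n, (n0 <= n)%N ->
    #|good_pairs n e|%:R <= #|[pred G : simple_graph n | is_regular d G]|%:R *
      expR (n%:R * (Sigma_r mu k + delta)) :> R.
Proof.
move=> delta0; have d2 : 0 < delta / 2 by rewrite divr_gt0.
pose muT : T -> R := law mu (S := fset_set (@S_ball d k)).
have muTd : is_dist muT by exact: law_dist.
have [e1 e10 [n1 H1]] := card_typical_pairs (@arc_of d r M) d0 (@reverseK d r M d0) muTd d2.
have e12 : 0 < e1 / 2 by rewrite divr_gt0.
have [e e0 He] := mean_type_close e12.
pose c := (d.+1 * d)%N.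
(* This power dominates [2 * (2 * n * d + 1) ^ (4 * c)]: the leading 2 accounts for atypical orders,
   the power for matchings that are not simple. *)
have [n2 H2] := @poly_le_exp R (2 * (2 * d%:R + 1)) (delta / 2) (4 * c)%N ltac:(by rewrite mulr_ge0 // addr_ge0 // mulr_ge0) d2.
pose X : R := (2 * #|{: T}| * (d.+1 ^ k * d.+1 ^ k))%:R / (e1 / 2) ^+ 2.
(* The bound [4 * d.+1 <= n] gives [4 * c <= n * d], required by the switchings; [X <= n] is the
   condition of [typical_systems]. *)
exists e => //; exists (maxn (maxn n1 n2) (maxn (4 * d.+1) (Num.truncn X).+1)).
move=> n; rewrite !geq_max => /andP[/andP[nn1 nn2] /andP[nd nX]].
have n0 : (0 < n)%N by apply: leq_trans nd; rewrite muln_gt0.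
have nT : (2 * #|{: T}| * (d.+1 ^ k * d.+1 ^ k))%:R <= n%:R * (e1 / 2) ^+ 2 :> R.
  rewrite -ler_pdivrMr ?exprn_gt0 //; apply: ltW; apply: lt_le_trans (truncnS_gt _) _.
  by rewrite ler_nat.
pose orders := {ffun 'I_n -> {ffun 'I_d -> 'I_n}}.
pose typ (G : simple_graph n) (f : {ffun 'I_n -> M}) : {set orders} :=
  [set s in order_systems d G | [forall a : T, `|empirical R (@types_of n d r M f s) a - mean_type R G f a| < e1 / 2]].
pose W := [set y : (simple_graph n * orders) * {ffun 'I_n -> M} |
  ((y.1.1, y.2) \in good_pairs n e) && (y.1.2 \in typ y.1.1 y.2)].
pose c_n := (d`! ^ n)%N.
have ZW : (#|good_pairs n e| * c_n <= 2 * #|W|)%N.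
  have -> : #|W| = (\sum_(x in good_pairs n e) #|typ x.1 x.2|)%N.
    rewrite -sum1_card (partition_big (fun y => (y.1.1, y.2)) (mem (good_pairs n e))) /=; last first.
      by move=> y; rewrite inE => /andP[].
    apply: eq_bigr => -[G f] xg; rewrite sum1_card /= -(card_imset _ (_ : injective (fun s : orders => ((G, s), f)))); last first.
      by move=> s t [].
    apply: eq_card => -[[G' s'] f']; apply/andP/imsetP => [[h /eqP[<- <-]]|[s sT [-> -> ->]]].
      by exists s' => //; move: h; rewrite inE => /andP[].
    by rewrite inE /= xg sT eqxx.
  rewrite big_distrr /= -sum_nat_const; apply: leq_sum => -[G f]; rewrite inE /= => /andP[reg good].
  by rewrite /c_n -(card_order_systems reg); apply: typical_systems.
pose P := [set it : {perm 'I_n * 'I_d} * {ffun 'I_n -> T} |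
        [&& it.1 \in matchings ('I_n * 'I_d)%type,
            compatible (@reverse d r M) (half_edge_types (@arc_of d r M) it.2) it.1 &
            [forall a, `|empirical R it.2 a - muT a| <= e1]]].
(* The matching determines the ordered graph, and the value of each type at the root label returns
   the color of the vertex. *)
have WP : (#|W| <= #|P|)%N.
  pose F (y : (simple_graph n * orders) * {ffun 'I_n -> M}) := (arc_matching y.1.2, @types_of n d r M y.2 y.1.2).
  have Finj : {in W &, injective F}.
    move=> [[G s] f] [[G' s'] f'] yW yW' [am ty].
    move: yW; rewrite inE /= => /andP[]; rewrite inE /= => /andP[reg _] /setIdP[sO _].
    move: yW'; rewrite inE /= => /andP[]; rewrite inE /= => /andP[reg' _] /setIdP[sO' _].
    have [] : (G, s) = (G', s').
      by apply: (@arc_matching_inj n d (G, s) (G', s') _ _ am); apply/setIdP; split.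
    move=> -> ->; congr (_, _); apply/ffunP => v.
    have rt : Tree (isT : tree_label d [::]) \in fset_set (@S_ball d k) by rewrite S_ballE.
    have := congr1 (fun g : {ffun 'I_n -> T} => g v [` rt]%fset) ty.
    by rewrite !ffunE.
  rewrite -(card_in_imset Finj); apply: subset_leq_card.
  apply/fintype.subsetP => _ /imsetP[[[G s] f] yW ->]; move: yW.
  rewrite inE /= => /andP[]; rewrite inE /= => /andP[reg good] /setIdP[sO /forallP cl].
  rewrite inE /=; apply/and3P; split.
    exact: arc_matching_matching reg sO.
    exact: (@arc_matching_compatible n d G s reg sO r M f d0).
  apply/forallP => a; have h1 := cl a; have h2 := He n G f n0 reg good a.
  apply: le_trans (ler_distD (mean_type R G f a) _ _) _.
  by move: (ltW h1) h2; rewrite -/muT; lra.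
have Pb := H1 n nn1; rewrite -/P edge_marginal_arc_of // -/muT in Pb.
have Mb : (#|matchings ('I_n * 'I_d)%type| <= (2 * (n * d)).+1 ^ (4 * c) *
   (#|[pred G : simple_graph n | is_regular d G]| * c_n))%N.
  apply: leq_trans (card_matchings_le _ _) _.
  - by rewrite mulnA leq_mul2r nd orbT.
  - by rewrite muln_gt0 n0.
  - by rewrite leq_mul2l card_simple_matchings_le orbT.
set g := #|[pred G : simple_graph n | is_regular d G]| in Mb *.
have cn0 : 0 < c_n%:R :> R by rewrite ltr0n expn_gt0 fact_gt0.
have : #|good_pairs n e|%:R * c_n%:R <= 2 * #|W|%:R :> R by rewrite -!natrM ler_nat.
have WP' : #|W|%:R <= #|P|%:R :> R by rewrite ler_nat.
have Mb' : #|matchings ('I_n * 'I_d)%type|%:R <= (2 * (n * d)).+1%:R ^+ (4 * c) * (g%:R * c_n%:R) :> R.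
  by rewrite -natrX -!natrM ler_nat.
have poly : 2 * (2 * (n * d)).+1%:R ^+ (4 * c) <= expR (n%:R * (delta / 2)) :> R.
  apply: le_trans (H2 n nn2).
  have c4 : (0 < 4 * c)%N by rewrite /c !muln_gt0 d0.
  rewrite -(prednK c4) [X in 2 * X]exprS [X in _ <= X]exprS mulrA.
  have base : 2 * (2 * (n * d)).+1%:R <= 2 * (2 * d%:R + 1) * n%:R :> R.
    have n1R : 1 <= n%:R :> R by rewrite ler1n.
    by rewrite -[(2 * (n * d)).+1]addn1 natrD !natrM; lra.
  apply: ler_pM; [by rewrite mulr_ge0|by rewrite exprn_ge0|exact: base|].
  apply: lerXn2r; rewrite ?nnegrE ?mulr_ge0 ?addr_ge0 ?mulr_ge0 //.
  by apply: le_trans base; rewrite ler_peMl // ler1n.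
move=> ZW'; rewrite -(ler_pM2r cn0); apply: le_trans ZW' _.
apply: le_trans (_ : _ <= 2 * #|P|%:R) _; first by rewrite ler_pM2l.
apply: le_trans (ler_wpM2l _ Pb) _ => //.
set ex := expR _ in Pb *; have ex0 : 0 <= ex by exact: expR_ge0.
apply: le_trans (_ : _ <= 2 * ((2 * (n * d)).+1%:R ^+ (4 * c) * (g%:R * c_n%:R) * ex)) _.
  by rewrite ler_pM2l // ler_wpM2r.
have -> : expR (n%:R * (Sigma_r mu k + delta)) = ex * expR (n%:R * (delta / 2)).
  rewrite -expRD; congr expR; rewrite /Sigma_r shannon_law -/muT; lra.
have := ler_wpM2r (mulr_ge0 (mulr_ge0 (ler0n R g) (ltW cn0)) ex0) poly; lra.
Qed.

End first_moment.

(** * Upper sofic entropy *)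

Section upper_entropy.
Variables (R : realType) (d : nat) (M : finPointedType).
Variable dist : probability (graph_space R M) R -> probability (graph_space R M) R -> R.
Variable mu : probability (config d M) R.
Variable alpha : R.
Hypothesis alpha0 : 0 < alpha.

Lemma H_graph_le n (G : simple_graph n) r r' e e' :
  (forall f, good_coloring dist mu G r e f -> good_coloring dist mu G r' e' f) ->
  (H_graph dist mu G r e <= H_graph dist mu G r' e')%E.
Proof.
move=> gg; apply: lee_wpmul2r; first by rewrite lee_fin invr_ge0.
rewrite lee_lne ?in_itv /= ?leey ?lee_fin ?ler0n //.
by rewrite ler_nat; apply: subset_leq_card; apply/fintype.subsetP => f; exact: gg.
Qed.

Lemma h_n_le n r r' e e' :
  (forall (G : simple_graph n) f, good_coloring dist mu G r e f -> good_coloring dist mu G r' e' f) ->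
  (h_n dist mu n r e alpha <= h_n dist mu n r' e' alpha)%E.
Proof.
move=> gg; apply: ereal_sup_le => h /= [h0 ah]; split => //; apply: le_trans ah _.
rewrite /prob_H_ge ler_wpM2r ?invr_ge0 // ler_nat; apply: subset_leq_card.
apply/fintype.subsetP => G; rewrite !inE => /andP[-> /le_trans]; apply.
by apply: H_graph_le => f; exact: gg.
Qed.

Lemma limf_esup_le (u v : nat -> \bar R) (F : set (set nat)) :
  (forall n, (u n <= v n)%E) -> (limf_esup u F <= limf_esup v F)%E.
Proof.
move=> uv; apply: le_ereal_inf_tmp => _ [V FV <-].
apply: le_trans (_ : _ <= ereal_sup (u @` V)%classic)%E _.
  by apply: ereal_inf_lbound; exists V.
by apply: ge_ereal_sup => _ [n Vn <-]; apply: le_trans (uv n) _; apply: ereal_sup_ubound; exists n.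
Qed.

Definition upper_rate r e : \bar R :=
  limf_esup (fun n => h_n dist mu n r e alpha) (within (admissible d) \oo)%classic.

Lemma upper_rate_nondecreasing r e e' : e <= e' -> (upper_rate r e <= upper_rate r e')%E.
Proof.
move=> ee; apply: limf_esup_le => n; apply: h_n_le => G f h; exact: le_trans ee.
Qed.

Lemma upper_rate_cvg r : cvg (upper_rate r e @[e --> 0^'+])%classic.
Proof.
apply: nondecreasing_at_right_is_cvge; near=> x => e e' _ _; exact: upper_rate_nondecreasing.
Unshelve. all: by end_near. Qed.

Hypotheses (d0 : (0 < d)%N) (wd : weak_distance dist).

(** The tolerance [e'] at radius [r] is fixed first; by continuity of restriction, a small enough
    tolerance at radius [r + 1] then forces it. *)
Lemma hbar_rS_le r : (hbar_r dist mu r.+1 alpha <= hbar_r dist mu r alpha)%E.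
Proof.
rewrite /hbar_r -!/(upper_rate _ _).
apply: lime_ge; first exact: upper_rate_cvg.
near=> e'; have e'0 : 0 < e' by near: e'; exact: nbhs_right_gt.
apply: lime_le; first exact: upper_rate_cvg.
have [e e0 he] := weak_ball_law wd r (ball_law r.+1 (tree_law mu)) e'0.
have [_ dsym _ _] := wd.
near=> x; apply: limf_esup_le => n; apply: h_n_le => G f good.
rewrite /good_coloring -(dist_ball_law wd _ _ (leqnSn r)) dsym; apply: ltW; apply: he.
rewrite dsym; apply: le_lt_trans good _; near: x; exact: nbhs_right_lt.
Unshelve. all: by end_near. Qed.

Hypothesis inv : aut_invariant mu.

Lemma h_n_le_Sigma r (delta : R) : 0 < delta -> exists2 e, 0 < e & exists n0, forall n,
  (n0 <= n)%N -> (h_n dist mu n r.+1 e alpha <= (Sigma_r mu r.+1 + delta)%:E)%E.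
Proof.
move=> delta0; have d2 : 0 < delta / 2 by rewrite divr_gt0.
have [e e0 [n0 H]] := @card_good_pairs R d r M dist mu d0 wd inv _ d2.
(* Beyond this rank the factor [1 / alpha] is at most [expR (n * delta / 2)]. *)
exists e => //; exists (maxn n0 (Num.truncn (- ln alpha / (delta / 2))).+1) => n.
rewrite geq_max => /andP[nn0 nX].
have n_gt0 : (0 < n)%N by exact: leq_trans nX.
have nR : 0 < n%:R :> R by rewrite ltr0n.
apply: ge_ereal_sup => h /= [[-> _|]]; first by rewrite leNye.
case: h => [h _| |//]; last by rewrite ltxx andbF.
rewrite /prob_H_ge; set A := #|[pred G : simple_graph n | is_regular d G && _]|.
set B := #|[pred G : simple_graph n | is_regular d G]| => aAB.
(* Without regular graphs the proportion is zero, as the inverse of zero is zero, and cannot reach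
   [alpha]. *)
have B0 : 0 < B%:R :> R.
  rewrite ltr0n lt0n; apply/eqP => B0; move: aAB; rewrite B0 invr0 mulr0.
  by rewrite leNgt alpha0.
rewrite ler_pdivlMr // in aAB.
(* Markov's inequality: each graph counted by [A] has at least [expR (n * h)] good colorings. *)
have AP : A%:R * expR (n%:R * h) <= #|good_pairs r dist mu n e|%:R :> R.
  have -> : #|good_pairs r dist mu n e| =
      (\sum_(G : simple_graph n | is_regular d G) #|[pred f | good_coloring dist mu G r.+1 e f]|)%N.
    rewrite -sum1_card.
    rewrite (eq_bigl (fun x : simple_graph n * {ffun 'I_n -> M} => is_regular d x.1 && good_coloring dist mu x.1 r.+1 e x.2)); last by move=> x; rewrite inE.
    rewrite -(pair_big_dep (fun G => is_regular d G) (fun G f => good_coloring dist mu G r.+1 e f) (fun _ _ => 1%N)) /=.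
    by apply: eq_bigr => G _; rewrite sum1_card.
  rewrite natr_sum (bigID (fun G => h%:E <= H_graph dist mu G r.+1 e)%E) /= -[X in X <= _]addr0.
  apply: lerD; last by apply: sumr_ge0.
  rewrite mulr_natl -sumr_const; apply: ler_sum => G; rewrite inE => /andP[_].
  rewrite /H_graph; set N := #|_|; case: (posnP N) => [->|N0].
    rewrite /= lexx mulNyr gtr0_sg ?mul1e ?invr_gt0 //.
  rewrite lne_EFin ?ltr0n // -EFinM lee_fin ler_pdivlMr // => hN.
  by rewrite -[X in _ <= X]lnK ?posrE ?ltr0n // ler_expR mulrC.
have := H n nn0; rewrite -/B => PB.
have : alpha * B%:R * expR (n%:R * h) <= B%:R * expR (n%:R * (Sigma_r mu r.+1 + delta / 2)).
  apply: le_trans PB; apply: le_trans AP; by rewrite ler_wpM2r ?expR_ge0.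
rewrite mulrAC [B%:R * _]mulrC ler_pM2r // -[X in X * _](@lnK R alpha) ?posrE // -expRD ler_expR => hh.
have la : - ln alpha <= n%:R * (delta / 2).
  rewrite -ler_pdivrMr //; apply: ltW; apply: lt_le_trans (truncnS_gt _) _.
  by rewrite ler_nat.
rewrite lee_fin -(ler_pM2l nR); lra.
Qed.

Lemma hbar_r_le_Sigma r : (hbar_r dist mu r.+1 alpha <= (Sigma_r mu r.+1)%:E)%E.
Proof.
apply/lee_addgt0Pr => delta delta0; rewrite -EFinD.
have [e e0 [n0 H]] := h_n_le_Sigma r delta0.
apply: lime_le; first exact: upper_rate_cvg.
near=> x; apply: le_trans (_ : upper_rate r.+1 e <= _)%E.
  by apply: upper_rate_nondecreasing; near: x; exact: nbhs_right_le.
apply: (@le_trans _ _ (ereal_sup ((fun n => h_n dist mu n r.+1 e alpha) @` [set n | (n0 <= n)%N])%classic)).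
  apply: ereal_inf_lbound; exists [set n | (n0 <= n)%N]%classic => //.
  by exists n0 => // n /= nn _.
by apply: ge_ereal_sup => _ [n /= nn <-]; exact: H.
Unshelve. all: by end_near. Qed.

Lemma hbar_cvg : cvgn (hbar_r dist mu ^~ alpha).
Proof.
apply: ereal_nonincreasing_is_cvgn; apply/nonincreasing_seqP => r; exact: hbar_rS_le.
Qed.

Lemma Sigma_cvg : cvgn (fun r => (Sigma_r mu r)%:E).
Proof.
(* Monotonicity is established from radius 1 on, and a shift does not change convergence. *)
have : cvgn (fun r => (Sigma_r mu r.+1)%:E).
  apply: ereal_nonincreasing_is_cvgn; apply/nonincreasing_seqP => r.
  by rewrite lee_fin; exact: Sigma_r_nonincreasing.
by move=> /cvg_ex[l hl]; apply/cvg_ex; exists l; rewrite -(cvg_shiftS (fun r => (Sigma_r mu r)%:E)).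
Qed.

End upper_entropy.

Theorem theorem1p5 (R : realType) (d : nat) (M : finPointedType)
    (dist : probability (graph_space R M) R -> probability (graph_space R M) R -> R)
    (mu : probability (config d M) R) (alpha : R) :
  (3 <= d)%N -> weak_distance dist -> aut_invariant mu -> 0 < alpha < 1 ->
  (forall r : nat, (1 <= r)%N -> (hbar_r dist mu r alpha <= (Sigma_r mu r)%:E)%E) /\
  (hbar dist mu alpha <= Sigma mu)%E.
Proof.
move=> d3 wd inv /andP[alpha0 _]; have d0 : (0 < d)%N by exact: leq_trans d3.
have le r : (1 <= r)%N -> (hbar_r dist mu r alpha <= (Sigma_r mu r)%:E)%E.
  by case: r => // r _; exact: hbar_r_le_Sigma.
split=> //; apply: lee_lim; [exact: hbar_cvg|exact: Sigma_cvg|].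
by exists 1%N => // r /=; exact: le.
Qed.
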